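(* Let $\alpha$ be a Liouville number. Then the set $S_\alpha^0=\{f\in F_\alpha\mid \dim_H(\mu_f)=0\}$ contains a countable intersection $\bigcap_{n} U_n$ of subsets $U_n\subset F_\alpha$, each of which is open in $F_\alpha$ in the $C^0$ topology and dense in $F_\alpha$ in the $C^\infty$ topology.
   Context: $S^1=\mathbb{R}/\mathbb{Z}$. $F$ is the group of orientation preserving $C^\infty$ diffeomorphisms of $S^1$. For $\alpha\in\mathbb{R}/\mathbb{Z}$, $F_\alpha\subset F$ is the subspace of all diffeomorphisms with rotation number $\alpha$ (a real number is also regarded as its class in $\mathbb{R}/\mathbb{Z}$). For $\alpha$ irrational and $f\in F_\alpha$, $\mu_f$ denotes the unique $f$-invariant Borel probability measure on $S^1$. An irrational number $\alpha$ is a Liouville number if for any $N\in\mathbb{N}$ there is a rational $p/q$ with $(p,q)=1$ and $q\ge 2$ such that $|\alpha-p/q|<1/q^N$. For a probability measure $\mu$ on a compact metric space $X$, $\dim_H(\mu)=\inf\{\dim_H Z\mid Z\subset X \text{ measurable},\ \mu(Z)=1\}$, where $\dim_H Z$ is the usual Hausdorff dimension of the set $Z$. The $C^0$ topology on $F_\alpha$ is that of uniform convergence of $f$ and $f^{-1}$; the $C^\infty$ topology is that of uniform convergence of $f$ and $f^{-1}$ together with all derivatives. *)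

(* Defs.v *)
From HB Require Import structures.
From mathcomp Require Import all_boot all_order all_algebra.
From mathcomp Require Import generic_quotient ring_quotient lra.
From mathcomp Require Import all_classical all_reals all_analysis.

Set Implicit Arguments.
Unset Strict Implicit.
Unset Printing Implicit Defensive.

Import Order.TTheory GRing.Theory Num.Theory.
Import numFieldNormedType.Exports.
Import numFieldTopology.Exports.

Local Open Scope classical_set_scope.
Local Open Scope ring_scope.
Local Open Scope quotient_scope.

Section Liouville.
Context {R : realType}.

Definition liouville (a : R) :=
  irrational a /\
  forall N : nat, exists (p : int) (q : nat),
    [/\ (2 <= q)%N, coprime `|p|%N q & `|a - p%:~R / q%:R| < 1 / q%:R ^+ N].

End Liouville.

Section Circle.
Variable R : realType.

(* The additive subgroup of integers, i.e. [Num.int]; despite its notation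
   [{ideal_quot _}], [Quotient.quot] divides a group by any such subgroup. *)
Definition Zint := GRing.ZmodClosed.clone R (@Num.int_num_subdef R) _.

Definition circle : Type := Quotient.quot Zint.

HB.instance Definition _ := GRing.Zmodule.on circle.
HB.instance Definition _ := isPointed.Build circle 0.

Definition proj (t : R) : circle := \pi_(Quotient.quot Zint) t.

Lemma projB : {morph proj : s t / s - t}.
Proof. by move=> s t; rewrite /proj raddfB. Qed.

Lemma proj0 : proj 0 = 0.
Proof. by rewrite /proj raddf0. Qed.

Lemma proj_surj (x : circle) : exists t, proj t = x.
Proof. by exists (repr x); rewrite /proj reprK. Qed.

Lemma proj_eq0 (t : R) : proj t = 0 -> t \is a Num.int.
Proof.
rewrite -proj0 => /eqP tE.
by have := Quotient.idealrBE Zint t 0; rewrite subr0 tE.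
Qed.

Lemma proj_eq (s t : R) : proj s = proj t -> s - t \is a Num.int.
Proof. by move=> st; apply: proj_eq0; rewrite projB st subrr. Qed.

(* The quotient metric: the distance in R between two fibres of [proj]. *)
Definition circle_dist (x y : circle) : R :=
  inf [set `|t| | t in [set t : R | proj t = x - y]].

Let norms x y := [set `|t| | t in [set t : R | proj t = x - y]].

Let has_inf_norms x y : has_inf (norms x y).
Proof.
have [t tE] := proj_surj (x - y); split; first by exists `|t|; exists t.
by exists 0 => _ [s _ <-].
Qed.

Let dist_le x y t : proj t = x - y -> circle_dist x y <= `|t|.
Proof. by move=> tE; apply: ge_inf; [case: (has_inf_norms x y)|exists t]. Qed.

Let dist_lt x y e : 0 < e ->
  exists2 t, proj t = x - y & `|t| < circle_dist x y + e.
Proof.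
by move=> /inf_adherent /(_ (has_inf_norms x y))[_ [t tE <-] te]; exists t.
Qed.

Let dist_ge0 x y : 0 <= circle_dist x y.
Proof.
by apply: lb_le_inf; [case: (has_inf_norms x y)|move=> _ [s _ <-]].
Qed.

Let circle_distxx x : circle_dist x x = 0.
Proof.
apply/eqP; rewrite eq_le dist_ge0 andbT -[leRHS](@normr0 _ R).
by apply: dist_le; rewrite proj0 subrr.
Qed.

Let circle_dist_positivity x y : circle_dist x y = 0 -> x = y.
Proof.
move=> xy0; have half_gt0 : 0 < 2^-1 :> R by rewrite invr_gt0.
have [t tE] := dist_lt x y half_gt0; rewrite xy0 add0r => t2.
have t_le s : proj s = x - y -> `|t| <= `|s|.
  move=> sE; have /proj_eq st : proj s = proj t by rewrite tE.
  have [/eqP|st0] := eqVneq (s - t) 0; first by rewrite subr_eq0 => /eqP ->.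
  have := le_trans (norm_intr_ge1 st st0) (ler_normB s t).
  by move: t2; lra.
have : `|t| <= 0.
  rewrite -xy0; apply: lb_le_inf; first by case: (has_inf_norms x y).
  by move=> _ [s sE <-]; exact: t_le.
rewrite normr_le0 => /eqP t0; apply/eqP.
by rewrite -subr_eq0 -tE t0 proj0.
Qed.

Let circle_dist_le_sym x y : circle_dist x y <= circle_dist y x.
Proof.
apply/ler_addgt0Pr => e /(dist_lt y x)[t tE /ltW]; apply: le_trans.
rewrite -normrN; apply: dist_le.
by rewrite -[- t]add0r projB tE proj0 add0r opprB.
Qed.

Let circle_dist_sym x y : circle_dist x y = circle_dist y x.
Proof. by apply/eqP; rewrite eq_le !circle_dist_le_sym. Qed.

Let circle_dist_triangle y x z :
  circle_dist x z <= circle_dist x y + circle_dist y z.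
Proof.
apply/ler_addgt0Pr => e e0; have e20 : 0 < e / 2 by rewrite divr_gt0.
have [s sE ss] := dist_lt x y e20; have [t tE tt] := dist_lt y z e20.
rewrite (splitr e) addrACA (le_trans _ (ltW (ltrD ss tt)))//.
rewrite (le_trans _ (ler_normD s t))//; apply: dist_le.
rewrite -[t]opprK projB -[- t]add0r projB sE tE proj0 add0r opprK.
by rewrite addrA subrK.
Qed.

HB.instance Definition _ := @isMetric.Build R circle circle_dist
  circle_distxx circle_dist_positivity circle_dist_sym circle_dist_triangle.

End Circle.

Section Hausdorff.
Context {R : realType} {T : metricType R}.
Local Open Scope ereal_scope.

Definition diam (A : set T) : \bar R :=
  ereal_sup [set (mdist xy.1 xy.2)%:E | xy in A `*` A].

(* Since [0 `^ 0 = 1], [hausdorff_measure 0] below is the counting measure. *)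
Definition diam_pow (s : R) (A : set T) : \bar R :=
  if pselect (A = set0) then 0 else diam A `^ s.

Definition hausdorff_premeasure (s delta : R) (Z : set T) : \bar R :=
  ereal_inf [set \sum_(0 <= i <oo) diam_pow s (A i) | A in
    [set A : nat -> set T |
      Z `<=` \bigcup_i A i /\ forall i, diam (A i) <= delta%:E]].

Definition hausdorff_measure (s : R) (Z : set T) : \bar R :=
  ereal_sup [set hausdorff_premeasure s delta Z | delta in [set d : R | (0 < d)%R]].

Definition hausdorff_dim (Z : set T) : \bar R :=
  ereal_inf [set s%:E | s in [set s : R | (0 <= s)%R /\ hausdorff_measure s Z = 0]].

End Hausdorff.

Section Diffeomorphisms.
Local Open Scope classical_set_scope.
Variable R : realType.
Local Notation circle := (circle R).
Implicit Types (F : R -> R) (f : circle -> circle).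

Definition smooth F := forall n x, derivable (F^`(n)) x 1.

(* Since [proj] is the universal covering and a local diffeomorphism, [f] is
   C^oo exactly when it has a smooth lift; it preserves orientation when the
   derivative of a lift is positive. Lifts differ by integers. *)
Definition smooth_lift F f := smooth F /\ forall x, f (proj x) = proj (F x).

Record diffeo := Diffeo {
  dfun :> circle -> circle;
  dinv : circle -> circle;
  dfunK : cancel dfun dinv;
  dinvK : cancel dinv dfun;
  dfun_smooth : exists2 F, smooth_lift F dfun & forall x, 0 < F^`() x;
  dinv_smooth : exists F, smooth_lift F dinv
}.

HB.instance Definition _ := gen_eqMixin diffeo.
HB.instance Definition _ := gen_choiceMixin diffeo.

(* An arbitrary smooth lift; [diffeo] guarantees that there is one for [dfun f]
   and for [dinv f]. *)
Definition chosen_lift f : R -> R := get [set F | smooth_lift F f].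

(* The limit exists, and changing the lift shifts it by an integer. *)
Definition rotation_number (f : diffeo) : circle :=
  proj (limn (fun n => iter n (chosen_lift f) 0 / n%:R)).

Definition diffeos_of_rotation (a : R) : set diffeo :=
  [set f | rotation_number f = proj a].

(* For k > 0 the k-th derivative of the lift is 1-periodic and does not depend
   on the lift. *)
Definition circle_deriv (k : nat) f : circle -> R :=
  fun x => (chosen_lift f)^`(k) (repr x).

Definition C0_embedding (f : diffeo) :
    {uniform circle -> circle} * {uniform circle -> circle} :=
  (dfun f, dinv f).

Definition derivs f : {ptws nat -> {uniform circle -> R}} :=
  fun k => circle_deriv k.+1 f.

Definition Coo_embedding (f : diffeo) :
    ({uniform circle -> circle} * {uniform circle -> circle}) *
    ({ptws nat -> {uniform circle -> R}} *
     {ptws nat -> {uniform circle -> R}}) :=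
  (C0_embedding f, (derivs (dfun f), derivs (dinv f))).

(* The subspace of diffeomorphisms with rotation number [a], with the C^0 and
   the C^oo topology respectively. *)
Definition C0_space (a : R) : Type :=
  initial_topology
    (fun f : set_type (diffeos_of_rotation a) => C0_embedding (val f)).
HB.instance Definition _ a := Topological.on (C0_space a).

Definition Coo_space (a : R) : Type :=
  initial_topology
    (fun f : set_type (diffeos_of_rotation a) => Coo_embedding (val f)).
HB.instance Definition _ a := Topological.on (Coo_space a).

End Diffeomorphisms.

Section Measures.
Variable R : realType.
Local Notation circle := (circle R).

Definition borel_circle : measurableType _ :=
  g_sigma_algebraType (@open circle).

Definition invariant_measure (f : circle -> circle) (mu : probability borel_circle R) :=
  forall A : set borel_circle, measurable A -> mu (f @^-1` A) = mu A.

(* Measures are functions on all sets, so uniqueness is equality on Borel sets. *)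
Definition unique_invariant_measure (f : circle -> circle)
    (mu : probability borel_circle R) :=
  invariant_measure f mu /\
  forall nu : probability borel_circle R, invariant_measure f nu ->
  forall A : set borel_circle, measurable A -> nu A = mu A.

Definition measure_dim (mu : probability borel_circle R) : \bar R :=
  ereal_inf [set hausdorff_dim (Z : set circle) | Z in
    [set Z : set borel_circle | measurable Z /\ mu Z = 1%E]].

(* [set_type D] is the type of elements of [D], so [val f] is a diffeomorphism. *)
Definition S0 (a : R) : set (set_type (diffeos_of_rotation (R:=R) a)) :=
  [set f | exists2 mu, unique_invariant_measure (dfun (val f)) mu &
           measure_dim mu = 0%E].

End Measures.

Arguments S0 {R} a _.

(* Main.v *)
(* The set U_n consists of the f in F_alpha for which, for some M, every orbit
   spends a proportion at least 1 - 2^-n of its first M steps in a finite union of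
   short arcs, whose diameters to the power 1/(n+1) add up to at most 2^-n. This
   is open in the C^0 topology, and the invariant measure of f in all U_n gives
   full measure to the superior limit of these unions, which has dimension 0.

   Density. Let F be a lift of f and p/q < alpha a Liouville approximation, with
   theta = q alpha - p smaller than any prescribed power of 1/q. Some translate
   F_1 = F - t, 0 <= t <= 2 theta, satisfies F_1^q >= id + p with equality along a
   periodic orbit O. Denjoy's argument, applied to the q gaps of O that are
   permuted by F_1, bounds the derivative of F_1^q below by a constant depending
   only on f. Add to F_1 a smooth function phi >= 0 which is small with its
   derivatives up to a given order, vanishes on O and is at least a power of 1/q
   away from an arc-neighbourhood of O of size another power of 1/q. The rotation
   number of F_1 + phi is p/q, hence some G = F_1 + phi + s with 0 <= s <= t has
   rotation number alpha. Then G^q - p >= id + c phi, while G^q - p moves points by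
   theta on average: orbits of G rarely leave the neighbourhood of O. The case
   p/q > alpha follows by conjugating with x -> -x.

   The invariant measure is the image of Lebesgue measure under the limit
   superior of F^n(y - n alpha); it is unique because the distribution function
   of an invariant measure semi-conjugates F to the translation by alpha, and is
   therefore determined on the orbit of 0. *)

From HB Require Import structures.
Require Import Defs.
From mathcomp Require Import all_boot all_order all_algebra.
From mathcomp Require Import all_classical all_reals all_analysis.
From mathcomp Require Import unstable measurable_realfun ring lra zify.
(* Imported again to shadow the [proj] of product topologies. *)
Require Import Defs.

Set Implicit Arguments.
Unset Strict Implicit.
Unset Printing Implicit Defensive.

Import Order.TTheory GRing.Theory Num.Theory.
Import numFieldNormedType.Exports.

Local Open Scope ring_scope.
Local Open Scope classical_set_scope.

Local Notation "f ^` ()" := (derive1 f) : ring_scope.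
Local Notation "f ^` ( n )" := (derive1n n f) : ring_scope.

(** * Rotation numbers of lifts *)

(** The obstacle is uniformity in [q]. The hypothesis on [alpha] makes [theta] small compared with
    powers of [1/q] only, so every loss in the argument has to be polynomial in [q]. The chain rule
    alone bounds the derivative of [F_1^q] below by the [q]-th power of the minimum of [F'], an
    exponential loss. Tangency repairs this: [F_1^q - id] is minimal on [O], so [F_1^q] has
    derivative exactly 1 there, and comparing another orbit with [O] costs only the total length of
    one family of gaps, which is 1. The other loss is the size of [phi], a product of [q] notches at
    a polynomial scale, whose derivatives up to a fixed order are polynomial in [q]. The proportion
    of time spent far from [O] is then at most [theta] over the size of [phi], up to constants.
    Since [1/(n+1)] tends to 0, one limsup set serves all positive Hausdorff exponents at once. The
    C^oo topology also involves the inverses, so inversion has to be shown continuous. *)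

Section Rotation.
Variable R : realType.
Implicit Types (F G : R -> R) (a x y s t : R).

Definition deg1 F := forall x, F (x + 1) = F x + 1.
(* [a] is the rotation number of [F]; the uniform bound is automatic for monotone
   lifts (lemma [rot_exists]). *)
Definition rot F a := forall n x, `|iter n F x - x - n%:R * a| <= 2.

Lemma deg1Z F (m : int) x : deg1 F -> F (x + m%:~R) = F x + m%:~R.
Proof.
move=> F1; have FN n y : F (y + n%:R) = F y + n%:R.
  elim: n y => [|n IH] y; first by rewrite !addr0.
  by rewrite -natr1 addrA F1 IH addrA.
case: m => n; first exact: FN.
rewrite NegzE mulrNz; apply: (addIr n.+1%:R).
by rewrite -FN !subrK.
Qed.

Lemma iter_deg1 F n : deg1 F -> deg1 (iter n F).
Proof. by move=> F1; elim: n => // n IH x; rewrite !iterS IH F1. Qed.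

Lemma iter_homo F n : {homo F : x y / x <= y} -> {homo iter n F : x y / x <= y}.
Proof. by move=> Fh; elim: n => // n IH x y xy; rewrite !iterS Fh// IH. Qed.

Lemma iter_le F G n x : {homo F : x y / x <= y} -> (forall y, F y <= G y) ->
  iter n F x <= iter n G x.
Proof.
by move=> Fh FG; elim: n => // n IH; rewrite !iterS (le_trans (Fh _ _ IH)).
Qed.

(** Up to an integer translation [y <= x <= y + 1], where monotonicity squeezes [F x] between [F y]
    and [F y + 1]. *)
Lemma deg1_osc F x y : {homo F : x y / x <= y} -> deg1 F ->
  `|F x - x - (F y - y)| <= 1.
Proof.
move=> Fh F1; set m := Num.floor (x - y).
have m1 : y + m%:~R <= x by rewrite -lerBrDl ge_floor.
have m2 : x <= y + m%:~R + 1.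
  by rewrite -addrA -lerBlDl ltW// -(@intrD1 R) lt_succ_floor.
have := Fh _ _ m1; have := Fh _ _ m2; rewrite F1 !deg1Z// => ? ?.
by rewrite ler_norml; apply/andP; split; lra.
Qed.

Lemma le0_archi (d C : R) : (forall k : nat, k%:R * d <= C) -> d <= 0.
Proof.
move=> h; rewrite leNgt; apply/negP => d0.
have := h (Num.bound (C / d)).
rewrite -ler_pdivlMr// leNgt => /negP; apply.
exact: ltr_bound.
Qed.

(** The orbit [u] of 0 is additive up to 1. Estimating [u (m * n)] in two ways puts every
    [(u m - 1) / m] below every [(u n + 1) / n], so the supremum [a] of the former satisfies
    [|u n - n * a| <= 1]. Passing from 0 to another starting point costs one more unit. *)
Lemma rot_exists F : {homo F : x y / x <= y} -> deg1 F -> exists a, rot F a.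
Proof.
move=> Fh F1; pose u n := iter n F 0.
have uD m n : `|u (m + n)%N - u m - u n| <= 1.
  have := deg1_osc (u n) 0 (iter_homo m Fh) (iter_deg1 m F1).
  by rewrite /u iterD subr0; congr (`|_| <= 1); ring.
have uM n k : `|u (k * n)%N - k%:R * u n| <= k%:R.
  elim: k => [|k IH]; first by rewrite !mul0r subr0 /u /= normr0.
  rewrite mulSn -natr1; have := uD n (k * n)%N; move: IH.
  rewrite !ler_norml => /andP[? ?] /andP[? ?]; apply/andP; split; lra.
have umn m n : (u m.+1 - 1) / m.+1%:R <= (u n.+1 + 1) / n.+1%:R.
  rewrite ler_pdivrMr// mulrAC ler_pdivlMr//.
  have := uM m.+1 n.+1; have := uM n.+1 m.+1; rewrite mulnC.
  by rewrite !ler_norml => /andP[? ?] /andP[? ?]; lra.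
pose S := [set (u m.+1 - 1) / m.+1%:R | m in @setT nat].
have Sub n : ubound S ((u n.+1 + 1) / n.+1%:R) by move=> _ [m _ <-].
have Ssup : has_sup S.
  by split; [exists ((u 1%N - 1) / 1%:R), 0%N|exists ((u 1%N + 1) / 1%:R)].
exists (sup S) => n x.
have un : `|u n - n%:R * sup S| <= 1.
  case: n => [|n]; first by rewrite mul0r subr0 /u normr0.
  have h1 : (u n.+1 - 1) / n.+1%:R <= sup S.
    by apply: ub_le_sup; [case: Ssup|exists n].
  have h2 : sup S <= (u n.+1 + 1) / n.+1%:R.
    by apply: ge_sup; [case: Ssup|exact: Sub].
  rewrite ler_pdivrMr// in h1; rewrite ler_pdivlMr// in h2.
  by rewrite ler_norml; apply/andP; split; lra.
have := deg1_osc x 0 (iter_homo n Fh) (iter_deg1 n F1); move: un.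
by rewrite /u !ler_norml => /andP[? ?] /andP[? ?]; apply/andP; split; lra.
Qed.

Lemma rot_cvg F a : rot F a -> (fun n => iter n F 0 / n%:R) @ \oo --> a.
Proof.
move=> Fa; apply/cvgrPdist_le => e e0.
exists (Num.bound (2 / e)).+1 => // n /= hn.
have n0 : (0 < n)%N by lia.
have n0R : 0 < n%:R :> R by rewrite ltr0n.
have -> : a - iter n F 0 / n%:R = - (iter n F 0 - 0 - n%:R * a) / n%:R.
  by field; rewrite ?lt0r_neq0.
rewrite normrM normrN normfV (ger0_norm (ltW n0R)) ler_pdivrMr//.
apply: (le_trans (Fa _ _)); rewrite -ler_pdivrMl// mulrC.
have /ltW/le_trans-> // : 2 / e < (Num.bound (2 / e))%:R.
  exact: ltr_bound.
by rewrite ler_nat; lia.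
Qed.

Lemma rot_iter_le F a q (p : int) x : {homo F : x y / x <= y} -> deg1 F ->
  rot F a -> iter q F x <= x + p%:~R -> q%:R * a <= p%:~R.
Proof.
move=> Fh F1 Fa xp.
have it k : iter (k * q) F x <= x + k%:R * p%:~R.
  elim: k => [|k IH]; first by rewrite mul0r addr0.
  rewrite mulSn iterD (le_trans (iter_homo _ Fh IH))//.
  rewrite -[k%:R]/(k%:~R) -intrM deg1Z; last exact: iter_deg1.
  by rewrite intrM -[k%:~R]/(k%:R) -natr1; lra.
rewrite -subr_le0; apply: (@le0_archi _ 2) => k.
have := Fa (k * q)%N x; rewrite ler_norml natrM => /andP[? _].
by have := it k; lra.
Qed.

Lemma rot_le F G a b : {homo F : x y / x <= y} -> (forall x, F x <= G x) ->
  rot F a -> rot G b -> a <= b.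
Proof.
move=> Fh FG Fa Gb; rewrite -subr_le0; apply: (@le0_archi _ 4) => k.
have := iter_le k 0 Fh FG.
have := Fa k 0; have := Gb k 0; rewrite !ler_norml => /andP[? ?] /andP[? ?] ?.
lra.
Qed.

Lemma rot_uniq F a b : {homo F : x y / x <= y} -> rot F a -> rot F b -> a = b.
Proof. by move=> Fh Fa Fb; apply/le_anti/andP; split; exact: rot_le Fh _ _ _. Qed.

(** The rotation number is continuous in [s]: multiplied by [n], it stays within 2 of the continuous
    function [s |-> iter n _ 0]. *)
Lemma rot_ivt F a a0 a1 s0 s1 : {homo F : x y / x <= y} -> deg1 F ->
  continuous F -> s0 <= s1 ->
  rot (fun x => F x + s0) a0 -> rot (fun x => F x + s1) a1 -> a0 <= a <= a1 ->
  exists2 s, s0 <= s <= s1 & rot (fun x => F x + s) a.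
Proof.
move=> Fh F1 Fc s01 F0a F1a aa.
have homos s : {homo (fun x => F x + s) : x y / x <= y}.
  by move=> x y xy; rewrite lerD2r Fh.
have /choice[r rP] s : exists b, rot (fun x => F x + s) b.
  by apply: rot_exists => // x; rewrite F1 addrAC.
have r0 : r s0 = a0 by exact: (rot_uniq (homos _) (rP _)).
have r1 : r s1 = a1 by exact: (rot_uniq (homos _) (rP _)).
have itc n : continuous (fun s => iter n (fun x => F x + s) 0).
  elim: n => [|n IH] s; first exact: cvg_cst.
  rewrite /=; apply: cvgD; last exact: cvg_id.
  by apply: (continuous_comp (IH s)); exact: Fc.
have rc : continuous r.
  move=> s; apply/cvgrPdist_le => e e0.
  (* The two errors 2 then cost less than [e * n / 2] together, which leaves [e * n / 2] for the
     variation of the [n]-th iterate. *)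
  set n := (Num.bound (8 / e)).+1.
  have n0 : 0 < n%:R :> R by [].
  have ne : 8 / e < n%:R.
    rewrite (lt_le_trans (ltr_bound _))//.
    by rewrite ler_nat.
  have : 0 < e * n%:R / 2 by rewrite divr_gt0// mulr_gt0.
  move: (itc n s) => /cvgrPdist_le/[apply]; apply: filterS => t st.
  have := rP t n 0; have := rP s n 0; move: st.
  rewrite !ler_norml => /andP[? ?] /andP[? ?] /andP[? ?].
  have ne' : 8 < e * n%:R by rewrite mulrC -ltr_pdivrMr.
  apply/andP; split; rewrite -(ler_pM2l n0); lra.
have [| s] := @IVT R r s0 s1 a s01 (continuous_subspaceT rc).
  by rewrite r0 r1; move/andP: aa => [? ?]; rewrite ge_min le_max; lra.
by rewrite in_itv /= => ss <-; exists s.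
Qed.

End Rotation.

(** * Smooth functions *)

Section Smooth.
Variable R : realType.
Implicit Types (f g u v F : R -> R) (x : R) (k : nat).

Lemma is_derive_fun f g : (forall x, is_derive x 1 f (g x)) -> f^`() = g.
Proof. by move=> fg; apply/funext => x; rewrite derive1E derive_val. Qed.

Lemma derivable_is_derive f : (forall x, derivable f x 1) ->
  forall x, is_derive x 1 f (f^`() x).
Proof. by move=> df x; apply: DeriveDef; rewrite ?derive1E. Qed.

Lemma smooth_is_derive f : smooth f -> forall x, is_derive x 1 f (f^`() x).
Proof. by move=> /(_ 0%N) df; exact: derivable_is_derive. Qed.

Lemma smooth_deriv f : smooth f -> smooth f^`().
Proof. by move=> fs n x; rewrite -derive1Sn; exact: fs. Qed.

Lemma smooth_derivn f n : smooth f -> smooth f^`(n).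
Proof. by elim: n f => [//|n IH] f /smooth_deriv/IH; rewrite derive1Sn. Qed.

Fixpoint cdiff k f : Prop :=
  if k is k'.+1 then (forall x, derivable f x 1) /\ cdiff k' f^`() else True.

Lemma smoothP f : smooth f <-> forall k, cdiff k f.
Proof.
split=> [fs k|fk n x].
  by elim: k f fs => //= k IH f fs; split; [exact: (fs 0%N)|exact/IH/smooth_deriv].
have : cdiff n.+1 f by [].
by elim: n f {fk} => [|n IH] f; [case=> /(_ x)|case=> _ /IH; rewrite derive1Sn].
Qed.

Lemma cdiff_is_derive k f : cdiff k.+1 f -> forall x, is_derive x 1 f (f^`() x).
Proof. by case=> fd _; exact: derivable_is_derive. Qed.

Lemma cdiffS k f g : (forall x, is_derive x 1 f (g x)) -> cdiff k g ->
  cdiff k.+1 f.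
Proof.
move=> fg cg; split; last by rewrite (is_derive_fun fg).
by move=> x; have [] := fg x.
Qed.

Lemma cdiffW k f : cdiff k.+1 f -> cdiff k f.
Proof. by elim: k f => //= k IH f [fd fc]; split=> //; exact: IH. Qed.

Lemma cdiff_cst k (c : R) : cdiff k (fun=> c).
Proof.
by elim: k c => // k IH c; apply: (@cdiffS _ _ (fun=> 0)).
Qed.

Lemma cdiff_id k : cdiff k id.
Proof.
by case: k => // k; apply: (@cdiffS _ _ (fun=> 1)); exact: cdiff_cst.
Qed.

Lemma cdiffD k f g : cdiff k f -> cdiff k g -> cdiff k (fun x => f x + g x).
Proof.
elim: k f g => // k IH f g cf cg.
apply: (@cdiffS _ _ (fun x => f^`() x + g^`() x)); last exact: IH cf.2 cg.2.
by move=> x; exact: (is_deriveD (cdiff_is_derive cf x) (cdiff_is_derive cg x)).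
Qed.

Lemma is_derive_mul f g x a b : is_derive x 1 f a -> is_derive x 1 g b ->
  is_derive x 1 (fun x => f x * g x) (a * g x + f x * b).
Proof.
move=> fa gb; have := is_deriveM fa gb; congr is_derive.
by rewrite /GRing.scale/=; ring.
Qed.

Lemma cdiffM k f g : cdiff k f -> cdiff k g -> cdiff k (fun x => f x * g x).
Proof.
elim: k f g => // k IH f g cf cg.
apply: (@cdiffS _ _ (fun x => f^`() x * g x + f x * g^`() x)).
  by move=> x; exact: (is_derive_mul (cdiff_is_derive cf x) (cdiff_is_derive cg x)).
by apply: cdiffD; apply: IH => //; [exact: cf.2|exact: cdiffW|exact: cdiffW|
  exact: cg.2].
Qed.

Lemma cdiffN k f : cdiff k f -> cdiff k (fun x => - f x).
Proof.
move=> fk; have := cdiffM (@cdiff_cst k (-1)) fk.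
by congr cdiff; apply/funext => x; rewrite mulN1r.
Qed.

Lemma cdiff_comp k f g : cdiff k f -> cdiff k g -> cdiff k (f \o g).
Proof.
elim: k f g => // k IH f g cf cg.
apply: (@cdiffS _ _ (fun x => (f^`() \o g) x * g^`() x)).
  move=> x; apply: is_derive1_comp; last exact: (cdiff_is_derive cg x).
  exact: (cdiff_is_derive cf).
by apply: cdiffM; [apply: IH => //; [exact: cf.2|exact: cdiffW]|exact: cg.2].
Qed.

Lemma is_derive_recip f x a : f x != 0 -> is_derive x 1 f a ->
  is_derive x 1 (fun x => (f x)^-1) (- (a * ((f x)^-1 * (f x)^-1))).
Proof.
move=> fx fa; have := is_deriveV fx fa; congr is_derive.
by rewrite /GRing.scale/=; field.
Qed.

Lemma cdiffV k f : (forall x, f x != 0) -> cdiff k f ->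
  cdiff k (fun x => (f x)^-1).
Proof.
move=> f0; elim: k => // k IH cf.
apply: (@cdiffS _ _ (fun x => - (f^`() x * ((f x)^-1 * (f x)^-1)))).
  by move=> x; apply: is_derive_recip => //; exact: (cdiff_is_derive cf).
have cV := IH (cdiffW cf).
by apply: cdiffN; apply: cdiffM; [exact: cf.2|exact: cdiffM].
Qed.

Lemma smoothD f g : smooth f -> smooth g -> smooth (fun x => f x + g x).
Proof. by rewrite !smoothP => ? ? ?; exact: cdiffD. Qed.

Lemma smoothM f g : smooth f -> smooth g -> smooth (fun x => f x * g x).
Proof. by rewrite !smoothP => ? ? ?; exact: cdiffM. Qed.

Lemma smoothN f : smooth f -> smooth (fun x => - f x).
Proof. by rewrite !smoothP => ? ?; exact: cdiffN. Qed.

Lemma smooth_comp f g : smooth f -> smooth g -> smooth (f \o g).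
Proof. by rewrite !smoothP => ? ? ?; exact: cdiff_comp. Qed.

Lemma smoothV f : (forall x, f x != 0) -> smooth f ->
  smooth (fun x => (f x)^-1).
Proof. by rewrite !smoothP => ? ? ?; exact: cdiffV. Qed.

Lemma smooth_cst (c : R) : smooth (fun=> c).
Proof. by rewrite smoothP => ?; exact: cdiff_cst. Qed.

Lemma smooth_id : smooth (@id R).
Proof. by rewrite smoothP => ?; exact: cdiff_id. Qed.

Lemma smooth_expR : smooth (@expR R).
Proof.
rewrite smoothP; elim=> // k IH.
by apply: (@cdiffS _ _ expR) => // x; exact: is_derive_expR.
Qed.

Lemma cdiff_sin_cos k : cdiff k (@sin R) /\ cdiff k (@cos R).
Proof.
elim: k => // k [IHs IHc]; split.
  by apply: (@cdiffS _ _ cos) => // x; exact: is_derive_sin.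
by apply: (@cdiffS _ _ (fun x => - sin x)); exact: cdiffN.
Qed.

Lemma smooth_sin : smooth (@sin R).
Proof. by rewrite smoothP => k; case: (cdiff_sin_cos k). Qed.

Lemma smooth_continuous f : smooth f -> continuous f.
Proof.
move=> /(_ 0%N) fd x; apply: differentiable_continuous.
exact/derivable1_diffP/fd.
Qed.

Lemma smooth_MVT f x y : smooth f -> x <= y ->
  exists2 c, x <= c <= y & f y - f x = f^`() c * (y - x).
Proof.
move=> fs xy; have [c] := @MVT_segment R f f^`() x y xy
  (fun z _ => smooth_is_derive fs z) (continuous_subspaceT (smooth_continuous fs)).
by rewrite in_itv/= => cxy fE; exists c.
Qed.

Lemma derivn_const (c : R) n : (fun=> c : R)^`(n.+1) = fun=> 0.
Proof.
elim: n c => [|n IH] c.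
  by rewrite derive1n1; apply: is_derive_fun => x; exact: is_derive_cst.
rewrite derive1Sn -[in RHS](IH 0) (_ : _^`() = fun=> 0)//.
by apply: is_derive_fun => x; exact: is_derive_cst.
Qed.

Lemma deriv_add f g : smooth f -> smooth g ->
  (fun x => f x + g x)^`() = (fun x => f^`() x + g^`() x).
Proof.
move=> fs gs; apply: is_derive_fun => x.
exact: (is_deriveD (smooth_is_derive fs x) (smooth_is_derive gs x)).
Qed.

Lemma derivn_add f g n : smooth f -> smooth g ->
  (fun x => f x + g x)^`(n) = (fun x => f^`(n) x + g^`(n) x).
Proof.
elim: n f g => // n IH f g fs gs.
rewrite !derive1Sn (deriv_add fs gs).
exact (IH _ _ (smooth_deriv fs) (smooth_deriv gs)).
Qed.

(** Bootstrap: in [H' = 1 / (F' \o H)] the right side is as often differentiable as [H], so [H]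
    gains one derivative at each turn. *)
Lemma smooth_inv F H : smooth F -> (forall x, 0 < F^`() x) ->
  cancel F H -> cancel H F -> continuous H ->
  smooth H /\ H^`() = (fun x => (F^`() (H x))^-1).
Proof.
move=> Fs Fp FK HK Hc.
have dH x : is_derive x 1 H (F^`() (H x))^-1.
  have nK : {near H x, cancel F H} by apply: filterE => y; exact: FK.
  have := is_derive_inverse nK _ (smooth_is_derive Fs (H x)).
  rewrite HK; apply; last by rewrite lt0r_neq0.
  by apply: filterE => y; exact: smooth_continuous.
split; last exact: is_derive_fun.
rewrite smoothP; elim=> // k IH; apply: (cdiffS dH).
apply: cdiffV => [x|]; first by rewrite lt0r_neq0.
by apply: (@cdiff_comp _ F^`()) => //; move/smooth_deriv/smoothP: Fs.
Qed.

End Smooth.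

(** * Periodic functions: bounds by compactness of a period *)

Section Periodic.
Variable R : realType.
Implicit Types (f g u v F : R -> R) (x : R) (k : nat).

Definition periodic u := forall x, u (x + 1) = u x.

Lemma periodicZ u (m : int) x : periodic u -> u (x + m%:~R) = u x.
Proof.
move=> up; have uN n y : u (y + n%:R) = u y.
  elim: n y => [|n IH] y; first by rewrite addr0.
  by rewrite -natr1 addrA up IH.
case: m => n; first exact: uN.
by rewrite NegzE mulrNz -(uN n.+1) subrK.
Qed.

Lemma periodic_itv u (P : R -> Prop) : periodic u ->
  (forall x, 0 <= x <= 1 -> P (u x)) -> forall x, P (u x).
Proof.
move=> up h x; rewrite -(subrK (Num.floor x)%:~R x) periodicZ//; apply: h.
rewrite subr_ge0 ge_floor lerBlDl ltW//.
by have := floorD1_gt x; rewrite intrD.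
Qed.

Lemma is_derive_shift f x a (c : R) : is_derive (x + c) 1 f a ->
  is_derive x 1 (fun y => f (y + c)) a.
Proof.
move=> fa; rewrite -[a]mulr1; apply: (@is_derive1_comp R f (fun y => y + c)) => //.
rewrite -[1 in X in is_derive _ _ _ X]addr0.
by apply: is_deriveD.
Qed.

Lemma deriv_shift f (c : R) : smooth f ->
  (fun y => f (y + c))^`() = fun y => f^`() (y + c).
Proof.
move=> fs; apply: is_derive_fun => x; apply: is_derive_shift.
exact: smooth_is_derive.
Qed.

Lemma deg1_deriv F : smooth F -> deg1 F -> periodic F^`().
Proof.
move=> Fs F1 x; have := deriv_shift 1 Fs; move/(congr1 (@^~ x)) => <-.
rewrite (_ : (fun y => F (y + 1)) = (fun y => F y + 1)); last exact/funext.
rewrite (deriv_add Fs (@smooth_cst R 1)).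
have -> : (fun=> 1 : R)^`() = fun=> 0 by exact: (derivn_const 1 0).
by rewrite addr0.
Qed.

Lemma periodic_deriv u : smooth u -> periodic u -> periodic u^`().
Proof.
move=> us up x; have := deriv_shift 1 us; move/(congr1 (@^~ x)) => <-.
by rewrite (_ : (fun y => u (y + 1)) = u)//; exact/funext.
Qed.

Lemma periodic_bounded u : continuous u -> periodic u ->
  exists2 M, 0 < M & forall x, `|u x| <= M.
Proof.
move=> uc up.
have uc' : {within `[0, 1], continuous (fun x => `|u x|)}.
  apply: continuous_subspaceT => x; apply: continuous_comp; first exact: uc.
  exact: norm_continuous.
have [c _ cM] := EVT_max ler01 uc'.
exists (`|u c| + 1); first by rewrite ltr_wpDl.
apply: (@periodic_itv _ (fun y => `|y| <= _)) => // x x01.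
by rewrite (le_trans (cM x _))// lerDl.
Qed.

Lemma periodic_pos u : continuous u -> periodic u -> (forall x, 0 < u x) ->
  exists2 m, 0 < m & forall x, m <= u x.
Proof.
move=> uc up u0.
have uc' : {within `[0, 1], continuous u} by exact: continuous_subspaceT.
have [c _ cM] := EVT_min ler01 uc'.
exists (u c); first exact: u0.
exact: (@periodic_itv _ (fun y => _ <= y)).
Qed.

Lemma lipschitz_deriv f M : smooth f -> (forall x, `|f^`() x| <= M) ->
  forall x y, `|f x - f y| <= M * `|x - y|.
Proof.
move=> fs fM; suff h x y : y <= x -> `|f x - f y| <= M * `|x - y|.
  move=> x y; have [/h//|/ltW/h] := leP y x.
  by rewrite distrC (distrC y).
move=> yx; have [c _ ->] := smooth_MVT fs yx.
by rewrite normrM ler_wpM2r.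
Qed.

End Periodic.

(** * Geometric bounds on successive derivatives *)

Section DerivativeBounds.
Variable R : realType.
Implicit Types (u v w : R -> R) (x M A : R) (k : nat).

Fixpoint dbound k M A u : Prop :=
  (forall x, `|u x| <= M) /\ if k is k'.+1 then dbound k' (M * A) A u^`() else True.

Lemma dbound0 k M A u : dbound k M A u -> forall x, `|u x| <= M.
Proof. by case: k => [|k] []. Qed.

Lemma dbound_derivn k M A u j x : dbound k M A u -> (j <= k)%N ->
  `|u^`(j) x| <= M * A ^+ j.
Proof.
elim: k M u j => [|k IH] M u [|j] // => [[+ _] _|[+ _] _|[_ uk] jk].
- by rewrite expr0 mulr1.
- by rewrite expr0 mulr1.
- by rewrite derive1Sn exprS mulrA; exact: IH.
Qed.

Lemma dbound_le k M A M' A' u : 0 <= M -> 0 <= A -> M <= M' -> A <= A' ->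
  dbound k M A u -> dbound k M' A' u.
Proof.
move=> M0 A0 + AA; elim: k M M' M0 u => [|k IH] M M' M0 u MM [uM uk]; split=> //.
- by move=> x; exact: le_trans MM.
- by move=> x; exact: le_trans MM.
- by apply: (IH (M * A)) => //; [exact: mulr_ge0|exact: ler_pM].
Qed.

Lemma dboundW k M A u : dbound k.+1 M A u -> dbound k M A u.
Proof.
by elim: k M u => [|k IH] M u [uM uk]; split=> //; exact: IH.
Qed.

Lemma dboundD k M1 M2 A u v : smooth u -> smooth v ->
  dbound k M1 A u -> dbound k M2 A v -> dbound k (M1 + M2) A (fun x => u x + v x).
Proof.
elim: k M1 M2 u v => [|k IH] M1 M2 u v us vs [uM uk] [vM vk]; split=> //.
- by move=> x; rewrite (le_trans (ler_normD _ _))// lerD.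
- by move=> x; rewrite (le_trans (ler_normD _ _))// lerD.
- rewrite (deriv_add us vs) mulrDl.
  exact (IH _ _ _ _ (smooth_deriv us) (smooth_deriv vs) uk vk).
Qed.

Lemma deriv_mul u v : smooth u -> smooth v ->
  (fun x => u x * v x)^`() = (fun x => u^`() x * v x + u x * v^`() x).
Proof.
move=> us vs; apply: is_derive_fun => x.
exact: (is_derive_mul (smooth_is_derive us x) (smooth_is_derive vs x)).
Qed.

(* The constants add up without binomial coefficients, so that a product of [n]
   functions costs only a factor [n] in [A]. *)
Lemma dboundM k M1 M2 A1 A2 u v : smooth u -> smooth v ->
  dbound k M1 A1 u -> dbound k M2 A2 v ->
  dbound k (M1 * M2) (A1 + A2) (fun x => u x * v x).
Proof.
elim: k M1 M2 u v => [|k IH] M1 M2 u v us vs uM vM; split.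
- by move=> x; rewrite normrM ler_pM// ?(dbound0 uM)// (dbound0 vM).
- by [].
- by move=> x; rewrite normrM ler_pM// ?(dbound0 uM)// (dbound0 vM).
- have [us' vs'] := (smooth_deriv us, smooth_deriv vs).
  rewrite deriv_mul// mulrDr; apply: dboundD; [exact: smoothM|exact: smoothM| |].
    by rewrite mulrAC; apply: IH => //; [exact: uM.2|exact: dboundW].
  by rewrite -mulrA; apply: IH => //; [exact: dboundW|exact: vM.2].
Qed.

Lemma dboundN k M A u : smooth u -> dbound k M A u ->
  dbound k M A (fun x => - u x).
Proof.
elim: k M u => [|k IH] M u us [uM uk]; split=> //.
- by move=> x; rewrite normrN.
- by move=> x; rewrite normrN.
- have -> : (fun x => - u x)^`() = fun x => - u^`() x.
    apply: is_derive_fun => x; exact: (is_deriveN (smooth_is_derive us x)).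
  by apply: IH => //; exact: smooth_deriv.
Qed.

Lemma dbound_cst k M (c : R) : `|c| <= M -> dbound k M 0 (fun=> c).
Proof.
elim: k M c => [|k IH] M c cM; split=> //.
have -> : (fun=> c)^`() = fun=> 0 by exact: (derivn_const c 0).
by apply: IH; rewrite normr0 mulr0.
Qed.

Lemma dbound_shift k M A u (c : R) : smooth u -> dbound k M A u ->
  dbound k M A (fun x => u (x + c)).
Proof.
elim: k M u => [|k IH] M u us [uM uk]; split=> //.
by rewrite deriv_shift//; apply: IH => //; exact: smooth_deriv.
Qed.

Lemma periodic_dbound k u : smooth u -> periodic u ->
  exists2 M, 0 < M & dbound k M 1 u.
Proof.
elim: k u => [|k IH] u us up.
  by have [M M0 uM] := periodic_bounded (smooth_continuous us) up; exists M.
have [M M0 uM] := periodic_bounded (smooth_continuous us) up.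
have [M' M'0 uM'] := IH _ (smooth_deriv us) (periodic_deriv us up).
exists (M + M'); first exact: addr_gt0.
split=> [x|]; first by rewrite (le_trans (uM x))// lerDl ltW.
by rewrite mulr1; apply: dbound_le uM'; rewrite ?lerDr// ltW.
Qed.

Lemma smooth_prod (I : eqType) (s : seq I) (f : I -> R -> R) :
  (forall i, i \in s -> smooth (f i)) -> smooth (fun x => \prod_(i <- s) f i x).
Proof.
elim: s => [|i s IH] fs.
  by under eq_fun do rewrite big_nil; exact: smooth_cst.
under eq_fun do rewrite big_cons.
apply: smoothM; first by apply: fs; rewrite inE eqxx.
by apply: IH => j js; apply: fs; rewrite inE js orbT.
Qed.

Lemma dbound_prod (I : eqType) (s : seq I) (f : I -> R -> R) k A :
  (forall i, i \in s -> smooth (f i)) ->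
  (forall i, i \in s -> dbound k 1 A (f i)) ->
  dbound k 1 ((size s)%:R * A) (fun x => \prod_(i <- s) f i x).
Proof.
elim: s => [|i s IH] fs fb.
  rewrite mul0r; under eq_fun do rewrite big_nil.
  by apply: dbound_cst; rewrite normr1.
under eq_fun do rewrite big_cons.
rewrite /= -natr1 mulrDl mul1r addrC -[X in dbound _ X]mulr1.
have fs' j : j \in s -> smooth (f j) by move=> js; apply: fs; rewrite inE js orbT.
apply: dboundM; [by apply: fs; rewrite inE eqxx|exact: smooth_prod| |].
  by apply: fb; rewrite inE eqxx.
by apply: IH => // j js; apply: fb; rewrite inE js orbT.
Qed.

End DerivativeBounds.

(** * A smooth function vanishing exactly on given points of the circle *)

Section Bump.
Variable R : realType.
Implicit Types (x r b c : R) (k : nat).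

Lemma smooth_shift (f : R -> R) c : smooth f -> smooth (fun x => f (x + c)).
Proof.
move=> fs; exact (smooth_comp fs (smoothD (@smooth_id R) (@smooth_cst R c))).
Qed.

Definition sqsin x := sin (pi * x) * sin (pi * x).

Lemma sqsin_smooth : smooth sqsin.
Proof.
have h : smooth (sin \o (fun x : R => pi * x)).
  apply: smooth_comp; first exact: smooth_sin.
  by apply: smoothM; [exact: smooth_cst|exact: smooth_id].
exact: (smoothM h h).
Qed.

Lemma sqsin_periodic : periodic sqsin.
Proof. by move=> x; rewrite /sqsin mulrDr mulr1 sinDpi mulrNN. Qed.

Lemma sqsin_ge0 x : 0 <= sqsin x.
Proof. by rewrite /sqsin -expr2 sqr_ge0. Qed.

Lemma sqsinZ (m : int) : sqsin m%:~R = 0.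
Proof.
by rewrite -[m%:~R]add0r periodicZ ?/sqsin ?mulr0 ?sin0 ?mulr0//;
  exact: sqsin_periodic.
Qed.

(** Up to [1] the mean value theorem gives [cos 1 * y <= sin y]. From [1] to [pi / 2 < 2] one has
    [sin y >= sin 1 >= cos 1 >= cos 1 / 2 * y]. The constant is the square of [cos 1 / 2], as
    [1 <= pi]. *)
Lemma sqsin_lb : exists2 c, 0 < c & forall x r, 0 < r ->
  (forall m : int, r <= `|x - m%:~R|) -> c * r ^+ 2 <= sqsin x.
Proof.
have pi0 : 0 < pi :> R by exact: pi_gt0.
have c1 : 0 < cos 1 :> R by exact: cos1_gt0.
have p1 : 1 <= pi / 2 :> R by exact: pihalf_ge1.
have p2 : pi / 2 < 2 :> R by exact: pihalf_lt2.
have sin1 (y : R) : 0 <= y <= 1 -> cos 1 * y <= sin y.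
  move=> /andP[y0 y1].
  have ss : smooth (@sin R) by exact: smooth_sin.
  have [c /andP[c0 cy]] := smooth_MVT ss y0.
  rewrite sin0 !subr0 => ->; rewrite ler_wpM2r//.
  have -> : sin^`() = cos :> (R -> R).
    by apply/funext => z; rewrite derive1E derive_val.
  have [->//|cn] := eqVneq c 1.
  have cl : c < 1 by rewrite lt_neqAle cn (le_trans cy).
  rewrite ltW// ltr_cos ?in_itv/=//; lra.
have sinh (y : R) : 0 <= y <= pi / 2 -> cos 1 / 2 * y <= sin y.
  move=> /andP[y0 y2]; have [y1|y1] := leP y 1.
    have : cos 1 * y <= sin y by apply: sin1; rewrite y0.
    have : 0 <= cos 1 * y by rewrite mulr_ge0// ltW.
    lra.
  have s1 : cos 1 <= sin 1 :> R by have := @sin1 1; rewrite mulr1; apply; lra.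
  have s2 : sin 1 < sin y by rewrite ltr_sin// in_itv/=; lra.
  have : cos 1 * y <= cos 1 * 2 by rewrite ler_pM2l//; lra.
  lra.
exists ((cos 1 / 2) ^+ 2); first by rewrite exprn_gt0// divr_gt0.
move=> x r r0 xr.
(* A nearest integer to [x], so that [pi * |x - m|] falls in the range of [sinh]. *)
set m := Num.floor (x + 2^-1).
have m1 : m%:~R <= x + 2^-1 by exact: ge_floor.
have m2 : x + 2^-1 < m%:~R + 1 by have := floorD1_gt (x + 2^-1); rewrite intrD.
have -> : sqsin x = sqsin (x - m%:~R).
  by rewrite -{1}(subrK m%:~R x) periodicZ//; exact: sqsin_periodic.
have := xr m; set y := x - m%:~R => yr.
have yy : -2^-1 <= y <= 2^-1 by rewrite /y; lra.
have -> : sqsin y = sin (pi * `|y|) ^+ 2.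
  by rewrite /sqsin -expr2; case: (ger0P y) => // _; rewrite mulrN sinN sqrrN.
rewrite -exprMn ler_sqr ?nnegrE; last 2 first.
- by rewrite mulr_ge0 ?ltW// divr_gt0.
- have := @sinh (pi * `|y|); set z := pi * _ => hz.
  have z0 : 0 <= z by rewrite mulr_ge0// ltW.
  have : z <= pi / 2.
    by rewrite ler_pM2l//; rewrite ler_norml; lra.
  move=> z2; have : 0 <= cos 1 / 2 * z by rewrite mulr_ge0// ltW// divr_gt0.
  by move/le_trans; apply; apply: hz; rewrite z0.
have yn : `|y| <= 2^-1 by rewrite ler_norml; lra.
apply: (@le_trans _ _ (cos 1 / 2 * (pi * `|y|))).
  rewrite ler_pM2l ?divr_gt0// (le_trans yr)// ler_peMl//; lra.
apply: sinh; apply/andP; split; first by rewrite mulr_ge0// ltW.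
by rewrite ler_pM2l.
Qed.

(** A smooth dip to 0 at the integers, of width about [b^(-1/2)]; away from them the value is close
    to 1. *)
Definition notch b x := 1 - expR (- b * sqsin x).

Lemma notch_smooth b : smooth (notch b).
Proof.
have h : smooth (expR \o (fun x => - b * sqsin x)).
  apply: smooth_comp; first exact: smooth_expR.
  by apply: smoothM; [exact: smooth_cst|exact: sqsin_smooth].
exact (smoothD (@smooth_cst R 1) (smoothN h)).
Qed.

Lemma notch_periodic b : periodic (notch b).
Proof. by move=> x; rewrite /notch sqsin_periodic. Qed.

Lemma notchZ b (m : int) : notch b m%:~R = 0.
Proof. by rewrite /notch sqsinZ mulr0 expR0 subrr. Qed.

Lemma notch01 b x : 0 <= b -> 0 <= notch b x <= 1.
Proof.
move=> b0; rewrite /notch subr_ge0 expR_le1 mulNr oppr_le0.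
by rewrite mulr_ge0 ?sqsin_ge0//= lerBlDr lerDl expR_ge0.
Qed.

(** Differentiation multiplies the function by [- b * sqsin'], a factor of size [b] varying on scale
    1, so each derivative costs one factor proportional to [b]. *)
Lemma exp_dbound k : exists2 C, 1 <= C & forall b, 1 <= b ->
  dbound k 1 (C * b) (fun x => expR (- b * sqsin x)).
Proof.
have le1 b x : 1 <= b -> `|expR (- b * sqsin x)| <= 1.
  move=> b1; rewrite ger0_norm ?expR_ge0// expR_le1 mulNr oppr_le0.
  by rewrite mulr_ge0 ?sqsin_ge0//; lra.
elim: k => [|k [C C1 IH]].
  by exists 1 => // b b1; split=> // x; exact: le1.
have [M M0 sM] := periodic_dbound k (smooth_deriv sqsin_smooth)
  (periodic_deriv sqsin_smooth sqsin_periodic).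
exists (C + 1 + M); first by lra.
move=> b b1; split=> [x|]; first exact: le1.
have es : smooth (fun x => expR (- b * sqsin x)).
  have h : smooth (fun x => - b * sqsin x).
    by apply: smoothM; [exact: smooth_cst|exact: sqsin_smooth].
  exact: (smooth_comp (@smooth_expR R) h).
have -> : (fun x => expR (- b * sqsin x))^`() =
    fun x => (- b * sqsin^`() x) * expR (- b * sqsin x).
  apply: is_derive_fun => x; rewrite mulrC.
  apply: (@is_derive1_comp R expR (fun x => - b * sqsin x)).
  have := is_derive_mul (is_derive_cst (- b) x 1)
    (smooth_is_derive sqsin_smooth x).
  by rewrite mul0r add0r.
have bs : smooth (fun x => - b * sqsin^`() x).
  by apply: smoothM; [exact: smooth_cst|exact: smooth_deriv sqsin_smooth].
have b0 : 0 < b by lra.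
have bound : dbound k (b * M * 1) (0 + 1 + C * b)
    (fun x => - b * sqsin^`() x * expR (- b * sqsin x)).
  apply: dboundM => //; last exact: IH.
  apply: (dboundM (@smooth_cst R (- b)) (smooth_deriv (@sqsin_smooth))) => //.
  by apply: dbound_cst; rewrite normrN ger0_norm// ltW.
have Mb : 0 < M * b by rewrite mulr_gt0.
have Cb : 0 < C * b by rewrite mulr_gt0//; lra.
apply: dbound_le bound; lra.
Qed.

Definition notches b (s : seq R) x := \prod_(z <- s) notch b (x - z).

Lemma notches_smooth b s : smooth (notches b s).
Proof.
by apply: smooth_prod => z _; apply: smooth_shift; exact: notch_smooth.
Qed.

Lemma notches_periodic b s : periodic (notches b s).
Proof.
move=> x; apply: eq_bigr => z _.
by rewrite addrAC notch_periodic.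
Qed.

Lemma prod01 (I : Type) (s : seq I) (f : I -> R) :
  (forall i, 0 <= f i <= 1) -> 0 <= \prod_(i <- s) f i <= 1.
Proof.
move=> f01; apply: (big_ind (fun p => 0 <= p <= 1)) => //.
  by rewrite ler01 lexx.
by move=> p q /andP[p0 p1] /andP[q0 q1]; rewrite mulr_ge0// mulr_ile1.
Qed.

Lemma notches01 b s x : 0 <= b -> 0 <= notches b s x <= 1.
Proof.
by move=> b0; apply: prod01 => z; exact: notch01.
Qed.

Lemma notches0 b s z (m : int) : z \in s -> notches b s (z + m%:~R) = 0.
Proof.
move=> zs; apply/eqP; rewrite /notches prodf_seq_eq0; apply/hasP.
by exists z => //=; rewrite addrAC subrr add0r notchZ.
Qed.

Lemma notches_dbound k : exists2 C, 1 <= C & forall b s, 1 <= b ->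
  dbound k 1 ((size s)%:R * (C * b)) (notches b s).
Proof.
have [C C1 Cb] := exp_dbound k; exists C => // b s b1.
have b0 : 0 < b by lra.
apply: dbound_prod => z _.
  by apply: smooth_shift; exact: notch_smooth.
apply: dbound_shift; first exact: notch_smooth.
have es : smooth (fun x => expR (- b * sqsin x)).
  have h : smooth (fun x => - b * sqsin x).
    by apply: smoothM; [exact: smooth_cst|exact: sqsin_smooth].
  exact: (smooth_comp (@smooth_expR R) h).
have : dbound k 1 (C * b) (fun x => - expR (- b * sqsin x)).
  exact: (dboundN es (Cb b b1)).
have n1 x : `|notch b x| <= 1.
  by rewrite ler_norml; have /andP[? ?] := notch01 x (ltW b0); apply/andP; split; lra.
case: k {Cb} => [|k] [_ ek]; split=> //.
rewrite (_ : (notch b)^`() = (fun x => - expR (- b * sqsin x))^`())//.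
rewrite /notch (deriv_add (@smooth_cst R 1) (smoothN es)).
have -> : (fun=> 1 : R)^`() = fun=> 0 by exact: (derivn_const 1 0).
by apply/funext => x; rewrite add0r.
Qed.

(** Weierstrass's product inequality; the induction step is [(1 - f i) * (1 - p) >= 0]. *)
Lemma prod_ge_1Bsum (I : Type) (s : seq I) (f : I -> R) :
  (forall i, 0 <= f i <= 1) ->
  1 - \sum_(i <- s) (1 - f i) <= \prod_(i <- s) f i.
Proof.
move=> f01; elim: s => [|i s IH]; first by rewrite !big_nil subr0.
rewrite !big_cons; move: IH.
have /andP[p0 p1] := prod01 s f01.
have /andP[? ?] := f01 i.
move: p0 p1; set p := \prod_(_ <- s) _; set S := \sum_(_ <- s) _ => p0 p1 pS.
have : 0 <= (1 - f i) * (1 - p) by apply: mulr_ge0; lra.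
lra.
Qed.

(** At distance [r] from the zeros each factor misses 1 by at most [exp (- t) <= 1 / t] with
    [t = b * c * r ^+ 2]. The hypothesis on [b] makes these errors add up to at most 1/2. *)
Lemma notches_lb : exists2 c, 0 < c & forall b s x r, 0 < r -> 1 <= b ->
  2 * (size s)%:R <= c * r ^+ 2 * b ->
  (forall z (m : int), z \in s -> r <= `|x - z - m%:~R|) ->
  2^-1 <= notches b s x.
Proof.
have [c c0 cP] := sqsin_lb; exists c => // b s x r r0 b1 sb far.
have b0 : 0 < b by lra.
set e := (b * (c * r ^+ 2))^-1.
have e0 : 0 < b * (c * r ^+ 2) by rewrite !mulr_gt0// exprn_gt0.
have fz z : z \in s -> 1 - notch b (x - z) <= e.
  move=> zs; rewrite /notch opprB addrC subrK mulNr expRN lef_pV2 ?posrE ?expR_gt0//.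
  apply: (@le_trans _ _ (b * sqsin (x - z))); last first.
    by rewrite (le_trans _ (expR_ge1Dx _))// lerDr.
  by rewrite ler_pM2l//; apply: cP => // m; exact: far.
have := @prod_ge_1Bsum _ s (fun z => notch b (x - z)) (fun z => notch01 _ (ltW b0)).
apply: le_trans.
have : \sum_(z <- s) (1 - notch b (x - z)) <= (size s)%:R * e.
  rewrite mulr_natl -(count_predT s) -iter_addr_0 -big_const_seq.
  by rewrite big_seq [leRHS]big_seq; exact: ler_sum.
have : (size s)%:R * e <= 2^-1.
  rewrite /e ler_pdivrMr//; lra.
lra.
Qed.

End Bump.

(** * Denjoy's inequality at a tangency with a rational translation *)

Section Lifts.
Variable R : realType.
Implicit Types (F G : R -> R) (a x y s t : R).

Definition diffeo_lift F := [/\ smooth F, (forall x, 0 < F^`() x) & deg1 F].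

Lemma diffeo_lift_lt F : diffeo_lift F -> {homo F : x y / x < y}.
Proof.
move=> [Fs Fp _] x y xy; have [c _ cE] := smooth_MVT Fs (ltW xy).
by rewrite -subr_gt0 cE mulr_gt0// subr_gt0.
Qed.

Lemma diffeo_lift_homo F : diffeo_lift F -> {homo F : x y / x <= y}.
Proof. by move=> /diffeo_lift_lt/ltW_homo. Qed.

Lemma diffeo_lift_mono F : diffeo_lift F -> {mono F : x y / x <= y}.
Proof. by move=> /diffeo_lift_lt; exact: le_mono. Qed.

Lemma diffeo_lift_shift F s : diffeo_lift F -> diffeo_lift (fun x => F x + s).
Proof.
move=> [Fs Fp F1]; split.
- exact (smoothD Fs (@smooth_cst R s)).
- move=> x; rewrite (deriv_add Fs (@smooth_cst R s)).
  have -> : (fun=> s : R)^`() = fun=> 0 by exact: (derivn_const s 0).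
  by rewrite addr0.
- by move=> x; rewrite F1 addrAC.
Qed.

Lemma deg1_continuous_surj F y : continuous F -> deg1 F -> exists x, F x = y.
Proof.
move=> Fc F1; set n := Num.bound (y - F 0).
have n1 : y - F 0 < n%:R by exact: ltr_bound.
have n2 : - (y - F 0) < n%:R by exact: ltrNbound.
have [||x _ <-] := @IVT R F (- n%:R) n%:R y _ (continuous_subspaceT Fc).
- by rewrite ge0_cp.
- have := deg1Z (n : int) 0 F1; have := deg1Z (- (n : int)) 0 F1.
  rewrite !add0r mulrNz => -> ->; rewrite ge_min le_max; lra.
by exists x.
Qed.

Lemma diffeo_lift_iter F n : diffeo_lift F -> diffeo_lift (iter n F).
Proof.
move=> Fl; elim: n => [|n [Is Ip I1]].
  split=> //; first exact: smooth_id.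
  by move=> x; rewrite derive1_id.
have [Fs Fp F1] := Fl.
split; last by move=> x /=; rewrite I1 F1.
  exact (smooth_comp Fs Is).
move=> x; suff -> : (iter n.+1 F)^`() = fun z => F^`() (iter n F z) * (iter n F)^`() z.
  by rewrite mulr_gt0.
apply: is_derive_fun => z; apply: (@is_derive1_comp R F (iter n F)).
  exact: smooth_is_derive.
exact: smooth_is_derive.
Qed.

Lemma deriv_iter F n x : smooth F -> smooth (iter n F) /\
  (iter n F)^`() x = \prod_(i < n) F^`() (iter i F x).
Proof.
move=> Fs; elim: n x => [|n IH] x.
  by split; [exact: smooth_id|rewrite big_ord0 derive1_id].
have Is : smooth (iter n F) by have [] := IH x.
split; first exact (smooth_comp Fs Is).
rewrite big_ord_recr /= mulrC -(IH x).2.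
suff -> : (iter n.+1 F)^`() = fun z => F^`() (iter n F z) * (iter n F)^`() z by [].
apply: is_derive_fun => z; apply: (@is_derive1_comp R F (iter n F));
  exact: smooth_is_derive.
Qed.

End Lifts.

Section Denjoy.
Variables (R : realType) (G : R -> R) (q : nat) (p : int) (L Lam x0 : R).
Hypotheses (Gl : diffeo_lift G) (q0 : (0 < q)%N) (pq : coprime `|p|%N q).
Hypothesis GL : forall x, G^`() x <= L.
(** This says that the logarithm of [G'] is [Lam]-Lipschitz. *)
Hypothesis GLam : forall x y, G^`() y * expR (- (Lam * `|x - y|)) <= G^`() x.
Hypothesis Lam0 : 0 <= Lam.
Hypothesis Gqp : forall x, x + p%:~R <= iter q G x.
Hypothesis Gx0 : iter q G x0 = x0 + p%:~R.

Let Gs : smooth G. Proof. by case: Gl. Qed.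
Let G1 : deg1 G. Proof. by case: Gl. Qed.
Let Gh : {homo G : x y / x <= y}. Proof. exact: diffeo_lift_homo. Qed.

Let bezout : exists (u : nat) (v : int), (u : int) * p - v * (q : int) = 1.
Proof.
have [u [v uv]] := Bezoutz p q.
have g1 : u * p + v * (q : int) = 1 by rewrite uv /gcdz /= (eqP pq).
(* Adding [k * q] to the first Bezout coefficient makes it a natural number, hence a number of
   iterations. *)
pose k := `|u|%N.
exists (absz (u + k%:Z * q)%R), (k%:Z * p - v).
have -> : (absz (u + k%:Z * q)%R : int) = u + k%:Z * q by rewrite /k; nia.
by rewrite -[RHS]g1; ring.
Qed.

Let fixed a := iter q G a = a + p%:~R.

Let iterq_fixed a k : fixed a -> iter (k * q) G a = a + (k%:Z * p)%:~R.
Proof.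
move=> fa; elim: k => [|k IH]; first by rewrite mul0r addr0.
rewrite mulSn iterD IH deg1Z; last exact: iter_deg1.
by rewrite fa -addrA -intrD; congr (_ + _%:~R); lia.
Qed.

(* [S] is the power of [G] that moves every point of the periodic orbit to its
   right neighbour: on that orbit, [S] composed [q] times is the translation
   by 1. *)
Let gaps : exists S : R -> R, forall a, fixed a ->
  [/\ fixed (S a), iter q S a = a + 1 &
      \sum_(i < q) (iter i G (S a) - iter i G a) = 1].
Proof.
have [u [v uv]] := bezout.
pose S y := iter u G y - v%:~R.
have S1 : deg1 S by move=> y; rewrite /S iter_deg1// addrAC.
have SG n y : iter n G (S y) = S (iter n G y).
  rewrite /S -mulrNz deg1Z; last exact: iter_deg1.
  by rewrite -!iterD addnC.
have iS n y : iter n S y = iter (u * n) G y - (n%:Z * v)%:~R.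
  elim: n y => [|n IH] y; first by rewrite muln0 mul0r subr0.
  rewrite iterS IH {1}/S -mulrNz deg1Z; last exact: iter_deg1.
  rewrite -iterD -mulnS -addrA; congr (_ + _).
  by rewrite -mulrNz -intrD -mulrNz; congr (_%:~R); lia.
exists S => a fa.
have fSa : fixed (S a).
  rewrite /fixed SG fa; exact: deg1Z.
have iSq : iter q S a = a + 1.
  rewrite iS iterq_fixed// -addrA; congr (_ + _).
  by rewrite -mulrNz -intrD (_ : _ - _ = 1)//; rewrite -uv; ring.
split=> //.
under eq_bigr do rewrite SG.
have dper : periodic (fun y => S y - y) by move=> y; rewrite S1; ring.
(* Since [u] is invertible modulo [q], [j |-> u * j mod q] permutes the indices. For
   [i = u * j mod q] the point [G^i a] is [S^j a] up to an integer, so the gaps are those between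
   consecutive points [S^j a], and their lengths telescope to [S^q a - a = 1]. *)
pose f (j : 'I_q) : 'I_q := Ordinal (ltn_pmod (u * j) q0).
have finj : injective f.
  move=> i j /(congr1 val)/= ij; apply/val_inj => /=.
  have := divn_eq (u * i) q; have := divn_eq (u * j) q; rewrite ij.
  move: (_ %/ _)%N (_ %/ _)%N (_ %% _)%N => c d e uj ui.
  have ijq : (i : nat)%:Z - (j : nat)%:Z = (q : int) *
      ((c%:Z - d%:Z) * p - v * ((i : nat)%:Z - (j : nat)%:Z)).
    have : u%:Z * ((i : nat)%:Z - (j : nat)%:Z) = (c%:Z - d%:Z) * q by lia.
    move=> ud; rewrite -[LHS]mul1r -uv mulrBl [u%:Z * p]mulrC -mulrA ud; ring.
  move: ijq; move: (_ * p - _) => w ijq.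
  have [iq jq] := (ltn_ord i, ltn_ord j).
  have w0 : w = 0 by nia.
  by move: ijq; rewrite w0; lia.
rewrite (reindex_inj finj) /=.
have -> : 1 = \sum_(j < q) (iter j.+1 S a - iter j S a).
  rewrite -(big_mkord xpredT (fun j => iter j.+1 S a - iter j S a)).
  by rewrite telescope_sumr// iSq /= addrAC subrr add0r.
apply: eq_bigr => j _.
rewrite iterS iS -mulrNz (periodicZ _ _ dper).
rewrite {3 4}(divn_eq (u * j) q) addnC iterD iterq_fixed// deg1Z; last exact: iter_deg1.
by rewrite (periodicZ _ _ dper).
Qed.

(** By [Gqp] the displacement of [iter q G] is minimal at [a], so its derivative vanishes there. *)
Let Dfix a : fixed a -> (iter q G)^`() a = 1.
Proof.
move=> fa; have [Is _] := deriv_iter q a Gs.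
have gs : smooth (fun z => iter q G z + - z).
  exact (smoothD Is (smoothN (@smooth_id R))).
have g0 : is_derive a 1 (fun z => iter q G z + - z) 0.
  apply: (@derive1_at_min R _ (a - 1) (a + 1)).
  - lra.
  - by move=> t _; exact: (gs 0%N).
  - rewrite in_itv/=; lra.
  - by move=> t _; rewrite fa; have := Gqp t; lra.
have g1 : is_derive a 1 (fun z => iter q G z + - z) ((iter q G)^`() a + - 1).
  exact: (is_deriveD (smooth_is_derive Is a) (is_deriveN (is_derive_id a 1))).
have := @derive_val _ _ _ _ _ _ _ g0.
by rewrite (@derive_val _ _ _ _ _ _ _ g1); lra.
Qed.

(** Denjoy's distortion estimate: the orbits of [x] and [a] stay in common gaps, so the logarithms
    of the two products of derivatives differ by at most [Lam] times the total length 1 of the gaps;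
    the product along the orbit of [a] is 1. *)
Let Dq_lb_near a b x : fixed a -> a <= x <= b ->
  \sum_(i < q) (iter i G b - iter i G a) = 1 ->
  expR (- Lam) <= (iter q G)^`() x.
Proof.
move=> fa /andP[ax xb] sum1; rewrite (deriv_iter q x Gs).2.
have le (i : nat) : iter i G a <= iter i G x <= iter i G b.
  by rewrite !(iter_homo i Gh).
apply: (@le_trans _ _ (\prod_(i < q)
    (G^`() (iter i G a) * expR (- (Lam * `|iter i G x - iter i G a|))))).
  rewrite big_split /= -(deriv_iter q a Gs).2 Dfix// mul1r.
  rewrite -expR_sum ler_expR sumrN lerN2 -mulr_sumr ler_piMr//.
  rewrite -sum1; apply: ler_sum => i _; have /andP[? ?] := le i.
  by rewrite ger0_norm ?subr_ge0// lerD2r.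
apply: ler_prod => i _; rewrite mulr_ge0 ?expR_ge0//=.
by rewrite ltW//; case: Gl.
Qed.

Let Dq_lb x : expR (- Lam) <= (iter q G)^`() x.
Proof.
have [S SP] := gaps.
have itS j : fixed (iter j S x0) by elim: j => // j; case/SP.
have [_ Sq _] := SP _ Gx0.
pose m := Num.floor (x - x0).
have m1 : m%:~R <= x - x0 by exact: ge_floor.
have m2 : x - x0 < m%:~R + 1 by have := floorD1_gt (x - x0); rewrite intrD.
have [Is _] := deriv_iter q x Gs.
rewrite -(subrK m%:~R x) periodicZ; last first.
  by apply: deg1_deriv => //; exact: iter_deg1.
set y := x - m%:~R.
have y1 : x0 <= y by rewrite /y; lra.
have y2 : y < iter q S x0 by rewrite Sq /y; lra.
(* The points [S^j x0] run from [x0] to [x0 + 1]; the first one beyond [y] closes a gap containing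
   [y]. *)
have ex : exists j, y < iter j S x0 by exists q.
have [j yj jmin] := ex_minnP ex.
case: j yj jmin => [|j] yj jmin; first by move: yj => /=; lra.
have yj' : iter j S x0 <= y.
  by rewrite leNgt; apply/negP => /jmin; rewrite ltnn.
have [_ _ sum1] := SP _ (itS j).
by apply: Dq_lb_near (itS j) _ sum1; rewrite yj'/= ltW.
Qed.

(** Raising [G x] by [h] amounts to starting from a point [y] with [y - x >= h / L], and [iter q G]
    contracts this distance at most by [expR (- Lam)]. *)
Lemma denjoy_expansion x h : 0 <= h ->
  iter q G x + expR (- Lam) / L * h <= iter q.-1 G (G x + h).
Proof.
move=> h0; have [y yE] := deg1_continuous_surj (G x + h) (smooth_continuous Gs) G1.
rewrite -yE -iterSr prednK//.
have xy : x <= y by rewrite -(diffeo_lift_mono Gl) yE lerDl.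
have [c _ cE] := smooth_MVT Gs xy.
have [Is _] := deriv_iter q x Gs.
have [d _ dE] := smooth_MVT Is xy.
have L0 : 0 < L by apply: lt_le_trans (GL 0); case: Gl.
have hE : h <= L * (y - x).
  have -> : h = G y - G x by rewrite yE; ring.
  by rewrite cE ler_wpM2r ?subr_ge0.
rewrite -lerBrDl dE; apply: (@le_trans _ _ (expR (- Lam) * (y - x))).
  by rewrite mulrAC -mulrA ler_pM2l ?expR_gt0// ler_pdivrMr// mulrC.
by rewrite ler_wpM2r ?subr_ge0// Dq_lb.
Qed.

End Denjoy.

(** * Perturbation with a prescribed rotation number *)

Section Perturbation.
Variable R : realType.
Implicit Types (F G phi : R -> R) (a x y s t L : R).

Lemma iter_shift_lipschitz F L n : 0 <= L ->
  (forall x y, `|F x - F y| <= L * `|x - y|) ->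
  exists2 C, 0 < C & forall s t x,
    `|iter n (fun x => F x + s) x - iter n (fun x => F x + t) x| <= C * `|s - t|.
Proof.
move=> L0 FL; elim: n => [|n [C C0 IH]].
  by exists 1 => // s t x; rewrite subrr normr0 mul1r.
exists (L * C + 1); first by rewrite ltr_wpDl// mulr_ge0// ltW.
move=> s t x /=; rewrite opprD addrACA (le_trans (ler_normD _ _))//.
by rewrite mulrDl mul1r lerD2r (le_trans (FL _ _))// -mulrA ler_wpM2l.
Qed.

Lemma iter_shift_le F n s x : {homo F : x y / x <= y} -> 0 <= s ->
  iter n.+1 (fun x => F x - s) x <= iter n.+1 F x - s.
Proof.
move=> Fh s0 /=; rewrite lerD2r Fh// (@iter_le _ (fun x => F x - s) F)//.
  by move=> y z yz; rewrite lerD2r Fh.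
by move=> y; rewrite gerBl.
Qed.

Variables (F : R -> R) (alpha L Lam : R) (q : nat) (p : int).
Hypotheses (Fl : diffeo_lift F) (Fa : rot F alpha).
Hypotheses (q0 : (0 < q)%N) (pq : coprime `|p|%N q).
Hypothesis qa : p%:~R < q%:R * alpha.
Hypothesis FL : forall x, F^`() x <= L.
Hypothesis Lam0 : 0 <= Lam.
Hypothesis FLam : forall x y, F^`() y * expR (- (Lam * `|x - y|)) <= F^`() x.

Let theta := q%:R * alpha - p%:~R.
Let theta0 : 0 < theta. Proof. by rewrite subr_gt0. Qed.
Let F1 : deg1 F. Proof. by case: Fl. Qed.
Let Fs : smooth F. Proof. by case: Fl. Qed.
Let Fh : {homo F : x y / x <= y}. Proof. exact: diffeo_lift_homo. Qed.

Let iterq_gt x : x + p%:~R < iter q F x.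
Proof.
rewrite ltNge; apply/negP => /(rot_iter_le Fh F1 Fa).
by rewrite leNgt qa.
Qed.

(** If all points moved by more than [p + 2 * theta] in [q] steps, then [q * alpha] would be at
    least [p + 2 * theta], whereas it is [p + theta]. *)
Let small_displacement : exists x, iter q F x <= x + p%:~R + 2 * theta.
Proof.
apply: contrapT => /forallNP far.
have it k : k%:R * (p%:~R + 2 * theta) <= iter (k * q) F 0.
  elim: k => [|k IH]; first by rewrite mul0r.
  have /negP := far (iter (k * q) F 0); rewrite -ltNge -iterD -mulSn => h.
  by rewrite -natr1 mulrDl mul1r; lra.
have : theta <= 0.
  apply: (@le0_archi _ _ 2) => k.
  have := Fa (k * q)%N 0; rewrite ler_norml natrM => /andP[_ ?].
  by have := it k; rewrite /theta; lra.
by rewrite leNgt theta0.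
Qed.

Let L0 : 0 < L. Proof. by apply: lt_le_trans (FL 0); case: Fl. Qed.

Let Flip x y : `|F x - F y| <= L * `|x - y|.
Proof.
apply: lipschitz_deriv => // z.
by rewrite ger0_norm// ltW//; case: Fl.
Qed.

(* The smallest [F - s] that still moves every point by at least [p] under [q]
   iterations touches the translation by [p]: it has a periodic orbit. *)
Let tangency : exists s, [/\ 0 <= s <= 2 * theta,
  forall x, x + p%:~R <= iter q (fun x => F x - s) x &
  exists x0, iter q (fun x => F x - s) x0 = x0 + p%:~R].
Proof.
pose E := [set s | 0 <= s /\ forall x, x + p%:~R <= iter q (fun x => F x - s) x].
have E0 : E 0.
  split=> // x; apply: (le_trans (ltW (iterq_gt x))).
  rewrite (_ : (fun x => F x - 0) = F)//.
  by apply/funext => z; rewrite subr0.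
(* Subtracting [s] at each step lowers the [q]-th iterate by at least [s], so a point of small
   displacement bounds [s]. *)
have Eub : ubound E (2 * theta).
  move=> s [s0 Es]; have [x xd] := small_displacement.
  have := Es x; have := @iter_shift_le F q.-1 s x Fh s0.
  by rewrite prednK//; lra.
have Esup : has_sup E by split; [exists 0|exists (2 * theta)].
pose s := sup E.
have s0 : 0 <= s by apply: ub_le_sup => //; case: Esup.
have s2 : s <= 2 * theta by apply: ge_sup => //; case: Esup.
have [C C0 CP] := iter_shift_lipschitz q (ltW L0) Flip.
have Es x : x + p%:~R <= iter q (fun x => F x - s) x.
  apply/ler_addgt0Pr => e e0.
  have [t [t0 Et] st] := sup_adherent (divr_gt0 e0 C0) Esup.
  have ts : t <= s by apply: ub_le_sup => //; case: Esup.
  apply: (le_trans (Et x)); have := CP (- t) (- s) x.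
  rewrite (_ : - t - - s = s - t); last by ring.
  rewrite (ger0_norm (_ : 0 <= s - t)); last by rewrite subr_ge0.
  have : C * (s - t) <= e by rewrite mulrC -ler_pdivlMr//; rewrite -/s in st; lra.
  by move=> ?; rewrite ler_norml => /andP[_ ?]; lra.
exists s; split=> //; first by rewrite s0.
(* Without equality, the displacement minus [p] has a positive minimum [m] over a period, and
   [s + m / C] would still belong to [E]. *)
apply: contrapT => /forallNP neq.
have Gl : diffeo_lift (fun x => F x - s) by exact: diffeo_lift_shift.
have [Is _ I1] := diffeo_lift_iter q Gl.
pose g x := iter q (fun x => F x - s) x - x - p%:~R.
have gc : continuous g.
  move=> x; apply: cvgB; last exact: cvg_cst.
  by apply: cvgB; [exact: smooth_continuous|exact: cvg_id].
have gp : periodic g by move=> x; rewrite /g I1; ring.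
have g0 x : 0 < g x.
  have := Es x; rewrite le_eqVlt => /orP[/eqP xE|]; last by rewrite /g; lra.
  by have := neq x; rewrite xE.
have [m m0 mg] := periodic_pos gc gp g0.
have : E (s + m / C).
  split; first by rewrite addr_ge0// divr_ge0// ltW.
  move=> x; have := CP (- (s + m / C)) (- s) x.
  rewrite (_ : - (s + m / C) - - s = - (m / C)); last by ring.
  rewrite normrN (ger0_norm (_ : 0 <= m / C)); last by rewrite divr_ge0// ltW.
  rewrite mulrCA mulfV ?gt_eqF// mulr1 ler_norml => /andP[? _].
  by have := mg x; rewrite /g; lra.
move=> /ub_le_sup -/(_ _)/wrap[]; first by case: Esup.
by rewrite -/s gerDl leNgt divr_gt0.
Qed.

(** The zeros [xs] come before [phi], which is built from them. As [phi] vanishes on the periodic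
    orbit of [F - s], that orbit survives in [F + phi - s], whose rotation number is thus at most
    [p / q < alpha]; that of [F + phi >= F] is at least [alpha]. *)
Lemma perturbation : exists2 xs : seq R, size xs = q & forall phi,
  periodic phi -> continuous phi -> (forall x, 0 <= phi x) ->
  (forall z (m : int), z \in xs -> phi (z + m%:~R) = 0) ->
  {homo (fun x => F x + phi x) : x y / x <= y} ->
  exists2 s, - (2 * theta) <= s <= 0 &
    rot (fun x => F x + phi x + s) alpha /\
    forall x, x + p%:~R + expR (- Lam) / L * phi x <=
      iter q (fun x => F x + phi x + s) x.
Proof.
have [s [/andP[s0 s2] Es [x0 Ex0]]] := tangency.
pose G x := F x - s.
have Gl : diffeo_lift G by exact: diffeo_lift_shift.
have GF : G^`() = F^`().
  rewrite (deriv_add Fs (@smooth_cst R (- s))); apply/funext => x.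
  have -> : (fun=> - s : R)^`() = fun=> 0 by exact: (derivn_const (- s) 0).
  by rewrite addr0.
have expand x h : 0 <= h ->
    iter q G x + expR (- Lam) / L * h <= iter q.-1 G (G x + h).
  by apply: denjoy_expansion Ex0 _ _ => //; rewrite GF.
exists [seq iter i G x0 | i <- iota 0 q]; first by rewrite size_map size_iota.
move=> phi phip phic phi0 phiz homo.
have homos t : {homo (fun x => F x + phi x + t) : x y / x <= y}.
  by move=> x y xy; rewrite lerD2r homo.
have d1 t : deg1 (fun x => F x + phi x + t).
  by move=> x; rewrite F1 phip; ring.
have [a0 a0P] := rot_exists (homos (- s)) (d1 _).
have [a1 a1P] := rot_exists (homos 0) (d1 _).
have orbit i : (i <= q)%N -> iter i (fun x => F x + phi x - s) x0 = iter i G x0.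
  elim: i => // i IH iq; rewrite !iterS IH ?(ltnW iq)// /G.
  have := @phiz (iter i G x0) 0; rewrite addr0 => ->; first by rewrite addr0.
  by apply/mapP; exists i => //; rewrite mem_iota.
have a0a : a0 <= alpha.
  have := @rot_iter_le _ _ a0 q p x0 (homos (- s)) (d1 _) a0P.
  rewrite orbit// Ex0 lexx => /(_ isT) a0p.
  rewrite -(ler_pM2l (_ : 0 < q%:R :> R)) ?ltr0n//.
  exact: (le_trans a0p (ltW qa)).
have aa1 : alpha <= a1.
  by apply: (rot_le Fh _ Fa a1P) => x; rewrite addr0 lerDl.
have [||||t /andP[ts t0] rt] := @rot_ivt _ (fun x => F x + phi x) alpha a0 a1 (- s) 0
    homo _ _ _ a0P a1P.
- by move=> x; rewrite F1 phip addrAC.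
- by move=> x; apply: cvgD; [exact: smooth_continuous|exact: phic].
- by rewrite oppr_le0.
- by rewrite a0a.
exists t; first by apply/andP; split=> //; lra.
split=> // x.
(* Only the first of the [q] steps uses the gain [phi x]; in the others the perturbed map is bounded
   below by [G]. *)
apply: (@le_trans _ _ (iter q G x + expR (- Lam) / L * phi x)).
  by rewrite lerD2r Es.
apply: (le_trans (expand x _ (phi0 x))).
rewrite -[in leRHS](prednK q0) iterSr.
set H := fun x => F x + phi x + t.
apply: (@le_trans _ _ (iter q.-1 G (H x))).
  apply: iter_homo; first exact: diffeo_lift_homo.
  by rewrite /G /H; lra.
apply: iter_le; first exact: diffeo_lift_homo.
by move=> y; rewrite /G /H; have := phi0 y; lra.
Qed.

End Perturbation.

(** * Time spent away from the periodic orbit *)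

Section Counting.
Variable R : realType.
Implicit Types (G f : R -> R) (x : R).

(** Split the times by residue modulo [q]. In each class the displacements under [iter q G]
    telescope to that of [iter (k * q) G], which is at most [k * q * alpha + 2]. *)
Lemma sum_orbit_le G (alpha : R) (q : nat) (p : int) f (k : nat) x :
  rot G alpha -> (forall x, x + p%:~R + f x <= iter q G x) ->
  \sum_(i < k * q) f (iter i G x) <=
    q%:R * (k%:R * (q%:R * alpha - p%:~R) + 2).
Proof.
move=> Ga Gf.
apply: (@le_trans _ _ (\sum_(i < q)
    (iter (k * q) G (iter i G x) - iter i G x - k%:R * p%:~R))).
  elim: k => [|k IH].
    rewrite mul0n big_ord0 sumr_ge0// => i _.
    by rewrite /= mul0r subr0 subrr.
  rewrite mulSnr big_split_ord /=.
  rewrite (le_trans (lerD IH (lexx _)))// -big_split /=.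
  apply: ler_sum => i _.
  have := Gf (iter (k * q) G (iter i G x)).
  have -> : iter q G (iter (k * q) G (iter i G x)) =
      iter (k * q + q) G (iter i G x) by rewrite addnC iterD.
  have -> : iter (k * q) G (iter i G x) = iter (k * q + i) G x by rewrite iterD.
  rewrite -natr1.
  lra.
set c := k%:R * _ + 2.
rewrite (_ : q%:R * c = \sum_(i < q) c); last by rewrite sumr_const card_ord mulr_natl.
apply: ler_sum => i _; rewrite /c.
have := Ga (k * q)%N (iter i G x); rewrite ler_norml natrM => /andP[_ ?].
lra.
Qed.

End Counting.

Section Concentration.
Variable R : realType.
Implicit Types (F G psi : R -> R) (a x y s t L : R).

Definition far (xs : seq R) (r : R) x : bool :=
  `[< forall z (m : int), z \in xs -> r <= `|x - z - m%:~R| >].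

(* All orbits spend a proportion at least 1 - 2^-n of the times [i < M] near [xs].
   The auxiliary [w] bounds the (n+1)-th root of the diameters of the arcs. *)
Definition concentrated n G := exists (xs : seq R) (r w : R) (M : nat),
  [/\ 0 < r, 0 < w, 4 * r <= w ^+ n.+1, (size xs)%:R * w <= 2^-1 ^+ n & (0 < M)%N]
  /\ forall x, \sum_(i < M) (far xs r (iter i G x))%:R <= 2^-1 ^+ n * M%:R :> R.

Definition approximable alpha F K n eta := exists2 psi : R -> R,
  [/\ smooth psi, periodic psi & forall j x, (j <= K)%N -> `|psi^`(j) x| <= eta] &
  [/\ diffeo_lift (fun x => F x + psi x), rot (fun x => F x + psi x) alpha &
      concentrated n (fun x => F x + psi x)].

Lemma pow2_small e : 0 < e -> exists N : nat, 2^-1 ^+ N <= e :> R.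
Proof.
move=> e0; exists (Num.bound e^-1).
rewrite exprVn -[leRHS]invrK lef_pV2 ?posrE ?invr_gt0 ?exprn_gt0//.
by rewrite ltW// upper_nthrootP.
Qed.

(** [Lam = M / m] bounds [|F''| / F']; the inequality [1 + t <= exp t] replaces the logarithm. *)
Lemma diffeo_lift_bounds F : diffeo_lift F -> exists L Lam m : R,
  [/\ 0 < L, 0 <= Lam, 0 < m, (forall x, m <= F^`() x <= L) &
     forall x y, F^`() y * expR (- (Lam * `|x - y|)) <= F^`() x].
Proof.
move=> [Fs Fp F1]; have F's := smooth_deriv Fs.
have F'p := deg1_deriv Fs F1.
have [L L0 FL] := periodic_bounded (smooth_continuous F's) F'p.
have [m m0 Fm] := periodic_pos (smooth_continuous F's) F'p Fp.
have [M M0 FM] := periodic_bounded (smooth_continuous (smooth_deriv F's))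
  (periodic_deriv F's F'p).
exists L, (M / m), m; split=> //; first by rewrite divr_ge0// ltW.
  by move=> x; rewrite Fm/= (le_trans (ler_norm _)).
move=> x y; set d := `|x - y|.
have := lipschitz_deriv F's FM x y; rewrite -/d ler_norml => /andP[h _].
rewrite expRN ler_pdivrMr ?expR_gt0//.
apply: (@le_trans _ _ (F^`() x * (1 + M / m * d))); last first.
  by rewrite ler_pM2l// expR_ge1Dx.
have : M * d <= F^`() x * (M / m * d).
  rewrite mulrA ler_wpM2r ?normr_ge0// mulrCA -[leLHS]mulr1 ler_pM2l//.
  by rewrite ler_pdivlMr// mul1r.
lra.
Qed.

Lemma approximable_above F alpha K n eta : diffeo_lift F -> rot F alpha ->
  0 < eta -> exists N : nat, forall (p : int) (q : nat), (2 <= q)%N ->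
  coprime `|p|%N q -> 0 < q%:R * alpha - p%:~R <= q%:R^-1 ^+ N ->
  approximable alpha F K n eta.
Proof.
move=> Fl Fa eta0.
have [L [Lam [m [L0 Lam0 m0 Fb FLam]]]] := diffeo_lift_bounds Fl.
have [Fs Fp F1] := Fl.
have [C C1 Cb] := notches_dbound R K.+1.
have [c0 c00 c0b] := notches_lb R.
(* The bound [m / 2] on [phi'] keeps [F + phi] a diffeomorphism; to have it also for [K = 0],
   derivatives up to order [K.+1] are controlled. Half of [eta] is kept for the constant [s]. *)
pose eta' := Num.min (eta / 2) (m / 2).
have eta'0 : 0 < eta' by rewrite lt_min !divr_gt0.
have eta'1 : eta' <= eta / 2 by rewrite ge_min lexx.
have eta'2 : eta' <= m / 2 by rewrite ge_min lexx orbT.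
(* With [b = b0 * q ^ (1 + 2 * m0')] and [r = q ^ (- m0')], the condition of [notches_lb] becomes
   [2 * q <= c0 * b0 * q]. *)
pose b0 := Num.max 1 (2 / c0).
have b01 : 1 <= b0 by rewrite le_max lexx.
have b02 : 2 <= c0 * b0 by rewrite mulrC -ler_pdivrMr// le_max lexx orbT.
(* The choice [w = q ^ (- (n + 1))] gives [q * w = q ^ (- n) <= 2 ^ (- n)]. The exponent of [r] is
   that of [w ^+ n.+1] plus 2, which pays for the factor 4 as [q >= 2]. *)
pose m0' := (n.+1 * n.+1 + 2)%N.
pose c := expR (- Lam) / L.
have c_gt0 : 0 < c by rewrite divr_gt0// expR_gt0.
pose e := 2^-1 ^+ n : R.
have e_gt0 : 0 < e by rewrite exprn_gt0.
(* The target [theta <= c * delta * e / 4] depends on [q] through [q ^ (- (2 + 2 * m0') * K.+1)];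
   [kappa] is the remaining constant, absorbed by [N1] further powers of [1 / q <= 1 / 2]. *)
pose kappa := c * e * eta' / (4 * (C * b0) ^+ K.+1).
have Cb00 : 0 < C * b0 by rewrite mulr_gt0//; lra.
have kappa0 : 0 < kappa.
  apply: divr_gt0; first exact: mulr_gt0 (mulr_gt0 c_gt0 e_gt0) eta'0.
  by apply: mulr_gt0 => //; exact: exprn_gt0.
have [|N1 N1P] := @pow2_small (Num.min kappa (eta / 4)).
  by rewrite lt_min kappa0 divr_gt0.
have [N1k N1e] : 2^-1 ^+ N1 <= kappa /\ 2^-1 ^+ N1 <= eta / 4.
  by move: N1P; rewrite le_min => /andP[].
exists ((2 + 2 * m0') * K.+1 + N1)%N => p q q2 pq /andP[th0 thN].
set Q := q%:R^-1 in thN.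
have q0 : (0 < q)%N by exact: leq_trans q2.
have qR : 0 < q%:R :> R by rewrite ltr0n.
have qR2 : 2 <= q%:R :> R by rewrite ler_nat.
have qR1 : 1 <= q%:R :> R by rewrite ler1n.
have Q0 : 0 < Q by rewrite invr_gt0.
have Q2 : Q <= 2^-1 by rewrite lef_pV2 ?posrE.
have Q1 : Q <= 1 by lra.
have Qpow k : Q ^+ k <= 2^-1 ^+ k by apply: lerXn2r => //; rewrite nnegrE ?invr_ge0// ltW.
have Qpow0 k : 0 < Q ^+ k by rewrite exprn_gt0.
have qQ k : q%:R ^+ k * Q ^+ k = 1.
  by rewrite -exprMn mulfV ?gt_eqF// expr1n.
set theta := q%:R * alpha - p%:~R in th0 thN.
pose r := Q ^+ m0'.
pose b := b0 * q%:R ^+ (1 + 2 * m0').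
have b1 : 1 <= b by rewrite /b mulr_ege1// exprn_ege1.
pose A := q%:R * (C * b).
have AE : A = C * b0 * q%:R ^+ (2 + 2 * m0').
  by rewrite /A /b (_ : 2 + _ = (1 + 2 * m0').+1)%N// exprS; ring.
have A1 : 1 <= A by rewrite /A mulr_ege1// mulr_ege1.
have A0 : 0 < A by exact: lt_le_trans A1.
(* [A] is the derivative scale of the product of notches, so the [j]-th derivative of [phi] is at
   most [delta * A ^+ j <= eta']. *)
pose delta := eta' / A ^+ K.+1.
have delta0 : 0 < delta by rewrite divr_gt0// exprn_gt0.
have deltaA j : (j <= K.+1)%N -> delta * A ^+ j <= eta'.
  move=> jK; rewrite -mulrAC ler_pdivrMr ?exprn_gt0// ler_pM2l//.
  by rewrite ler_weXn2l.
have th1 : theta <= c * delta * e / 4.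
  apply: (le_trans thN); rewrite exprD.
  have -> : c * delta * e / 4 = Q ^+ ((2 + 2 * m0') * K.+1) * kappa.
    rewrite /delta /kappa AE exprMn -exprM.
    have := qQ ((2 + 2 * m0') * K.+1)%N.
    set u := q%:R ^+ _; set v := Q ^+ _; set w := _ ^+ K.+1 => uv.
    have u0 : u != 0 by rewrite expf_neq0// gt_eqF.
    have w0 : w != 0 by rewrite expf_neq0// gt_eqF.
    have -> : v = u^-1 by apply: (mulfI u0); rewrite uv mulfV.
    by field; rewrite u0 w0.
  by rewrite ler_pM2l// (le_trans (Qpow _)).
have th2 : 2 * theta <= eta / 2.
  have : Q ^+ ((2 + 2 * m0') * K.+1 + N1) <= Q ^+ N1.
    by apply: ler_wiXn2l => //; [exact: ltW|exact: leq_addl].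
  by have := Qpow N1; lra.
have qap : p%:~R < q%:R * alpha by rewrite -subr_gt0.
have FL x : F^`() x <= L by case/andP: (Fb x).
have [xs xsq xsP] := perturbation Fl Fa q0 pq qap FL Lam0 FLam.
pose phi x := delta * notches b xs x.
have phis : smooth phi by exact (smoothM (@smooth_cst R delta) (@notches_smooth R b xs)).
have phip : periodic phi by move=> x; rewrite /phi notches_periodic.
have b_ge0 : 0 <= b by exact: le_trans b1.
have phi0 x : 0 <= phi x.
  apply: mulr_ge0; first exact: ltW.
  by case/andP: (notches01 xs x b_ge0).
have phib : dbound K.+1 delta A phi.
  rewrite -[delta]mulr1 -[A]add0r; apply: dboundM; [exact: smooth_cst|
    exact: notches_smooth|by apply: dbound_cst; rewrite ger0_norm// ltW|].
  by rewrite /A -xsq; exact: Cb.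
have phij j x : (j <= K.+1)%N -> `|phi^`(j) x| <= eta'.
  by move=> jK; rewrite (le_trans (dbound_derivn x phib jK))// deltaA.
have Gl0 : diffeo_lift (fun x => F x + phi x).
  split; first exact: smoothD.
    move=> x; rewrite deriv_add//.
    have := phij 1%N x (isT : (1 <= K.+1)%N); rewrite ler_norml => /andP[? _].
    have /andP[? _] := Fb x.
    have -> : phi^`() x = phi^`(1) x by [].
    lra.
  by move=> x; rewrite F1 phip addrAC.
have [s /andP[s1 s2] [rotG expG]] := xsP phi phip (smooth_continuous phis) phi0
  (fun z mm zs => etrans (congr1 _ (notches0 b mm zs)) (mulr0 _))
  (diffeo_lift_homo Gl0).
have GE : (fun x => F x + (phi x + s)) = (fun x => F x + phi x + s).
  by apply/funext => x; rewrite addrA.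
exists (fun x => phi x + s); rewrite ?GE.
  split; first exact (smoothD phis (@smooth_cst R s)).
    by move=> x; rewrite phip.
  move=> j x jK; rewrite (derivn_add j phis (@smooth_cst R s)).
  have := phij j x (leqW jK); case: j jK => [|j] jK.
    rewrite -/theta in s1.
    rewrite !derive1n0 /= !ler_norml => /andP[? ?]; apply/andP; split; lra.
  by rewrite derivn_const addr0 => /le_trans; apply; lra.
split; [exact: diffeo_lift_shift|exact: rotG|].
set G := fun x => F x + phi x + s.
(* So many rounds that the additive error 2 of [sum_orbit_le] is at most [k * (c * delta * e) / 4],
   the same bound as for [k * theta]. *)
pose k := (Num.bound (8 / (c * delta * e))).+1.
have cde0 : 0 < c * delta * e by exact: mulr_gt0 (mulr_gt0 c_gt0 delta0) e_gt0.
have k8 : 8 <= k%:R * (c * delta * e).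
  rewrite -ler_pdivrMr//; apply/ltW/(lt_le_trans (ltr_bound _)).
  by rewrite ler_nat.
exists xs, r, (Q ^+ n.+1), (k * q)%N; split.
  split; [exact: Qpow0|exact: Qpow0| | |by rewrite muln_gt0].
    rewrite -exprM /r /m0' exprD mulrCA; apply: ler_piMr; first exact: ltW.
    have : Q ^+ 2 <= 2^-1 ^+ 2 by exact: Qpow.
    by rewrite !expr2; lra.
  by rewrite xsq exprS mulrA mulfV ?gt_eqF// mul1r.
move=> x.
have := @sum_orbit_le R G alpha q p (fun y => c * phi y) k x rotG expG.
rewrite -/theta => sumle.
have farle y : c * delta / 2 * (far xs r y)%:R <= c * phi y.
  have [/asboolP fy|_] := boolP (far xs r y); last first.
    by rewrite mulr0; apply: mulr_ge0; [exact: ltW|exact: phi0].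
  rewrite mulr1 -mulrA ler_pM2l// /phi ler_pM2l//.
  apply: (c0b b xs y r (Qpow0 _) b1 _ fy).
  rewrite xsq /r -exprM mulnC /b exprD expr1.
  have -> : c0 * Q ^+ (2 * m0') * (b0 * (q%:R * q%:R ^+ (2 * m0'))) =
    c0 * b0 * q%:R * (q%:R ^+ (2 * m0') * Q ^+ (2 * m0')) by ring.
  by rewrite qQ mulr1 ler_pM2r.
have cd0 : 0 < c * delta / 2 by rewrite divr_gt0// mulr_gt0.
rewrite -(ler_pM2l cd0) mulr_sumr.
apply: (@le_trans _ _ (\sum_(i < k * q) c * phi (iter i G x))).
  by apply: ler_sum => i _; exact: farle.
apply: (le_trans sumle); rewrite natrM.
have -> : c * delta / 2 * (2^-1 ^+ n * (k%:R * q%:R)) =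
   q%:R * (k%:R * (c * delta * e / 4) + k%:R * (c * delta * e) / 4).
  by rewrite /e; field.
rewrite ler_pM2l// lerD ?ler_wpM2l//.
lra.
Qed.

End Concentration.

(** * Rational approximations from above, by conjugation with x -> -x *)

Section Flip.
Variable R : realType.
Implicit Types (F G psi : R -> R) (a x y : R).

Definition flip F x := - F (- x).

Lemma derivn_oppx psi j : smooth psi ->
  (fun x => psi (- x))^`(j) = fun x => (-1) ^+ j * psi^`(j) (- x).
Proof.
elim: j psi => [|j IH] psi ps.
  by apply/funext => x; rewrite !derive1n0 mul1r.
rewrite derive1nS IH//; apply: is_derive_fun => x.
have ds := smooth_is_derive (@smooth_derivn R psi j ps) (- x).
have dN : is_derive x (1 : R) (fun y : R => - y) (- 1).
  exact: (is_deriveN (is_derive_id x 1)).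
have := is_derive_mul (is_derive_cst ((-1) ^+ j : R) x 1) (is_derive1_comp ds dN).
congr is_derive.
by rewrite derive1nS exprS /=; ring.
Qed.

Lemma derivn_flip psi j x : smooth psi -> `|(flip psi)^`(j) x| = `|psi^`(j) (- x)|.
Proof.
move=> ps.
have /(congr1 (@^~ x)) /= -> : (flip psi)^`(j) =
    fun x => (-1) ^+ j * (fun y => - psi y)^`(j) (- x).
  exact (@derivn_oppx (fun y => - psi y) j (smoothN ps)).
rewrite normrM normrX normrN normr1 expr1n mul1r.
elim: j psi ps x => [|j IH] psi ps x; first by rewrite !derive1n0 normrN.
rewrite !derive1Sn -IH; last exact: smooth_deriv.
suff -> : (fun y => - psi y)^`() = (fun y => - psi^`() y) by [].
apply: is_derive_fun => y; exact: (is_deriveN (smooth_is_derive ps y)).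
Qed.

Lemma smooth_flip psi : smooth psi -> smooth (flip psi).
Proof.
by move=> ps; exact (smoothN (smooth_comp ps (smoothN (@smooth_id R)))).
Qed.

Lemma diffeo_lift_flip F : diffeo_lift F -> diffeo_lift (flip F).
Proof.
move=> [Fs Fp F1]; split; first exact: smooth_flip.
  move=> x; suff -> : (flip F)^`() x = F^`() (- x) by [].
  have dN : is_derive x (1 : R) (fun y : R => - y) (- 1).
    exact: (is_deriveN (is_derive_id x 1)).
  have H : is_derive x (1 : R) (flip F) (F^`() (- x)).
    have := is_deriveN (is_derive1_comp (smooth_is_derive Fs (- x)) dN).
    by rewrite mulrN1 opprK.
  by rewrite derive1E derive_val.
move=> x; have := F1 (- (x + 1)); rewrite /flip (_ : - (x + 1) + 1 = - x).
  by move=> ->; ring.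
by ring.
Qed.

Lemma iter_flip F n x : iter n (flip F) x = - iter n F (- x).
Proof. by elim: n => [|n IH]; rewrite ?opprK// !iterS IH /flip opprK. Qed.

Lemma rot_flip F a : rot F a -> rot (flip F) (- a).
Proof.
move=> Fa n x; rewrite iter_flip -normrN; have := Fa n (- x).
by congr (`|_| <= 2); ring.
Qed.

Lemma far_flip xs (r : R) x : far (map -%R xs) r (- x) -> far xs r x.
Proof.
move=> /asboolP h; apply/asboolP => z m zs.
have := h (- z) (- m) (map_f _ zs).
by rewrite -normrN mulrNz; congr (_ <= `|_|); ring.
Qed.

Lemma concentrated_flip n G : concentrated n G -> concentrated n (flip G).
Proof.
move=> [xs [r [w [M [[r0 w0 rw xsw M0] h]]]]].
exists (map -%R xs), r, w, M; split; first by split=> //; rewrite size_map.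
move=> x; apply: le_trans (h (- x)); apply: ler_sum => i _.
rewrite iter_flip ler_nat; case: (far _ _ _) / boolP => //= f.
rewrite lt0b; apply: (@far_flip _ _ (iter i G (- x))).
done.
Qed.

Lemma approximable_flip F alpha K n eta :
  approximable (- alpha) (flip F) K n eta -> approximable alpha F K n eta.
Proof.
move=> [psi [ps pp pb] [Gl Gr Gc]].
have GE : (fun x => F x + flip psi x) = flip (fun x => flip F x + psi x).
  by apply/funext => x; rewrite /flip !opprD !opprK.
exists (flip psi); rewrite ?GE.
  split; [exact: smooth_flip| |by move=> j x jK; rewrite derivn_flip// pb].
  by move=> x; rewrite /flip -(pp (- (x + 1))) opprD subrK.
split; [exact: diffeo_lift_flip|rewrite -[alpha]opprK; exact: rot_flip|].
exact: concentrated_flip.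
Qed.

Lemma irrational_neq (alpha : R) (q : nat) (p : int) : irrational alpha ->
  (0 < q)%N -> q%:R * alpha != p%:~R.
Proof.
move=> irr q0; apply/eqP => qp; apply: irr.
have qR : q%:R != 0 :> R by rewrite pnatr_eq0 -lt0n.
by apply/rationalP; exists p, q; rewrite -qp mulrC mulKf.
Qed.

Lemma liouville_small (alpha : R) (N : nat) : liouville alpha ->
  exists (p : int) (q : nat), [/\ (2 <= q)%N, coprime `|p|%N q &
    0 < `|q%:R * alpha - p%:~R| <= q%:R^-1 ^+ N].
Proof.
(* Multiplying the approximation by [q] uses up one power. *)
move=> [irr /(_ N.+1)[p [q [q2 pq apq]]]]; exists p, q; split=> //.
have q0 : (0 < q)%N by exact: leq_trans q2.
have qR : 0 < q%:R :> R by rewrite ltr0n.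
rewrite normr_gt0 subr_eq0 irrational_neq//=.
have -> : q%:R * alpha - p%:~R = q%:R * (alpha - p%:~R / q%:R).
  by field; rewrite gt_eqF.
rewrite normrM (ger0_norm (ltW qR)) mulrC -ler_pdivlMr// ltW//.
apply: (lt_le_trans apq).
by rewrite div1r exprVn -invfM exprSr.
Qed.

Lemma approximable_liouville F (alpha : R) K n eta : liouville alpha ->
  diffeo_lift F -> rot F alpha -> 0 < eta -> approximable alpha F K n eta.
Proof.
move=> aL Fl Fa eta0.
have [N1 P1] := approximable_above K n Fl Fa eta0.
have [N2 P2] := approximable_above K n (diffeo_lift_flip Fl) (rot_flip Fa) eta0.
(* The sign of [q * alpha - p] is not known beforehand, so the exponent has to serve both cases. *)
have [p [q [q2 pq /andP[th0 thN]]]] := liouville_small (N1 + N2) aL.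
have qI : q%:R^-1 <= 1 :> R by rewrite invf_le1 ?ler1n ?ltr0n; exact: leq_trans q2.
have qI0 : 0 <= q%:R^-1 :> R by rewrite invr_ge0.
have le1 : q%:R^-1 ^+ (N1 + N2) <= q%:R^-1 ^+ N1 :> R.
  by apply: ler_wiXn2l => //; exact: leq_addr.
have le2 : q%:R^-1 ^+ (N1 + N2) <= q%:R^-1 ^+ N2 :> R.
  by apply: ler_wiXn2l => //; exact: leq_addl.
move: th0 thN; rewrite normr_gt0 => thn0.
case: ltrgt0P thn0 => [th _|th _|_]; [move=> thN|move=> thN|by []].
  by apply: (P1 p q q2 pq); apply/andP; split=> //; exact: le_trans thN le1.
apply: approximable_flip; apply: (P2 (- p) q q2); first by rewrite abszN.
have -> : q%:R * - alpha - (- p)%:~R = - (q%:R * alpha - p%:~R).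
  by rewrite mulrNz; ring.
by rewrite oppr_gt0; apply/andP; split=> //; exact: le_trans thN le2.
Qed.

End Flip.

(** * Convergence of inverses *)

Section SmoothConvergence.
Variable R : realType.
Implicit Types (u v F H : R -> R) (un vn Fn Hn : nat -> R -> R) (k : nat).

Definition ucvg un u := forall e : R, 0 < e ->
  exists N, forall n, (N <= n)%N -> forall x, `|un n x - u x| <= e.

Fixpoint ucvgk k un u : Prop :=
  ucvg un u /\ if k is k'.+1 then ucvgk k' (fun n => (un n)^`()) u^`() else True.

Lemma ucvgk0 k un u : ucvgk k un u -> ucvg un u.
Proof. by case: k => [|k] []. Qed.

Lemma ucvgkW k un u : ucvgk k.+1 un u -> ucvgk k un u.
Proof. by elim: k un u => [|k IH] un u [u0 uk]; split=> //; exact: IH. Qed.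

Lemma ucvgkP un u : (forall k, ucvgk k un u) <->
  (forall j, ucvg (fun n => (un n)^`(j)) u^`(j)).
Proof.
split=> [uk j|uj k].
  have : ucvgk j un u by [].
  elim: j un u {uk} => [|j IH] un u; first by case.
  by move=> [_ /IH]; rewrite derive1Sn; under eq_fun do rewrite -derive1Sn.
elim: k un u uj => [|k IH] un u uj; split; [exact: (uj 0%N)|by []|exact: (uj 0%N)|].
apply: IH => j; have := uj j.+1; rewrite derive1Sn.
by under eq_fun do rewrite derive1Sn.
Qed.

Lemma ucvgk_intro k un u un' u' :
  (forall n, (un n)^`() = un' n) -> u^`() = u' ->
  ucvg un u -> ucvgk k un' u' -> ucvgk k.+1 un u.
Proof.
move=> unE uE u0 uk; split=> //; rewrite uE.
by rewrite (_ : (fun n => (un n)^`()) = un')//; exact/funext.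
Qed.

Lemma ucvgD un vn u v : ucvg un u -> ucvg vn v ->
  ucvg (fun n x => un n x + vn n x) (fun x => u x + v x).
Proof.
move=> uu vv e e0; have e20 : 0 < e / 2 by rewrite divr_gt0.
have [N1 h1] := uu _ e20; have [N2 h2] := vv _ e20.
exists (N1 + N2)%N => n nN x.
rewrite opprD addrACA (splitr e) (le_trans (ler_normD _ _))// lerD//.
  by apply: h1; apply: leq_trans nN; rewrite leq_addr.
by apply: h2; apply: leq_trans nN; rewrite leq_addl.
Qed.

Lemma ucvgkD k un vn u v : (forall n, smooth (un n)) -> (forall n, smooth (vn n)) ->
  smooth u -> smooth v -> ucvgk k un u -> ucvgk k vn v ->
  ucvgk k (fun n x => un n x + vn n x) (fun x => u x + v x).
Proof.
elim: k un vn u v => [|k IH] un vn u v uns vns us vs uk vk.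
  by split=> //; apply: ucvgD; [exact: uk.1|exact: vk.1].
apply: (@ucvgk_intro _ _ _ (fun n x => (un n)^`() x + (vn n)^`() x)
  (fun x => u^`() x + v^`() x)).
- exact (fun n => deriv_add (uns n) (vns n)).
- exact (deriv_add us vs).
- exact (ucvgD uk.1 vk.1).
- exact (IH _ _ _ _ (fun n => smooth_deriv (uns n)) (fun n => smooth_deriv (vns n))
    (smooth_deriv us) (smooth_deriv vs) uk.2 vk.2).
Qed.

Lemma ucvgM un vn u v : continuous u -> continuous v -> periodic u -> periodic v ->
  ucvg un u -> ucvg vn v -> ucvg (fun n x => un n x * vn n x) (fun x => u x * v x).
Proof.
move=> uc vc up vp uu vv e e0.
have [M M0 uM] := periodic_bounded uc up.
have [M' M'0 vM] := periodic_bounded vc vp.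
pose d := Num.min 1 (e / (M + M' + 1)).
have S0 : 0 < M + M' + 1 by rewrite !addr_gt0.
have d0 : 0 < d by rewrite lt_min ltr01 divr_gt0.
have d1 : d <= 1 by rewrite ge_min lexx.
have dS : d * (M + M' + 1) <= e by rewrite -ler_pdivlMr// ge_min lexx orbT.
have [N1 h1] := uu _ d0; have [N2 h2] := vv _ d0.
exists (N1 + N2)%N => n nN x.
have a : `|un n x - u x| <= d by apply: h1; apply: leq_trans nN; rewrite leq_addr.
have b : `|vn n x - v x| <= d by apply: h2; apply: leq_trans nN; rewrite leq_addl.
have -> : un n x * vn n x - u x * v x =
  (un n x - u x) * (vn n x - v x) + (un n x - u x) * v x + u x * (vn n x - v x) by ring.
apply: le_trans dS; rewrite (_ : d * _ = d * 1 + d * M' + M * d); last by ring.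
rewrite (le_trans (ler_normD _ _))// lerD//; last by rewrite normrM ler_pM.
rewrite (le_trans (ler_normD _ _))// lerD// normrM ler_pM//.
exact: le_trans d1.
Qed.

Lemma ucvgkM k un vn u v : (forall n, smooth (un n)) -> (forall n, smooth (vn n)) ->
  smooth u -> smooth v -> periodic u -> periodic v ->
  ucvgk k un u -> ucvgk k vn v ->
  ucvgk k (fun n x => un n x * vn n x) (fun x => u x * v x).
Proof.
elim: k un vn u v => [|k IH] un vn u v uns vns us vs up vp uk vk.
  split; last exact I.
  exact (ucvgM (smooth_continuous us) (smooth_continuous vs) up vp uk.1 vk.1).
have [us' vs'] := (smooth_deriv us, smooth_deriv vs).
have [up' vp'] := (periodic_deriv us up, periodic_deriv vs vp).
have uns' n := smooth_deriv (uns n).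
have vns' n := smooth_deriv (vns n).
apply: (@ucvgk_intro _ _ _ (fun n x => (un n)^`() x * vn n x + un n x * (vn n)^`() x)
  (fun x => u^`() x * v x + u x * v^`() x)).
- exact (fun n => deriv_mul (uns n) (vns n)).
- exact (deriv_mul us vs).
- exact (ucvgM (smooth_continuous us) (smooth_continuous vs) up vp uk.1 vk.1).
- exact (ucvgkD (fun n => smoothM (uns' n) (vns n)) (fun n => smoothM (uns n) (vns' n))
    (smoothM us' vs) (smoothM us vs')
    (IH _ _ _ _ uns' vns us' vs up' vp uk.2 (ucvgkW vk))
    (IH _ _ _ _ uns vns' us vs' up vp' (ucvgkW uk) vk.2)).
Qed.

Lemma periodic_comp u H : periodic u -> deg1 H -> periodic (u \o H).
Proof. by move=> up H1 x /=; rewrite H1 up. Qed.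

Lemma deriv_comp u H : smooth u -> smooth H ->
  (u \o H)^`() = fun x => (u^`() \o H) x * H^`() x.
Proof.
move=> us Hs; apply: is_derive_fun => x.
exact: (is_derive1_comp (smooth_is_derive us _) (smooth_is_derive Hs x)).
Qed.

Lemma ucvg_comp un u Hn H : smooth u -> periodic u ->
  ucvg un u -> ucvg Hn H -> ucvg (fun n => un n \o Hn n) (u \o H).
Proof.
move=> us up uu HH e e0.
have [M M0 uM] := periodic_bounded (smooth_continuous (smooth_deriv us))
  (periodic_deriv us up).
have e2 : 0 < e / 2 by rewrite divr_gt0.
have [N1 h1] := uu _ e2; have [N2 h2] := HH _ (divr_gt0 e2 M0).
exists (N1 + N2)%N => n nN x /=.
have a : `|un n (Hn n x) - u (Hn n x)| <= e / 2.
  by apply: h1; apply: leq_trans nN; rewrite leq_addr.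
have b : `|u (Hn n x) - u (H x)| <= e / 2.
  rewrite (le_trans (lipschitz_deriv us uM _ _))// mulrC -ler_pdivlMr//.
  by apply: h2; apply: leq_trans nN; rewrite leq_addl.
have -> : un n (Hn n x) - u (H x) =
  (un n (Hn n x) - u (Hn n x)) + (u (Hn n x) - u (H x)) by ring.
by rewrite (splitr e) (le_trans (ler_normD _ _))// lerD.
Qed.

Lemma ucvgk_comp k un u Hn H : (forall n, smooth (un n)) ->
  (forall n, smooth (Hn n)) -> smooth u -> smooth H -> periodic u -> deg1 H ->
  ucvgk k un u -> ucvgk k Hn H -> ucvgk k (fun n => un n \o Hn n) (u \o H).
Proof.
elim: k un u => [|k IH] un u uns Hns us Hs up H1 uk Hk.
  split; last exact I.
  exact (ucvg_comp us up uk.1 Hk.1).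
have us' := smooth_deriv us.
have uns' n := smooth_deriv (uns n).
have up' := periodic_deriv us up.
apply: (@ucvgk_intro _ _ _ (fun n x => ((un n)^`() \o Hn n) x * (Hn n)^`() x)
  (fun x => (u^`() \o H) x * H^`() x)).
- exact (fun n => deriv_comp (uns n) (Hns n)).
- exact (deriv_comp us Hs).
- exact (ucvg_comp us up uk.1 Hk.1).
- exact (ucvgkM (fun n => smooth_comp (uns' n) (Hns n))
    (fun n => smooth_deriv (Hns n)) (smooth_comp us' Hs) (smooth_deriv Hs)
    (periodic_comp up' H1) (deg1_deriv Hs H1)
    (IH _ _ uns' Hns us' Hs up' H1 uk.2 (ucvgkW Hk)) Hk.2).
Qed.

Lemma ucvgV un u : continuous u -> periodic u -> (forall x, 0 < u x) ->
  ucvg un u -> ucvg (fun n x => (un n x)^-1) (fun x => (u x)^-1).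
Proof.
move=> uc up u0 uu e e0.
have [m m0 um] := periodic_pos uc up u0.
(* The first bound keeps [un] above [m / 2]; the second is the resulting lower bound of [un * u]
   times [e]. *)
pose d := Num.min (m / 2) (e * (m / 2 * m)).
have m2 : 0 < m / 2 by rewrite divr_gt0.
have d0 : 0 < d by rewrite lt_min m2/= !mulr_gt0// invr_gt0.
have [N h] := uu _ d0; exists N => n /h {}h x.
have := h x; rewrite le_min => /andP[h1 h2].
have un0 : m / 2 <= un n x.
  by move: h1; rewrite ler_norml => /andP[? _]; have := um x; lra.
have unx0 : 0 < un n x by exact: lt_le_trans un0.
have -> : (un n x)^-1 - (u x)^-1 = (u x - un n x) / (un n x * u x).
  by field; rewrite !gt_eqF.
have p0 : 0 < un n x * u x by rewrite mulr_gt0.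
rewrite normrM normfV (gtr0_norm p0) ler_pdivrMr// distrC (le_trans h2)//.
by rewrite ler_pM2l//; apply: ler_pM => //; exact: ltW.
Qed.

Lemma ucvgk_cst k (c : R) : ucvgk k (fun _ _ => c) (fun=> c).
Proof.
have cst0 (d : R) : ucvg (fun _ _ => d) (fun=> d).
  by move=> e e0; exists 0%N => n _ x; rewrite subrr normr0 ltW.
elim: k c => [|k IH] c; first by split.
apply: (@ucvgk_intro _ _ _ (fun _ _ => 0) (fun=> 0)).
- by move=> n; exact: (derivn_const c 0).
- exact: (derivn_const c 0).
- exact: cst0.
- exact: IH.
Qed.

Lemma ucvgkV k un u : (forall n, smooth (un n)) -> smooth u -> periodic u ->
  (forall x, 0 < u x) -> (forall n x, 0 < un n x) ->
  ucvgk k un u -> ucvgk k (fun n x => (un n x)^-1) (fun x => (u x)^-1).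
Proof.
move=> uns us up u0 un0.
have u_neq0 x : u x != 0 by rewrite gt_eqF.
have un_neq0 n x : un n x != 0 by rewrite gt_eqF.
have Vs := smoothV u_neq0 us.
have Vns n := smoothV (un_neq0 n) (uns n).
have Vp : periodic (fun x => (u x)^-1) by move=> x; rewrite up.
have us' := smooth_deriv us.
have uns' n := smooth_deriv (uns n).
have up' := periodic_deriv us up.
have VVs := smoothM Vs Vs.
have VVns n := smoothM (Vns n) (Vns n).
have VVp : periodic (fun x => (u x)^-1 * (u x)^-1) by move=> x; rewrite up.
have PVVp : periodic (fun x => u^`() x * ((u x)^-1 * (u x)^-1)).
  by move=> x; rewrite up up'.
elim: k => [|k IH] uk.
  by split; [exact (ucvgV (smooth_continuous us) up u0 uk.1)|].
apply: (@ucvgk_intro _ _ _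
  (fun n x => -1 * ((un n)^`() x * ((un n x)^-1 * (un n x)^-1)))
  (fun x => -1 * (u^`() x * ((u x)^-1 * (u x)^-1)))).
- move=> n; apply: is_derive_fun => x; rewrite mulN1r.
  exact (is_derive_recip (un_neq0 n x) (smooth_is_derive (uns n) x)).
- apply: is_derive_fun => x; rewrite mulN1r.
  exact (is_derive_recip (u_neq0 x) (smooth_is_derive us x)).
- exact (ucvgV (smooth_continuous us) up u0 uk.1).
- have kV := IH (ucvgkW uk).
  exact (ucvgkM (fun n => @smooth_cst R (-1)) (fun n => smoothM (uns' n) (VVns n))
    (@smooth_cst R (-1)) (smoothM us' VVs) (fun x => erefl) PVVp (ucvgk_cst k (-1))
    (ucvgkM uns' VVns us' VVs up' VVp uk.2 (ucvgkM Vns Vns Vs Vs Vp Vp kV kV))).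
Qed.

Lemma diffeo_lift_inverse F : diffeo_lift F -> exists H,
  [/\ cancel F H, cancel H F, deg1 H, smooth H & H^`() = fun x => (F^`() (H x))^-1].
Proof.
move=> Fl; have [Fs Fp F1] := Fl.
have /choice[H HK] y : exists x, F x = y.
  exact: deg1_continuous_surj (smooth_continuous Fs) F1.
have FI : injective F by exact: inc_inj (diffeo_lift_mono Fl).
have FK : cancel F H by move=> x; apply: FI; rewrite HK.
have H1 : deg1 H by move=> x; apply: FI; rewrite HK F1 HK.
have [L [Lam [m [_ _ m0 Fb _]]]] := diffeo_lift_bounds Fl.
have expa x y : x <= y -> m * (y - x) <= F y - F x.
  move=> xy; have [c _ ->] := smooth_MVT Fs xy.
  by rewrite ler_wpM2r ?subr_ge0//; case/andP: (Fb c).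
have Hc : continuous H.
  move=> y; apply/cvgrPdist_le => e e0.
  have me : 0 < m * e by rewrite mulr_gt0.
  near=> z; rewrite -(ler_pM2l m0).
  apply: (@le_trans _ _ `|y - z|); last by near: z; exact: cvgr_dist_le.
  have [zy|/ltW zy] := leP (H z) (H y); have := expa _ _ zy; rewrite !HK => h.
    rewrite ger0_norm ?subr_ge0//.
    exact: le_trans h (ler_norm _).
  rewrite distrC ger0_norm ?subr_ge0// distrC.
  exact: le_trans h (ler_norm _).
have [Hs HE] := smooth_inv Fs Fp FK HK Hc.
by exists H.
Unshelve. all: by end_near.
Qed.

(** At order 0, [Hn y] and [H y] are the images under the Lipschitz map [H] of [F (Hn y)] and
    [Fn (Hn y)], which are uniformly close. Each further order follows from [Hn' = 1 / (Fn' \o Hn)],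
    as in [smooth_inv]. *)
Lemma ucvgk_inverse k Fn F Hn H : (forall n, diffeo_lift (Fn n)) -> diffeo_lift F ->
  (forall k, ucvgk k Fn F) ->
  (forall n, [/\ cancel (Hn n) (Fn n), smooth (Hn n) &
    (Hn n)^`() = fun x => ((Fn n)^`() (Hn n x))^-1]) ->
  [/\ cancel F H, deg1 H, smooth H & H^`() = fun x => (F^`() (H x))^-1] ->
  ucvgk k Hn H.
Proof.
move=> Fnl Fl FF HnP [FK H1 Hs HE].
have [L [Lam [m [_ _ m0 Fb _]]]] := diffeo_lift_bounds Fl.
have Hlip : forall x y, `|H x - H y| <= m^-1 * `|x - y|.
  apply: lipschitz_deriv => // x; rewrite HE normfV lef_pV2 ?posrE//.
    by have /andP[h _] := Fb (H x); rewrite (le_trans h)// ler_norm.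
  by rewrite normr_gt0 gt_eqF//; case: Fl.
have H0 : ucvg Hn H.
  move=> e e0; have [N h] := ucvgk0 (FF 0%N) (mulr_gt0 m0 e0).
  exists N => n /h {}h y; have [HnK _ _] := HnP n.
  rewrite distrC -{1}(HnK y) -{2}(FK (Hn n y)) (le_trans (Hlip _ _))//.
  by rewrite -ler_pdivlMl// ?invr_gt0// invrK.
have [Fs Fp F1] := Fl.
elim: k => [|k IH]; first by split.
apply: (@ucvgk_intro _ _ _ (fun n => (fun x => ((Fn n)^`() x)^-1) \o Hn n)
  ((fun x => (F^`() x)^-1) \o H)); [by move=> n; case: (HnP n)|exact HE|exact H0|].
have Fns n : smooth (Fn n)^`() by case: (Fnl n) => Fs' _ _; exact (smooth_deriv Fs').
have F's := smooth_deriv Fs.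
have F'p := deg1_deriv Fs F1.
have Fnp n x : 0 < (Fn n)^`() x by case: (Fnl n).
have Fn_neq0 n x : (Fn n)^`() x != 0 by rewrite gt_eqF.
have F_neq0 x : F^`() x != 0 by rewrite gt_eqF.
have Vp : periodic (fun x => (F^`() x)^-1) by move=> x; rewrite F'p.
have Hns n : smooth (Hn n) by case: (HnP n).
exact (ucvgk_comp (fun n => smoothV (Fn_neq0 n) (Fns n)) Hns (smoothV F_neq0 F's) Hs
  Vp H1 (ucvgkV Fns F's F'p Fp Fnp (FF k.+1).2) IH).
Qed.

End SmoothConvergence.

(** * Diffeomorphisms of the circle and their topologies *)

Section CircleLifts.
Variable R : realType.
Local Notation circle := (circle R).
Implicit Types (F G H : R -> R) (s t x y a : R) (f : diffeo R).

Lemma projD s t : proj (s + t) = proj s + proj t.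
Proof.
have hN : proj (- t) = - proj t by rewrite -[- t]sub0r projB proj0 sub0r.
by rewrite -{1}[t]opprK projB hN opprK.
Qed.

Lemma proj_int (m : int) : proj (m%:~R : R) = 0.
Proof.
have := Quotient.idealrBE (Zint R) (m%:~R) 0; rewrite subr0 => h.
rewrite -proj0; apply/eqP; rewrite /proj -h.
exact: intr_int.
Qed.

Lemma proj_shift t (m : int) : proj (t + m%:~R) = proj t.
Proof. by rewrite projD proj_int addr0. Qed.

Lemma proj_eqP s t : proj s = proj t <-> exists m : int, s = t + m%:~R.
Proof.
split=> [/proj_eq/intrP[m st]|[m ->]]; last exact: proj_shift.
by exists m; rewrite -st addrC subrK.
Qed.

Lemma proj_repr (x : circle) : proj (repr x : R) = x.
Proof. by rewrite /proj reprK. Qed.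

Lemma mdist_proj s t : mdist (proj s) (proj t) <= `|s - t|.
Proof.
apply: ge_inf; last by exists (s - t) => //=; rewrite projB.
by exists 0 => _ [u _ <-].
Qed.

Lemma mdist_lift (x y : circle) e : mdist x y < e ->
  exists2 t, proj t = x - y & `|t| < e.
Proof.
move=> xye.
have hi : has_inf [set `|t| | t in [set t : R | proj t = x - y]].
  split; last by exists 0 => _ [u _ <-].
  by have [t tE] := proj_surj (x - y); exists `|t|, t.
have e0 : 0 < e - mdist x y by rewrite subr_gt0.
have [_ [t tE <-] te] := inf_adherent e0 hi.
exists t => //; apply: lt_le_trans te _.
by rewrite (_ : inf _ = mdist x y)// addrC subrK.
Qed.

Lemma iter_lift (f : circle -> circle) F n x : (forall x, f (proj x) = proj (F x)) ->
  iter n f (proj x) = proj (iter n F x).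
Proof. by move=> fF; elim: n => // n IH; rewrite !iterS IH fF. Qed.

(** An increasing lift satisfies [F (x + 1) = F x + m] with [m > 0]. If [m > 1], the value [F x + 1]
    would be taken strictly between [x] and [x + 1], against the injectivity of [f]. *)
Lemma diffeo_has_lift f : exists2 F, diffeo_lift F & forall x, f (proj x) = proj (F x).
Proof.
have [F [Fs fF] Fp] := dfun_smooth f.
have Flt : {homo F : x y / x < y}.
  move=> x y xy; have [c _ cE] := smooth_MVT Fs (ltW xy).
  by rewrite -subr_gt0 cE mulr_gt0// subr_gt0.
exists F => //; split=> // x.
have /proj_eqP[m mE] : proj (F (x + 1)) = proj (F x).
  by rewrite -!fF (proj_shift x 1).
have m0 : 0 < m.
  rewrite -(ltr0z R) -(ltrD2l (F x)) addr0 -mE.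
  by apply: Flt; rewrite ltrDl.
rewrite mE; congr (_ + _); have [m1|m1] := leP m 1.
  by have -> : m = 1 by lia.
have m1R : 1 <= m%:~R :> R by rewrite (ler_int _ 1) ltW.
have m1R' : 1 < m%:~R :> R by rewrite (ltr_int _ 1).
have [||y] := @IVT R F x (x + 1) (F x + 1) _ (continuous_subspaceT (smooth_continuous Fs)).
- by rewrite lerDl.
- apply/andP; split; first by rewrite ge_min lerDl ler01.
  by rewrite le_max mE lerD2l m1R orbT.
rewrite in_itv/= => /andP[xy yx] yE.
have /(can_inj (dfunK f))/proj_eqP[k kE] : f (proj y) = f (proj x).
  by rewrite !fF yE (proj_shift _ 1).
have xy' : x < y.
  rewrite lt_neqAle xy andbT; apply/eqP => xyE; move: yE; rewrite xyE.
  by lra.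
have yx' : y < x + 1.
  rewrite lt_neqAle yx andbT; apply/eqP => xyE; move: yE; rewrite xyE mE.
  by lra.
have k0 : 0 < k by rewrite -(ltr0z R); lra.
have k1 : k < 1 by rewrite -(ltr_int R); lra.
lia.
Qed.

Lemma continuous_int_const (g : R -> R) : continuous g ->
  (forall x, g x \is a Num.int) -> forall x y, g x = g y.
Proof.
move=> gc gi; suff h x y : x <= y -> g x = g y.
  by move=> x y; have [/h|/ltW/h] := leP x y.
move=> xy; have [//|gxy] := eqVneq (g x) (g y).
have [m mE] := intrP (gi x); have [k kE] := intrP (gi y).
have mk : m != k by apply: contraNneq gxy; rewrite mE kE => ->.
pose v := (Num.min m k)%:~R + 2^-1 : R.
have [|c _ cE] := @IVT R g x y v xy (continuous_subspaceT gc).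
  rewrite mE kE /v; case: (ltgtP m k) mk => // mk _.
    rewrite ge_min le_max; have : m%:~R + 1 <= k%:~R :> R.
      by rewrite -(intrD1 m) ler_int; lia.
    lra.
  rewrite ge_min le_max; have : k%:~R + 1 <= m%:~R :> R.
    by rewrite -(intrD1 k) ler_int; lia.
  lra.
have [j jE] := intrP (gi c); move: cE; rewrite jE /v => h.
have h1 : (Num.min m k) < j by rewrite -(ltr_int R); lra.
have h2 : j < Num.min m k + 1 by rewrite -(ltr_int R) intrD; lra.
lia.
Qed.

(** Two smooth lifts differ by a continuous integer-valued function. This lets any explicit lift
    compute what is defined through [chosen_lift]. *)
Lemma chosen_liftE (h : circle -> circle) F : smooth F ->
  (forall x, h (proj x) = proj (F x)) ->
  exists m : int, chosen_lift h = fun x => F x + m%:~R.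
Proof.
move=> Fs hF.
have [Gs hG] : smooth_lift (chosen_lift h) h.
  exact (xgetPex point (ex_intro (fun G => smooth_lift G h) F (conj Fs hF))).
have gi x : chosen_lift h x - F x \is a Num.int.
  by apply: proj_eq; rewrite -hG hF.
have gc : continuous (fun x => chosen_lift h x - F x).
  by move=> x; apply: cvgB; exact: smooth_continuous.
have [m mE] := intrP (gi 0); exists m; apply/funext => x.
by rewrite -mE (continuous_int_const gc gi 0 x) addrC subrK.
Qed.

Lemma iter_addZ F n x (m : int) : deg1 F ->
  iter n (fun x => F x + m%:~R) x = iter n F x + n%:R * m%:~R.
Proof.
move=> F1; elim: n x => [|n IH] x; first by rewrite mul0r addr0.
rewrite !iterS IH -[n%:R]/(n%:~R) -intrM deg1Z// intrM -natr1.
by rewrite -[n%:~R]/(n%:R); ring.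
Qed.

Lemma rot_addZ F a (m : int) : deg1 F -> rot F a ->
  rot (fun x => F x + m%:~R) (a + m%:~R).
Proof.
move=> F1 Fa n x; rewrite iter_addZ//; have := Fa n x.
by congr (`|_| <= 2); ring.
Qed.

Lemma rotation_number_lift f F a : smooth F -> deg1 F ->
  (forall x, f (proj x) = proj (F x)) -> rot F a -> rotation_number f = proj a.
Proof.
move=> Fs F1 fF Fa; rewrite /rotation_number.
have [m ->] := chosen_liftE Fs fF.
by rewrite (cvg_lim _ (rot_cvg (rot_addZ m F1 Fa)))// proj_shift.
Qed.

Lemma rotation_has_lift f a : diffeos_of_rotation a f ->
  exists F, [/\ diffeo_lift F, forall x, f (proj x) = proj (F x) & rot F a].
Proof.
move=> fa; have [F Fl fF] := diffeo_has_lift f; have [Fs Fp F1] := Fl.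
have [b Fb] := rot_exists (diffeo_lift_homo Fl) F1.
have /proj_eqP[m mE] : proj a = proj b.
  by rewrite -(rotation_number_lift Fs F1 fF Fb); symmetry.
exists (fun x => F x + m%:~R); split; first exact: diffeo_lift_shift.
  by move=> x; rewrite proj_shift.
by rewrite mE; exact: rot_addZ.
Qed.

Lemma circle_deriv_lift k (h : circle -> circle) F (z : circle) : smooth F ->
  (forall x, h (proj x) = proj (F x)) ->
  circle_deriv k.+1 h z = F^`(k.+1) (repr z).
Proof.
move=> Fs hF; rewrite /circle_deriv; have [m ->] := chosen_liftE Fs hF.
rewrite (derivn_add k.+1 Fs (@smooth_cst R m%:~R)) /= -/(derive1n _ _).
have /(congr1 (@^~ (repr z))) /= := derivn_const (m%:~R : R) k.
by rewrite /derive1n /= => ->; rewrite addr0.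
Qed.

Definition circle_map F (x : circle) : circle := proj (F (repr x)).

Lemma circle_mapE F x : deg1 F -> circle_map F (proj x) = proj (F x).
Proof.
move=> F1; rewrite /circle_map.
have /proj_eqP[m ->] : proj (repr (proj x)) = proj x by rewrite proj_repr.
by rewrite deg1Z// proj_shift.
Qed.

Lemma diffeo_of_lift F H : diffeo_lift F -> cancel F H -> cancel H F -> deg1 H ->
  smooth H -> exists f : diffeo R,
  (forall x, f (proj x) = proj (F x)) /\ (forall x, dinv f (proj x) = proj (H x)).
Proof.
move=> [Fs Fp F1] FK HK H1 Hs.
have c1 : cancel (circle_map F) (circle_map H).
  by move=> x; rewrite -(proj_repr x) !circle_mapE// FK.
have c2 : cancel (circle_map H) (circle_map F).
  by move=> x; rewrite -(proj_repr x) !circle_mapE// HK.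
have s1 : exists2 G, smooth_lift G (circle_map F) & forall x, 0 < G^`() x.
  by exists F => //; split=> // x; rewrite circle_mapE.
have s2 : exists G, smooth_lift G (circle_map H).
  by exists H; split=> // x; rewrite circle_mapE.
by exists (Diffeo c1 c2 s1 s2); split=> x /=; rewrite circle_mapE.
Qed.

Lemma dinv_lift f F H : (forall x, f (proj x) = proj (F x)) -> cancel H F ->
  forall x, dinv f (proj x) = proj (H x).
Proof. by move=> fF HK x; rewrite -{1}(HK x) -fF dfunK. Qed.

End CircleLifts.

(** * Openness in the C^0 topology, convergence in the C^oo topology *)

Section Topology.
Variable R : realType.
Local Notation circle := (circle R).
Implicit Types (F G H : R -> R) (s t : R) (x y z : circle).

Definition cfar (cs : seq circle) (r : R) x : bool :=
  `[< forall z, z \in cs -> r <= mdist x z >].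

(* The slack [e] makes the condition open in the C^0 topology. *)
Definition concentrated_map n (f : circle -> circle) :=
  exists (cs : seq circle) (r e w : R) (M : nat),
  [/\ 0 < e, 0 < w, 2 * r <= w ^+ n.+1, (size cs)%:R * w <= 2^-1 ^+ n & (0 < M)%N]
  /\ forall x, \sum_(i < M) (cfar cs (r - e) (iter i f x))%:R <=
       2^-1 ^+ n * M%:R :> R.

Definition concentrated_set (a : R) n : set (diffeos_of_rotation a) :=
  [set f | concentrated_map n (dfun (val f))].

Lemma ler_bool (b c : bool) : (b -> c) -> b%:R <= c%:R :> R.
Proof. by rewrite ler_nat; case: b c => [] [] // /(_ isT). Qed.

Lemma concentrated_lift n G (f : circle -> circle) :
  (forall t, f (proj t) = proj (G t)) -> concentrated n G -> concentrated_map n f.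
Proof.
move=> fG [xs [r [w [M [[r0 w0 rw xsw M0] h]]]]].
(* Doubling the radius provides the slack: [2 * r - r] is the radius in [concentrated], whose factor
   4 was meant for this. *)
exists (map (@proj R) xs), (2 * r), r, w, M; split.
  by split=> //; [lra|rewrite size_map].
move=> x; rewrite -(proj_repr x); apply: le_trans (h (repr x)).
apply: ler_sum => i _; rewrite (iter_lift _ _ fG); apply: ler_bool.
move=> /asboolP fr; apply/asboolP => z m zs.
have := fr (proj z) (map_f _ zs).
rewrite (_ : 2 * r - r = r); last by ring.
move=> /le_trans; apply; rewrite -(proj_shift z m).
by rewrite -addrA -opprD; exact: mdist_proj.
Qed.

Lemma diffeo_lipschitz (f : diffeo R) : exists2 L : R, 0 < L &
  forall x y, mdist (f x) (f y) <= L * mdist x y.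
Proof.
have [F Fl fF] := diffeo_has_lift f; have [Fs Fp F1] := Fl.
have [L [Lam [m [L0 _ _ Fb _]]]] := diffeo_lift_bounds Fl.
exists L => // x y; apply/ler_addgt0Pr => e e0.
have eL : 0 < e / L by rewrite divr_gt0.
have [t tE tlt] : exists2 t : R, proj t = x - y & `|t| < mdist x y + e / L.
  by apply: mdist_lift; rewrite ltrDl.
have xE : x = proj (repr y + t) by rewrite projD tE proj_repr addrC subrK.
have -> : f x = proj (F (repr y + t)) by rewrite xE fF.
have -> : f y = proj (F (repr y)) by rewrite -fF proj_repr.
rewrite (le_trans (mdist_proj _ _))//.
have /lipschitz_deriv -/(_ Fs) Flip : forall u, `|F^`() u| <= L.
  by move=> u; rewrite ger0_norm; [case/andP: (Fb u)|exact: ltW].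
rewrite (le_trans (Flip _ _))// addrC addKr.
have : L * `|t| <= L * (mdist x y + e / L) by rewrite ler_pM2l// ltW.
by have -> : L * (mdist x y + e / L) = L * mdist x y + e by field; rewrite gt_eqF.
Qed.

Lemma iter_close (f : diffeo R) (M : nat) e : 0 < e -> exists2 d : R, 0 < d &
  forall g : circle -> circle, (forall x, mdist (f x) (g x) <= d) ->
  forall i x, (i < M)%N -> mdist (iter i f x) (iter i g x) <= e.
Proof.
have [L L0 fL] := diffeo_lipschitz f.
suff [C C0 h] : exists2 C : R, 0 < C & forall (g : circle -> circle) d,
    (forall x, mdist (f x) (g x) <= d) ->
    forall i x, (i < M)%N -> mdist (iter i f x) (iter i g x) <= C * d.
  move=> e0; exists (e / C); first by rewrite divr_gt0.
  move=> g gd i x iM; have := h g _ gd i x iM.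
  by rewrite mulrCA mulfV ?gt_eqF// mulr1.
elim: M => [|M [C C0 IH]]; first by exists 1.
exists (L * C + C + 1); first by rewrite !addr_gt0// mulr_gt0.
move=> g d gd i x; have d0 : 0 <= d by apply: le_trans (gd x); exact: mdist_ge0.
have LC : 0 < L * C by exact: mulr_gt0.
have LCd : 0 <= L * C * d by rewrite mulr_ge0// ltW.
have Cd : 0 <= C * d by rewrite mulr_ge0// ltW.
case: i => [_|i]; first by rewrite /= mdistxx mulr_ge0// !addr_ge0// ltW.
rewrite ltnS => iM.
have -> : (L * C + C + 1) * d = L * (C * d) + d + C * d by ring.
rewrite -[leLHS]addr0 lerD// !iterS.
rewrite (le_trans (metric_triangle _ (f (iter i g x)) _))// lerD//.
by rewrite (le_trans (fL _ _))// ler_pM2l// IH.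
Qed.

Lemma nbhs_uniform_dist (T : choiceType) (V : metricType R) (f : T -> V) (d : R) : 0 < d ->
  nbhs (f : {uniform T -> V}) [set g | forall p : T, mdist (f p) (g p) < d].
Proof.
move=> d0; apply/uniform_nbhs; exists [set xy | ball xy.1 d xy.2]; split.
  exact: (entourage_ball _ (PosNum d0)).
by move=> g /= h p; have := h p I; rewrite ballEmdist.
Qed.

(** The first [M] iterates of nearby maps are uniformly [e / 2]-close. Whenever [g] is at distance
    [r - e / 2] from the centres, [f] is at distance [r - e], so the count for [f] bounds the count
    for [g] with half the slack. *)
Lemma open_concentrated_set (a : R) n :
  open (concentrated_set n : set (C0_space a)).
Proof.
rewrite openE => f [cs [r [e [w [M [[e0 w0 rw csw M0] h]]]]]].
have e2 : 0 < e / 2 by rewrite divr_gt0.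
have [d d0 close] := iter_close (val f) M e2.
pose N : set ({uniform circle -> circle} * {uniform circle -> circle}) :=
  fst @^-1` [set g | forall x, mdist (dfun (val f) x) (g x) < d].
have nN : nbhs (C0_embedding (val f)) N.
  apply: (@cvg_fst _ _ (nbhs (dfun (val f) : {uniform circle -> circle}))).
  exact: nbhs_uniform_dist.
have := @initial_continuous _ _
  (fun f : set_type (diffeos_of_rotation a) => C0_embedding (val f)) f N nN.
move=> nf.
suff NU : (fun g : C0_space a => C0_embedding (val (g : set_type _))) @^-1` N `<=`
    concentrated_set n by exact: filterS NU nf.
move=> g /= gN.
exists cs, r, (e / 2), w, M; split=> // x.
apply: le_trans (h x); apply: ler_sum => i _; apply: ler_bool => /asboolP fr; apply/asboolP => z zs.
have := fr z zs; have := close (dfun (val g)) (fun x => ltW (gN x)) i x (ltn_ord i).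
have := metric_triangle (iter i (dfun (val g)) x) (iter i (dfun (val f)) x) z.
rewrite (metric_sym (iter i (dfun (val g)) x) (iter i (dfun (val f)) x)); lra.
Qed.

Lemma cvg_initial (S : choiceType) (T : topologicalType) (f : S -> T)
    (u : nat -> S) (s : S) : (fun n => f (u n)) @ \oo --> f s ->
  u @ \oo --> (s : initial_topology f).
Proof.
move=> h A; rewrite nbhsE => -[B [[W oW <-] Ws] BA].
suff : (u @ \oo) (f @^-1` W) by apply: filterS.
by apply: h; exact: open_nbhs_nbhs.
Qed.

Lemma cvg_uniform_dist (T : choiceType) (V : metricType R) (f : T -> V)
    (u : nat -> T -> V) :
  (forall e : R, 0 < e -> exists N, forall n, (N <= n)%N -> forall p,
     mdist (f p) (u n p) < e) ->
  (u : nat -> {uniform T -> V}) @ \oo --> (f : {uniform T -> V}).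
Proof.
move=> h A /uniform_nbhs[E [/=]]; rewrite -entourage_ballE => -[e /= e0 eE] EA.
have [N hN] := h e e0; exists N => // n /= /hN nd.
apply: EA => p _; apply: eE; rewrite /= ballEmdist /=; exact: nd.
Qed.

Lemma cvg_uniform_norm (T : choiceType) (f : T -> R) (u : nat -> T -> R) :
  (forall e : R, 0 < e -> exists N, forall n, (N <= n)%N -> forall p,
     `|f p - u n p| < e) ->
  (u : nat -> {uniform T -> R}) @ \oo --> (f : {uniform T -> R}).
Proof.
move=> h A /uniform_nbhs[E [/=]]; rewrite -entourage_ballE => -[e /= e0 eE] EA.
have [N hN] := h e e0; exists N => // n /= /hN nd.
by apply: EA => p _; apply: eE; exact: nd.
Qed.

Lemma cvg_ptws (I : choiceType) (V : topologicalType) (f : I -> V)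
    (u : nat -> I -> V) : (forall i, (fun n => u n i) @ \oo --> f i) ->
  (u : nat -> {ptws I -> V}) @ \oo --> (f : {ptws I -> V}).
Proof.
move=> h; apply/cvg_sup => i.
exact: (@cvg_initial _ _ (fun g : I -> V => g i)).
Qed.

Lemma cvg_Coo (a : R) (g : nat -> set_type (diffeos_of_rotation a))
    (f : set_type (diffeos_of_rotation a)) Fn F Hn H :
  (forall n, smooth (Fn n)) -> smooth F ->
  (forall n, smooth (Hn n)) -> smooth H ->
  (forall n t, dfun (val (g n)) (proj t) = proj (Fn n t)) ->
  (forall t, dfun (val f) (proj t) = proj (F t)) ->
  (forall n t, dinv (val (g n)) (proj t) = proj (Hn n t)) ->
  (forall t, dinv (val f) (proj t) = proj (H t)) ->
  (forall k, ucvgk k Fn F) -> (forall k, ucvgk k Hn H) ->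
  (g : nat -> Coo_space a) @ \oo --> (f : Coo_space a).
Proof.
move=> Fns Fs Hns Hs gF fF gH fH /ucvgkP FF /ucvgkP HH.
have C0 (h : nat -> circle -> circle) (h0 : circle -> circle) Gn G :
    (forall n t, h n (proj t) = proj (Gn n t)) ->
    (forall t, h0 (proj t) = proj (G t)) -> ucvg Gn G ->
    (h : nat -> {uniform circle -> circle}) @ \oo -->
    (h0 : {uniform circle -> circle}).
  move=> hG h0G cG; apply: cvg_uniform_dist => e e0.
  have e2 : 0 < e / 2 by rewrite divr_gt0.
  have [N hN] := cG _ e2; exists N => n nN x.
  rewrite -(proj_repr x) hG h0G (le_lt_trans (mdist_proj _ _))//.
  rewrite distrC (le_lt_trans (hN n nN _))//; lra.
have Ck (h : nat -> circle -> circle) (h0 : circle -> circle) Gn G :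
    (forall n, smooth (Gn n)) -> smooth G ->
    (forall n t, h n (proj t) = proj (Gn n t)) ->
    (forall t, h0 (proj t) = proj (G t)) ->
    (forall k, ucvg (fun n => (Gn n)^`(k)) G^`(k)) ->
    (fun n => derivs (h n)) @ \oo --> derivs h0.
  move=> Gns Gs hG h0G cG; apply: cvg_ptws => k.
  apply: cvg_uniform_norm => e e0.
  have e2 : 0 < e / 2 by rewrite divr_gt0.
  have [N hN] := cG k.+1 _ e2; exists N => n nN x.
  rewrite /derivs (circle_deriv_lift k x Gs h0G).
  rewrite (circle_deriv_lift k x (Gns n) (hG n)).
  rewrite distrC (le_lt_trans (hN n nN _))//; lra.
have h1 : (fun n => C0_embedding (val (g n))) @ \oo --> C0_embedding (val f).
  exact: (cvg_pair
    (C0 (fun n => dfun (val (g n))) (dfun (val f)) _ _ gF fF (FF 0%N))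
    (C0 (fun n => dinv (val (g n))) (dinv (val f)) _ _ gH fH (HH 0%N))).
have h2 : (fun n => (derivs (dfun (val (g n))), derivs (dinv (val (g n))))) @ \oo
    --> (derivs (dfun (val f)), derivs (dinv (val f))).
  exact: (cvg_pair (Ck (fun n => dfun (val (g n))) (dfun (val f)) _ _ Fns Fs gF fF FF)
  (Ck (fun n => dinv (val (g n))) (dinv (val f)) _ _ Hns Hs gH fH HH)).
exact: (@cvg_initial _ _
  (fun f : set_type (diffeos_of_rotation a) => Coo_embedding (val f)) g f
  (cvg_pair h1 h2)).
Qed.

End Topology.

(** * Density in the C^oo topology *)

Section Density.
Variable R : realType.
Implicit Types (F G H : R -> R).

(** The diffeomorphism, its lift and the inverse lift form a single witness, so that one use of
    [choice] yields matching sequences. *)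
Lemma approximable_diffeo (a : R) F K n eta : diffeo_lift F ->
  approximable a F K n eta ->
  exists GH : set_type (diffeos_of_rotation a) * ((R -> R) * (R -> R)),
  [/\ diffeo_lift GH.2.1, concentrated_set n GH.1,
      (forall t, dfun (val GH.1) (proj t) = proj (GH.2.1 t)),
      (forall t, dinv (val GH.1) (proj t) = proj (GH.2.2 t)) &
      [/\ cancel GH.2.2 GH.2.1, smooth GH.2.2,
        GH.2.2^`() = (fun x => (GH.2.1^`() (GH.2.2 x))^-1) &
        forall j x, (j <= K)%N -> `|GH.2.1^`(j) x - F^`(j) x| <= eta]].
Proof.
move=> [Fs Fp F1] [psi [ps pp pb] [Gl Ga Gc]].
have [H [FK HK H1 Hs HE]] := diffeo_lift_inverse Gl.
have [g [gG gH]] := diffeo_of_lift Gl FK HK H1 Hs.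
have [Gs Gp G1] := Gl.
have ga : diffeos_of_rotation a g by exact: rotation_number_lift Gs G1 gG Ga.
exists (exist _ g (mem_set ga), (fun x => F x + psi x, H)) => /=.
split=> //; first exact: concentrated_lift gG Gc.
split=> // j x jK; rewrite (derivn_add j Fs ps) addrC addKr.
exact: pb.
Qed.

Lemma dense_concentrated_set (a : R) n : liouville a ->
  dense (concentrated_set n : set (Coo_space a)).
Proof.
move=> aL O [f Of] [W oW WO].
have fa : diffeos_of_rotation a (val (f : set_type _)) by exact: set_valP.
have [F [Fl fF Fa]] := rotation_has_lift fa.
have inv0 m : 0 < m.+1%:R^-1 :> R by rewrite invr_gt0.
(* The [m]-th map controls [m] derivatives up to [1 / (m + 1)] while [n] stays fixed, so every
   derivative converges. *)
have ex m := approximable_diffeo Fl (approximable_liouville m n aL Fl Fa (inv0 m)).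
have [GH GHP] := choice ex.
have [H [FK HK H1 Hs HE]] := diffeo_lift_inverse Fl.
have [Fs _ _] := Fl.
have cF k : ucvgk k (fun m => (GH m).2.1) F.
  move: k; apply/ucvgkP => j e e0.
  exists (maxn j (Num.bound e^-1)) => m; rewrite geq_max => /andP[jm em] x.
  have [_ _ _ _ [_ _ _ /(_ j x jm) /le_trans]] := GHP m; apply.
  rewrite -[leRHS]invrK lef_pV2 ?posrE ?invr_gt0//.
  by rewrite ltW// (lt_le_trans (ltr_bound _))// ler_nat (leq_trans em).
have Gl m : diffeo_lift (GH m).2.1 by case: (GHP m).
have cH k : ucvgk k (fun m => (GH m).2.2) H.
  apply: (@ucvgk_inverse R k (fun m => (GH m).2.1) F (fun m => (GH m).2.2) H
    Gl Fl cF) => [m|]; last by split.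
  by have [_ _ _ _ []] := GHP m.
have cvg : (fun m => (GH m).1) @ \oo --> (f : Coo_space a).
  have Gs m : smooth (GH m).2.1 by case: (Gl m).
  have Hns m : smooth (GH m).2.2 by have [_ _ _ _ []] := GHP m.
  have gF m t : dfun (val (GH m).1) (proj t) = proj ((GH m).2.1 t).
    by have [] := GHP m.
  have gH m t : dinv (val (GH m).1) (proj t) = proj ((GH m).2.2 t).
    by have [] := GHP m.
  exact (cvg_Coo Gs Fs Hns Hs gF fF gH (dinv_lift fF HK) cF cH).
have Oopen : open (O : set (Coo_space a)) by exists W.
have [N _ hN] := cvg _ (open_nbhs_nbhs (conj Oopen Of)).
exists (GH N).1; split; first exact: (hN N (leqnn N)).
by have [] := GHP N.
Qed.

End Density.

(** * The invariant measure *)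

Section LebesguePeriod.
Variable R : realType.
Local Notation mu := (@lebesgue_measure R).
Local Open Scope ereal_scope.
Local Notation RT := (measurableTypeR R).
Implicit Types (B : set RT) (a x y : R).

Lemma lebesgue_measure_shift a B : measurable B ->
  mu ((fun x : RT => (x + a)%R : RT) @^-1` B) = mu B.
Proof.
move=> mB; have ms : measurable_fun [set: RT] (fun x : RT => (x + a)%R : RT).
  by apply: nondecreasing_measurable => // x y xy; rewrite lerD2r.
rewrite -[LHS]/(pushforward mu (fun x : RT => (x + a)%R : RT) B).
apply/esym/lebesgue_measure_unique => //= _ [[u v]] _ <-.
rewrite /pushforward.
have -> : (fun x : RT => (x + a)%R : RT) @^-1` `]u, v] = `](u - a)%R, (v - a)%R]%classic.
  by apply/seteqP; split => x /=; rewrite !in_itv/= ltrBlDr lerBrDr.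
rewrite !lebesgue_measure_itv/= !lte_fin ltrD2r.
by case: ifP => // _; rewrite -!EFinB; congr EFin; ring.
Qed.

(** With [m] the floor of [a], cut [[a, a + 1[] at [m + 1] and move the right piece back by 1: this
    gives [[m, m + 1[]. *)
Lemma lebesgue_measure_period a B : measurable B ->
  (forall x, B (x + 1)%R <-> B x) ->
  mu ((fun x : RT => (x + a)%R : RT) @^-1` B `&` `[0%R, 1%R[) = mu (B `&` `[0%R, 1%R[).
Proof.
move=> mB Bp.
have BpZ x (m : int) : B (x + m%:~R)%R <-> B x.
  have BN y (n : nat) : B (y + n%:R)%R <-> B y.
    elim: n y => [|n IH] y; first by rewrite addr0.
    by rewrite -natr1 addrA Bp IH.
  case: m => n; first exact: BN.
  by rewrite NegzE mulrNz -(BN _ n.+1) subrK.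
have shift c u v : mu ((fun x : RT => (x + c)%R : RT) @^-1` B `&` `[u, v[) =
    mu (B `&` `[(u + c)%R, (v + c)%R[).
  rewrite -(@lebesgue_measure_shift c (B `&` _)); last exact: measurableI.
  congr (mu _); apply/seteqP; split=> x /= [Bx]; rewrite !in_itv/= => /andP[h1 h2].
    by split=> //; rewrite lerD2r h1 ltrD2r.
  by split=> //; rewrite -(lerD2r c) h1 -(ltrD2r c).
have shiftZ (m : int) u v : mu (B `&` `[(u + m%:~R)%R, (v + m%:~R)%R[) = mu (B `&` `[u, v[).
  rewrite -shift; congr (mu (_ `&` _)); apply/seteqP.
  by split=> x /=; exact: (BpZ x m).1 || exact: (BpZ x m).2.
have split u v w : (u <= v)%R -> (v <= w)%R ->
    mu (B `&` `[u, w[) = mu (B `&` `[u, v[) + mu (B `&` `[v, w[).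
  move=> uv vw; rewrite -measureU//; try exact: measurableI.
    congr (mu _); rewrite -setIUr; congr (_ `&` _).
    apply/seteqP; split=> x /=; rewrite !in_itv/=.
      by move=> /andP[ux xw]; case: (ltP x v) => xv; [left; rewrite ux|right].
    move=> [/andP[ux xv]|/andP[vx xw]]; first by rewrite ux (lt_le_trans xv).
    by rewrite (le_trans uv vx).
  rewrite setIACA setIid; apply/seteqP; split=> // x /= [_ []].
  by rewrite !in_itv/= => /andP[_ xv] /andP[vx _]; move: (lt_le_trans xv vx); rewrite ltxx.
rewrite shift add0r.
set m := Num.floor a.
have m1 : (m%:~R <= a)%R by exact: ge_floor.
have m2 : (a < m%:~R + 1)%R by have := floorD1_gt a; rewrite intrD.
have m3 : (m%:~R + 1 <= 1 + a)%R by lra.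
rewrite (split a (m%:~R + 1)%R (1 + a)%R (ltW m2) m3).
rewrite [X in _ + X](_ : _ = mu (B `&` `[m%:~R, a[)); last first.
  by rewrite -(shiftZ 1%Z m%:~R%R a) [(1 + a)%R]addrC.
rewrite addeC -(split _ _ _ m1 (ltW m2)).
by rewrite -(shiftZ m 0%R 1%R) add0r [(1 + _)%R]addrC.
Qed.

Definition lebesgue01 : set RT -> \bar R :=
  mrestr mu (measurable_itv `[(0 : R)%R, 1%R[%R).

HB.instance Definition _ := Measure.on lebesgue01.

Let lebesgue01_setT : lebesgue01 setT = 1.
Proof.
rewrite /lebesgue01 /mrestr setTI lebesgue_measure_itv/= lte_fin ltr01.
by rewrite oppr0 adde0.
Qed.

HB.instance Definition _ := Measure_isProbability.Build _ _ _
  lebesgue01 lebesgue01_setT.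

End LebesguePeriod.

Section CircleBorel.
Variable R : realType.
Local Notation circle := (circle R).
Local Notation RT := (measurableTypeR R).

Lemma open_proj_preimage (A : set circle) : open A -> open ((@proj R) @^-1` A).
Proof.
rewrite !openE => oA t At; have := oA _ At; rewrite /interior /= -nbhs_ballE.
move=> [e /= e0 eA]; rewrite -nbhs_ballE; exists e => // s ts; apply: eA.
by rewrite ballEmdist /=; apply: le_lt_trans (mdist_proj _ _) ts.
Qed.

Lemma measurable_proj : measurable_fun [set: RT] (@proj R : RT -> borel_circle R).
Proof.
apply: (@measurability _ _ RT (borel_circle R) setT (@proj R)
  (@open circle)) => //= _ [A oA <-]; rewrite setTI.
exact: open_measurable (open_proj_preimage oA).
Qed.

Lemma measurable_circle_fun (f : diffeo R) :
  measurable_fun [set: borel_circle R] (dfun f : borel_circle R -> borel_circle R).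
Proof.
apply: (@measurability _ _ (borel_circle R) (borel_circle R) setT (dfun f)
  (@open circle)) => //= _ [A oA <-]; rewrite setTI.
apply: sub_sigma_algebra; move: oA; rewrite !openE => oA x Ax.
have [L L0 fL] := diffeo_lipschitz f.
have := oA _ Ax; rewrite /interior /= -nbhs_ballE => -[e /= e0 eA].
exists (e / L) => /=; first by rewrite divr_gt0.
move=> y; rewrite ballEmdist /= => xy; apply: eA; rewrite ballEmdist /=.
apply: le_lt_trans (fL _ _) _.
by rewrite mulrC -ltr_pdivlMr.
Qed.

End CircleBorel.

Section Existence.
Variables (R : realType) (F : R -> R) (alpha : R) (f : diffeo R).
Hypotheses (Fl : diffeo_lift F) (Fa : rot F alpha).
Hypothesis fF : forall t, f (proj t) = proj (F t).
Local Notation RT := (measurableTypeR R).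
Implicit Types (x y : R).

Let S y := [set x | exists N, forall n, (N <= n)%N ->
  iter n F (y - n%:R * alpha) <= x].

(* The superior limit of [iter n F (y - n * alpha)], which conjugates the
   translation by [alpha] to [F]. *)
Let K y := inf (S y).

Let Fh : {homo F : x y / x <= y}. Proof. exact: diffeo_lift_homo. Qed.
Let F1 : deg1 F. Proof. by case: Fl. Qed.

Let Sy y : has_inf (S y).
Proof.
have h n : `|iter n F (y - n%:R * alpha) - y| <= 2.
  have := Fa n (y - n%:R * alpha); congr (`|_| <= 2); ring.
split.
  exists (y + 2), 0%N => n _; have := h n; rewrite ler_norml => /andP[_ ?]; lra.
exists (y - 2) => x [N /(_ N (leqnn N))]; have := h N; rewrite ler_norml => /andP[? _]; lra.
Qed.

Let K_homo : {homo K : x y / x <= y}.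
Proof.
move=> x y xy; apply: lb_le_inf; first by case: (Sy y).
move=> z [N hN]; apply: ge_inf; first by case: (Sy x).
exists N => n nN; apply: le_trans (hN n nN); apply: iter_homo => //.
by rewrite lerD2r.
Qed.

Let K1 y : K (y + 1) = K y + 1.
Proof.
apply/eqP; rewrite eq_le; apply/andP; split.
  rewrite -lerBlDr; apply: lb_le_inf; first by case: (Sy y).
  move=> z [N hN]; rewrite lerBlDr; apply: ge_inf; first by case: (Sy (y + 1)).
  exists N => n nN; rewrite addrAC iter_deg1// lerD2r; exact: hN.
apply: lb_le_inf; first by case: (Sy (y + 1)).
move=> z [N hN]; rewrite -lerBrDr; apply: ge_inf; first by case: (Sy y).
exists N => n nN; rewrite lerBrDr -iter_deg1// addrAC; exact: hN.
Qed.

(** Term [n + 1] at [y + alpha] is [F] of term [n] at [y], and an increasing homeomorphism commutes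
    with superior limits. *)
Let KF y : K (y + alpha) = F (K y).
Proof.
have [H [FK HK H1 Hs HE]] := diffeo_lift_inverse Fl.
have step n : y + alpha - n.+1%:R * alpha = y - n%:R * alpha.
  by rewrite -natr1; ring.
apply/eqP; rewrite eq_le; apply/andP; split.
  rewrite -[K (y + alpha)]HK (diffeo_lift_mono Fl).
  apply: lb_le_inf; first by case: (Sy y).
  move=> z [N hN]; rewrite -(diffeo_lift_mono Fl) HK.
  apply: ge_inf; first by case: (Sy (y + alpha)).
  exists N.+1 => -[//|n] nN; rewrite step iterS (diffeo_lift_mono Fl); exact: hN.
apply: lb_le_inf; first by case: (Sy (y + alpha)).
move=> z [N hN]; rewrite -[z]HK (diffeo_lift_mono Fl).
apply: ge_inf; first by case: (Sy y).
exists N => n nN; rewrite -(diffeo_lift_mono Fl) HK -iterS -step.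
by apply: hN; exact: leqW.
Qed.

Let kappa (t : RT) : borel_circle R := proj (K t).

Let kappa_measurable : measurable_fun [set: RT] kappa.
Proof.
apply: (measurableT_comp (@measurable_proj R)).
exact: nondecreasing_measurable.
Qed.

HB.instance Definition _ := isMeasurableFun.Build _ _ _ _ kappa kappa_measurable.

Lemma invariant_measure_exists :
  exists mu : probability (borel_circle R) R, invariant_measure f mu.
Proof.
exists (distribution (@lebesgue01 R) kappa) => A mA.
rewrite /distribution /pushforward.
have mB : measurable (kappa @^-1` A) by rewrite -[X in measurable X]setTI; exact: kappa_measurable.
rewrite -[RHS](@lebesgue_measure_period R alpha (kappa @^-1` A) mB); last first.
  by move=> x; rewrite /= /kappa K1 (proj_shift _ 1).
rewrite /lebesgue01 /mrestr; congr (lebesgue_measure (_ `&` _)).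
by apply/seteqP; split => x /=; rewrite /kappa KF fF.
Qed.

End Existence.

(** * Borel probabilities on the circle through a fundamental domain *)

Section Cut.
Variable R : realType.
Local Notation circle := (circle R).
Local Notation RT := (measurableTypeR R).
Implicit Types (x : circle) (t b : R).

Definition cut x : R := repr x - (Num.floor (repr x))%:~R.

Lemma cut_itv x : 0 <= cut x < 1.
Proof.
rewrite /cut subr_ge0 ge_floor /= ltrBlDl.
by have := floorD1_gt (repr x : R); rewrite intrD.
Qed.

Lemma proj_cut x : proj (cut x) = x.
Proof. by rewrite /cut -mulrNz proj_shift proj_repr. Qed.

Lemma cut_proj t : 0 <= t < 1 -> cut (proj t) = t.
Proof.
move=> /andP[t0 t1]; have /andP[c0 c1] := cut_itv (proj t).
have /proj_eqP[m mE] : proj (cut (proj t)) = proj t by rewrite proj_cut.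
suff m0 : m = 0 by rewrite mE m0 addr0.
have : (m%:~R : R) < 1%:~R by lra.
have : ((-1)%:~R : R) < m%:~R by rewrite mulrNz; lra.
by rewrite !ltr_int; lia.
Qed.

Lemma open_proj_itv (a b : R) : open ((@proj R) @` `]a, b[).
Proof.
rewrite openE => _ [t /= + <-]; rewrite in_itv/= => /andP[at_ tb].
change (nbhs (proj t) ((@proj R) @` `]a, b[)).
pose e := Num.min (t - a) (b - t).
have e0 : 0 < e by rewrite lt_min !subr_gt0 at_.
have ea : e <= t - a by rewrite ge_min lexx.
have eb : e <= b - t by rewrite ge_min lexx orbT.
rewrite -nbhs_ballE; exists e => // y; rewrite ballEmdist /= => ye.
have [u uE ue] := mdist_lift ye.
exists (t - u); last by rewrite projB uE opprB addrC subrK.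
by move: ue; rewrite ltr_norml /= in_itv/= => /andP[? ?]; apply/andP; split; lra.
Qed.

Lemma measurable_open_circle (A : set circle) : open A ->
  measurable (A : set (borel_circle R)).
Proof. exact: sub_sigma_algebra. Qed.

(** [cut] jumps at the class of 0, which no image of an interval []0, b[] with [b <= 1] contains;
    that point is obtained as the complement of the image of []0, 1[]. *)
Lemma measurable_cut_lt b : measurable ([set x | cut x < b] : set (borel_circle R)).
Proof.
have [b0|b0] := leP b 0.
  rewrite (_ : [set x | _] = set0); first exact: measurable0.
  apply/seteqP; split=> // x /=; have := cut_itv x; lra.
have [b1|b1] := ltP 1 b.
  rewrite (_ : [set x | _] = setT); first exact: measurableT.
  apply/seteqP; split=> // x _ /=; have := cut_itv x; lra.
rewrite (_ : [set x | _] =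
  ~` ((@proj R) @` `]0, 1[) `|` ((@proj R) @` `]0, b[)); last first.
  apply/seteqP; split=> x /=.
    move=> xb; have [x0|x0] := eqVneq (cut x) 0.
      left=> -[t]; rewrite /= in_itv/= => t01 tx.
      have t01' : 0 <= t < 1 by lra.
      by have := cut_proj t01'; rewrite tx x0; lra.
    right; exists (cut x); last exact: proj_cut.
    rewrite /= in_itv/= xb andbT lt_neqAle eq_sym x0.
    by case/andP: (cut_itv x).
  case=> [nx|[t]].
    suff -> : cut x = 0 by [].
    apply: contrapT => /eqP x0; apply: nx; exists (cut x); last exact: proj_cut.
    rewrite /= in_itv/= lt_neqAle eq_sym x0.
    exact: cut_itv.
  rewrite in_itv/= => /andP[t0 tb] <-; rewrite cut_proj; lra.
have mo (a c : R) : measurable ((@proj R) @` `]a, c[ : set (borel_circle R)).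
  by apply: measurable_open_circle; exact: open_proj_itv.
by apply: measurableU => //; exact: measurableC.
Qed.

Lemma measurable_cut : measurable_fun [set: borel_circle R] (cut : borel_circle R -> RT).
Proof.
apply: (@measurability _ _ (borel_circle R) RT setT cut (@RGenInftyO.G R)).
  exact: RGenInftyO.measurableE.
move=> _ [_ [b ->] <-]; rewrite setTI.
rewrite (_ : cut @^-1` _ = [set x | cut x < b]); first exact: measurable_cut_lt.
by apply/seteqP; split=> x /=; rewrite in_itv.
Qed.

HB.instance Definition _ := isMeasurableFun.Build _ _ _ _
  (cut : borel_circle R -> RT) measurable_cut.

Lemma probability_circle_eq (m1 m2 : probability (borel_circle R) R) :
  (forall b, m1 [set x | cut x < b] = m2 [set x | cut x < b]) ->
  forall A : set (borel_circle R), measurable A -> m1 A = m2 A.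
Proof.
move=> m12 A mA.
have projm : measurable ((@proj R : RT -> borel_circle R) @^-1` A).
  by rewrite -[X in measurable X]setTI; exact: measurable_proj.
have AE : A = cut @^-1` ((@proj R) @^-1` A).
  by apply/seteqP; split=> x /=; rewrite proj_cut.
have lt (m : probability (borel_circle R) R) b :
    distribution m (cut : borel_circle R -> RT) `]-oo, b[ = m [set x | cut x < b].
  suff -> : [set x | cut x < b] = cut @^-1` `]-oo, b[ by [].
  by apply/seteqP; split=> x /=; rewrite in_itv.
rewrite AE; apply: (@measure_unique _ R RT (@RGenInftyO.G R)
  (fun n => `]-oo, n%:R[) _ _ _ _
  (distribution m1 (cut : borel_circle R -> RT))
  (distribution m2 (cut : borel_circle R -> RT))) => //.
- exact: RGenInftyO.measurableE.
- move=> _ _ [a ->] [b ->]; exists (Num.min a b).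
  by apply/seteqP; split=> x /=; rewrite !in_itv/= lt_min => /andP.
- by move=> n; exists n%:R.
- apply/seteqP; split=> // x _; exists (Num.bound x) => //=.
  by rewrite in_itv/= ltr_bound.
- by move=> _ [b ->]; exact: (etrans (lt m1 b) (etrans (m12 b) (esym (lt m2 b)))).
- by move=> n; rewrite (le_lt_trans (probability_le1 _ _))// ?ltry//; exact: measurable_itv.
Qed.

End Cut.

(** * Uniqueness of the invariant measure *)

Section Uniqueness.
Variables (R : realType) (F : R -> R) (alpha : R) (f : diffeo R).
Hypotheses (Fl : diffeo_lift F) (Fa : rot F alpha).
Hypothesis fF : forall t, f (proj t) = proj (F t).
Local Notation RT := (measurableTypeR R).
Implicit Types (t b : R) (nu : probability (borel_circle R) R).

(* For [0 <= b], the number of lifts of [x] in [0, b[. *)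
Let count b (x : borel_circle R) : R := - (Num.floor (cut x - b))%:~R.

(** The distribution function of [nu], extended from a period to a degree-one function on the
    line. *)
Let hnu nu b : R := \int[nu]_x count b x.

Let count_measurable b : measurable_fun [set: borel_circle R] (count b : _ -> RT).
Proof.
have h : measurable_fun [set: RT] (fun t : RT => - (Num.floor (t - b))%:~R : RT).
  apply: nonincreasing_measurable => // s t st.
  by rewrite lerN2 ler_int floor_ge_int (le_trans (ge_floor _))// lerD2r.
exact: (measurableT_comp h (@measurable_cut R)).
Qed.

Let count_bounds b x : b - 1 <= count b x <= b + 1.
Proof.
rewrite /count; have := floor_itv (cut x - b); have := cut_itv x.
by rewrite intrD; lra.
Qed.

Let count_integrable nu b : nu.-integrable setT (EFin \o count b).
Proof.
apply: measurable_bounded_integrable => //.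
- by rewrite (le_lt_trans (probability_le1 _ _))// ltry.
- exact: count_measurable.
- exists (`|b| + 1); split; first exact: num_real.
  move=> M bM x _; have := count_bounds b x; have := ler_norm b; have := ler_norm (- b).
  rewrite normrN => ? ? /andP[? ?]; rewrite /= ler_norml; apply/andP; split; lra.
Qed.

Let invariant_integral nu g : invariant_measure f nu ->
  measurable_fun [set: borel_circle R] (g : _ -> RT) ->
  nu.-integrable setT (EFin \o g) ->
  nu.-integrable setT (EFin \o (g \o f)) ->
  \int[nu]_x g (f x) = \int[nu]_x g x.
Proof.
move=> inv mg ig igf; rewrite /Rintegral; congr fine.
have mf := @measurable_circle_fun R f.
rewrite -(@integral_pushforward _ _ _ _ _ (f : borel_circle R -> borel_circle R)
  mf nu setT (EFin \o g))//.
- by apply: eq_measure_integral => A mA _; exact: inv.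
- exact/measurable_EFinP.
Qed.

Let hnu_homo nu : {homo hnu nu : a b / a <= b}.
Proof.
move=> a b ab; apply: le_Rintegral => //; [exact: count_integrable|exact: count_integrable|].
move=> x _; rewrite /count lerN2 ler_int floor_ge_int (le_trans (ge_floor _))//.
by rewrite lerD2l lerN2.
Qed.

Let hnu1 nu : deg1 (hnu nu).
Proof.
move=> b; rewrite /hnu.
have -> : count (b + 1) = (fun x => count b x + 1).
  apply/funext => x; rewrite /count.
  suff -> : Num.floor (cut x - (b + 1)) = Num.floor (cut x - b) - 1.
    by rewrite intrD mulrNz; ring.
  by apply: floor_def; have := floor_itv (cut x - b); rewrite !intrD mulrNz; lra.
rewrite RintegralD//; [|exact: count_integrable|].
  by rewrite Rintegral_cst//= probability_setT mul1r.
apply: measurable_bounded_integrable => //.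
  by rewrite (le_lt_trans (probability_le1 _ _))// ltry.
by exists 1; split; [exact: num_real|move=> M M1 x _; rewrite /= normr1 ltW].
Qed.

Let count0 : count 0 = fun=> 0.
Proof.
apply/funext => x; rewrite /count subr0 (_ : Num.floor _ = 0) ?oppr0//.
by apply: floor_def; exact: cut_itv.
Qed.

Let hnu0 nu : hnu nu 0 = 0.
Proof. by rewrite /hnu count0 Rintegral_cst// mul0r. Qed.

(* The lift of [cut x] under [F] is [cut (f x)] up to an integer that does not
   depend on [b]. *)
Let countF b x : count (F b) (f x) - count b x = count (F 0) (f x) - count 0 x.
Proof.
have /proj_eqP[k kE] : proj (F (cut x)) = proj (cut (f x)).
  by rewrite proj_cut -fF proj_cut.
suff h c : Num.floor (cut (f x) - F c) = Num.floor (cut x - c) - k.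
  by rewrite /count !h !intrD; ring.
have F1 : deg1 F by case: Fl.
have iff n : (n <= Num.floor (cut (f x) - F c)) = (n <= Num.floor (cut x - c) - k).
  rewrite floor_ge_int lerBrDr [in RHS]lerBrDr floor_ge_int [in RHS]lerBrDr.
  rewrite [X in _ = (X <= _)]addrC -[in RHS](diffeo_lift_mono Fl) deg1Z// kE intrD.
  by apply/idP/idP; lra.
by apply/eqP; rewrite eq_le -iff lexx iff lexx.
Qed.

(** Integrate [countF]: invariance replaces [count (F b) (f x)] by [count (F b) x] under the
    integral. *)
Let hnuF nu : invariant_measure f nu -> exists c, forall b, hnu nu (F b) = hnu nu b + c.
Proof.
move=> inv; exists (hnu nu (F 0) - hnu nu 0) => b.
have mf := @measurable_circle_fun R f.
have ifint c : nu.-integrable setT (EFin \o (count c \o f)).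
  apply: measurable_bounded_integrable => //.
  - by rewrite (le_lt_trans (probability_le1 _ _))// ltry.
  - exact: (measurableT_comp (count_measurable c) mf).
  - exists (`|c| + 1); split; first exact: num_real.
    move=> M bM x _; have := count_bounds c (f x).
    have := ler_norm c; have := ler_norm (- c).
    rewrite normrN => ? ? /andP[? ?]; rewrite /= ler_norml; apply/andP; split; lra.
have E c : hnu nu (F c) - hnu nu c = \int[nu]_x (count (F c) (f x) - count c x).
  rewrite RintegralB//; [|exact: ifint|exact: count_integrable].
  congr (_ - _); apply/esym/(invariant_integral inv).
  - exact: count_measurable.
  - exact: count_integrable.
  - exact: ifint.
have : hnu nu (F b) - hnu nu b = hnu nu (F 0) - hnu nu 0.
  by rewrite !E; apply: eq_Rintegral => x _; exact: countF.
lra.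
Qed.

Let hnu_lt nu b : 0 < b <= 1 -> nu [set x | cut x < b] = (hnu nu b)%:E.
Proof.
move=> b01; pose A : set (borel_circle R) := [set x | cut x < b].
have mA : measurable A by exact: measurable_cut_lt.
have cE : count b = \1_A.
  apply/funext => x; rewrite /count indicE; have := cut_itv x => c01.
  have [xb|xb] := ltP (cut x) b.
    rewrite (_ : x \in A) /=; last exact: mem_set.
    rewrite (_ : Num.floor _ = - 1) ?mulrNz ?opprK//.
    by apply: floor_def; rewrite addNr mulrNz; lra.
  rewrite (_ : (x \in A) = false) /=; last first.
    by apply/negbTE/negP; rewrite inE /A /= ltNge xb.
  rewrite (_ : Num.floor _ = 0) ?oppr0//.
  by apply: floor_def; rewrite add0r; lra.
rewrite /hnu cE /Rintegral integral_indic// setIT fineK//.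
exact: fin_num_measure.
Qed.

(** As [h] stays within 1 of the identity, its translation constant is [alpha]. Hence both functions
    take the value [m * alpha + n] at [F^m 0 + n]. If [h2 b < h1 b], such a value lies strictly
    between, and comparing [b] with [F^m 0 + n] contradicts the monotonicity of [h1] or of [h2]. *)
Let hnu_unique (h1 h2 : R -> R) c1 c2 :
  (forall u v : R, u < v -> exists (m : nat) (n : int), u < m%:R * alpha + n%:~R < v) ->
  {homo h1 : a b / a <= b} -> {homo h2 : a b / a <= b} -> deg1 h1 -> deg1 h2 ->
  h1 0 = 0 -> h2 0 = 0 -> (forall b, h1 (F b) = h1 b + c1) ->
  (forall b, h2 (F b) = h2 b + c2) -> forall b, h1 b <= h2 b.
Proof.
have iterh (h : R -> R) c n : (forall b, h (F b) = h b + c) -> h (iter n F 0) = h 0 + n%:R * c.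
  move=> hF; elim: n => [|n IH]; first by rewrite mul0r addr0.
  by rewrite iterS hF IH -natr1; ring.
have cE (h : R -> R) c : {homo h : a b / a <= b} -> deg1 h -> h 0 = 0 ->
    (forall b, h (F b) = h b + c) -> c = alpha.
  move=> hh hd h0 hF.
  have bd n : `|n%:R * c - n%:R * alpha| <= 3.
    have := deg1_osc (iter n F 0) 0 hh hd; have := Fa n 0.
    rewrite (iterh _ _ _ hF) h0 !ler_norml => /andP[? ?] /andP[? ?].
    by apply/andP; split; lra.
  have le1 : c - alpha <= 0.
    apply: (@le0_archi _ _ 3) => n; rewrite mulrBr.
    by have := bd n; rewrite ler_norml => /andP[].
  have le2 : alpha - c <= 0.
    apply: (@le0_archi _ _ 3) => n; rewrite mulrBr.
    by have := bd n; rewrite ler_norml => /andP[? ?]; lra.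
  lra.
move=> dens h1h h2h h11 h21 h10 h20 h1F h2F b.
rewrite leNgt; apply/negP => /dens[m [n /andP[u v]]].
have e1 : h1 (iter m F 0 + n%:~R) = m%:R * alpha + n%:~R.
  by rewrite deg1Z// (iterh _ _ _ h1F) h10 add0r (cE h1 c1).
have e2 : h2 (iter m F 0 + n%:~R) = m%:R * alpha + n%:~R.
  by rewrite deg1Z// (iterh _ _ _ h2F) h20 add0r (cE h2 c2).
have [/h1h|/ltW/h2h] := leP b (iter m F 0 + n%:~R).
  by rewrite e1 leNgt v.
by rewrite e2 leNgt u.
Qed.

Lemma invariant_measure_unique nu1 nu2 :
  (forall u v : R, u < v -> exists (m : nat) (n : int), u < m%:R * alpha + n%:~R < v) ->
  invariant_measure f nu1 -> invariant_measure f nu2 ->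
  forall A : set (borel_circle R), measurable A -> nu1 A = nu2 A.
Proof.
move=> dens inv1 inv2; apply: probability_circle_eq => b.
have [c1 h1F] := hnuF inv1; have [c2 h2F] := hnuF inv2.
have [b0|b0] := leP b 0.
  rewrite (_ : [set x | _] = set0) ?measure0//.
  apply/seteqP; split=> // x /=; have := cut_itv x; lra.
have [b1|b1] := ltP 1 b.
  rewrite (_ : [set x | _] = setT) ?probability_setT//.
  apply/seteqP; split=> // x _ /=; have := cut_itv x; lra.
rewrite !hnu_lt ?b0//; congr EFin; apply/eqP; rewrite eq_le.
apply/andP; split; first exact: (hnu_unique dens (@hnu_homo nu1) (@hnu_homo nu2)
  (@hnu1 nu1) (@hnu1 nu2) (hnu0 nu1) (hnu0 nu2) h1F h2F).
exact: (hnu_unique dens (@hnu_homo nu2) (@hnu_homo nu1)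
  (@hnu1 nu2) (@hnu1 nu1) (hnu0 nu2) (hnu0 nu1) h2F h1F).
Qed.

End Uniqueness.

(** The multiples of a nonzero [theta] shorter than the interval cannot jump over it. *)
Lemma liouville_dense (R : realType) (alpha u v : R) : liouville alpha -> u < v ->
  exists (m : nat) (n : int), u < m%:R * alpha + n%:~R < v.
Proof.
move=> aL uv; have uv2 : 0 < (v - u) / 2 by rewrite divr_gt0// subr_gt0.
have [N NP] := pow2_small uv2.
have [p [q [q2 pq /andP[th0 thN]]]] := liouville_small N aL.
set theta := q%:R * alpha - p%:~R in th0 thN.
have thuv : `|theta| < v - u.
  apply: (le_lt_trans thN); apply: (@le_lt_trans _ _ (2^-1 ^+ N)); last by lra.
  apply: lerXn2r; rewrite ?nnegrE ?invr_ge0//.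
  by rewrite lef_pV2 ?posrE ?ler_nat// ltr0n; exact: leq_trans q2.
have el (k : nat) (j : int) : k%:R * theta + j%:~R =
    (k * q)%N%:R * alpha + (j - k%:Z * p)%:~R.
  by rewrite natrM intrD mulrNz intrM /theta; ring.
have step (w d : R) : 0 < d -> 0 <= w -> exists k : nat, w < k%:R * d <= w + d.
  move=> d0 w0; exists (Num.truncn (w / d)).+1.
  have wd : 0 <= w / d by rewrite divr_ge0// ltW.
  have /andP[h1 h2] := truncn_itv wd.
  rewrite -ltr_pdivrMr// h2 /= -natr1 mulrDl mul1r lerD2r.
  by rewrite -ler_pdivlMr.
(* Only natural multiples are available, as [m] counts iterations: walk up from an integer below
   [u], or down from one above [v], according to the sign of [theta]. *)
have [th|th] := leP 0 theta.
  rewrite (ger0_norm th) in th0 thuv.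
  have [|k /andP[k1 k2]] := step (u - (Num.floor u)%:~R) theta th0.
    by rewrite subr_ge0 ge_floor.
  by exists (k * q)%N, (Num.floor u - k%:Z * p); rewrite -el; lra.
rewrite (ltr0_norm th) in th0 thuv.
have [|k /andP[k1 k2]] := step ((Num.floor v + 1)%:~R - v) (- theta) th0.
  by rewrite subr_ge0 ltW// floorD1_gt.
by exists (k * q)%N, (Num.floor v + 1 - k%:Z * p); rewrite -el; lra.
Qed.

(** * Hausdorff dimension *)

Section HausdorffCover.
Variables (R : realType) (T : metricType R).
Local Open Scope ereal_scope.
Implicit Types (s delta : R) (Z : set T) (A : nat -> nat -> set T).

Lemma diam_pow_ge0 s (B : set T) : 0 <= diam_pow s B.
Proof. by rewrite /diam_pow; case: pselect => //= _; exact: poweR_ge0. Qed.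

Lemma nneseries_le_bound (u : nat -> \bar R) c : (forall n, 0 <= u n) ->
  (forall N, \sum_(0 <= n < N) u n <= c) -> \sum_(0 <= n <oo) u n <= c.
Proof.
move=> u0 uc; apply: lime_le; first exact: is_cvg_nneseries.
by apply: nearW => N; exact: uc.
Qed.

(** The covers used below are indexed by the stage [n] and the centre [k]; a bijection of [nat] with
    its square turns them into sequences. *)
Lemma hausdorff_premeasure_double s delta Z A :
  Z `<=` \bigcup_n \bigcup_k A n k -> (forall n k, diam (A n k) <= delta%:E) ->
  hausdorff_premeasure s delta Z <=
    \sum_(0 <= n <oo) \sum_(0 <= k <oo) diam_pow s (A n k).
Proof.
move=> ZA Ad; have /card_esym/ppcard_eqP[f] := card_nat2.
apply: (@le_trans _ _ (\sum_(0 <= i <oo) diam_pow s (A (f i).1 (f i).2))).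
  apply: ereal_inf_lbound; exists (fun i => A (f i).1 (f i).2) => //.
  split=> [z /ZA[n _ [k _ Az]]|i]; last exact: Ad.
  by exists (f^-1%FUN (n, k)) => //=; rewrite invK ?inE.
rewrite nneseries_esumT; last by move=> i; exact: diam_pow_ge0.
rewrite -(@reindex_esum R nat (nat * nat)%type setT setT f
  (fun nk => diam_pow s (A nk.1 nk.2))); last exact: bij.
have -> : [set: nat * nat] = [set: nat] `*`` (fun=> [set: nat]).
  by apply/seteqP; split.
rewrite -(@esum_esum R nat nat setT (fun=> setT) (fun n k => diam_pow s (A n k))).
  rewrite nneseries_esumT.
    by apply: le_esum => n _; rewrite nneseries_esumT// => k; exact: diam_pow_ge0.
  by move=> n; apply: nneseries_ge0 => k _ _; exact: diam_pow_ge0.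
by move=> n k _ _; exact: diam_pow_ge0.
Qed.

Lemma diam_ge0 (B : set T) : B !=set0 -> 0 <= diam B.
Proof.
by move=> [z Bz]; apply: ereal_sup_ubound; exists (z, z) => //=; rewrite mdistxx.
Qed.

Lemma diam_ball_le (z : T) (r d : R) : (2 * r <= d)%R -> diam (ball z r) <= d%:E.
Proof.
move=> rd; apply: ge_ereal_sup => _ [[x y] /= [xz yz] <-].
rewrite !ballEmdist /= in xz yz; rewrite lee_fin.
have := metric_triangle x z y; rewrite (metric_sym x z); lra.
Qed.

(** The diameter to the power [s] is at most [w ^ (s * (n + 1))], and [w <= 1]. For fixed [s > 0]
    the condition on [n] holds from some stage on. *)
Lemma diam_pow_ball_le (z : T) s (r w : R) (n : nat) : (0 < w <= 1)%R ->
  (2 * r <= w ^+ n.+1)%R -> (1 <= s * n.+1%:R)%R ->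
  diam_pow s (ball z r) <= w%:E.
Proof.
move=> /andP[w0 w1] rw sn; rewrite /diam_pow; case: pselect => [_|/eqP/set0P ne] /=.
  by rewrite lee_fin ltW.
have s0 : (0 <= s)%R.
  rewrite leNgt; apply/negP => s0.
  have : (s * n.+1%:R < 0)%R by rewrite pmulr_llt0.
  by move: sn; lra.
apply: (@le_trans _ _ ((w ^+ n.+1)%:E `^ s)).
  apply: gt0_ler_poweR => //; last exact: diam_ball_le.
    by rewrite in_itv/= leey andbT diam_ge0.
  by rewrite in_itv/= leey andbT lee_fin exprn_ge0// ltW.
rewrite poweR_EFin lee_fin -(powR_mulrn _ (ltW w0)) -powRrM.
rewrite -[leRHS](powRr1 (ltW w0)); apply: ger_powR; first by rewrite w0.
by rewrite mulrC.
Qed.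

End HausdorffCover.

(** * Dimension of the invariant measure *)

Section Dimension.
Variable R : realType.
Local Notation circle := (circle R).
Local Notation bc := (borel_circle R).
Local Open Scope ereal_scope.
Variables (f : diffeo R) (mu : probability bc R).
Hypothesis muf : invariant_measure f mu.
Hypothesis conc : forall n, concentrated_map n f.

Let iter_preimage (A : set bc) i : measurable A ->
  measurable ((iter i f : bc -> bc) @^-1` A) /\ mu (iter i f @^-1` A) = mu A.
Proof.
move=> mA; elim: i => [|i [IHm IH]]; first by [].
have -> : iter i.+1 f @^-1` A = f @^-1` (iter i f @^-1` A).
  by apply/seteqP; split=> x /=; rewrite -iterS iterSr.
split; last by rewrite muf.
by rewrite -[X in measurable X]setTI; exact: measurable_circle_fun.
Qed.

Let balls (cs : seq circle) (r : R) : set bc := [set x | exists2 z, z \in cs & mdist x z < r]%R.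

Let balls_measurable cs r : measurable (balls cs r).
Proof.
apply: measurable_open_circle; rewrite openE => x [z zs xz].
change (nbhs (x : circle) (balls cs r)).
rewrite -nbhs_ballE; exists (r - mdist x z)%R; first by rewrite /= subr_gt0.
move=> y; rewrite ballEmdist /= => xy; exists z => //.
have := metric_triangle y x z; rewrite (metric_sym y x); lra.
Qed.

(** By invariance [M * mu B] is the integral of the number of visits to [B] during the first [M]
    steps, which is at most [c * M] at every point. *)
Let balls_measure (cs : seq circle) (r e c : R) (M : nat) : (0 < M)%N -> (0 < e)%R ->
  (forall x, \sum_(i < M) (cfar cs (r - e) (iter i f x))%:R <= c * M%:R :> R)%R ->
  mu (~` balls cs r) <= c%:E.
Proof.
move=> M0 e0 h; pose B := ~` balls cs r.
have mB : measurable B by apply: measurableC; exact: balls_measurable.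
pose g (i : nat) (x : bc) : \bar R := (\1_(iter i f @^-1` B) x)%:E.
have mg i : measurable_fun [set: bc] (g i).
  apply/measurable_EFinP; apply: measurable_indic.
  exact: (iter_preimage i mB).1.
have intg : \int[mu]_x (\sum_(i < M) g i x) = M%:R%:E * mu B.
  rewrite ge0_integral_sum//; last by move=> i x _; rewrite lee_fin.
  rewrite (eq_bigr (fun=> mu B)); last first.
    move=> i _; rewrite integral_indic ?setIT//; first exact: (iter_preimage i mB).2.
    exact: (iter_preimage i mB).1.
  have muB : mu B \is a fin_num by exact: fin_num_measure.
  by rewrite -(fineK muB) sumEFin sumr_const card_ord -EFinM mulr_natl.
have : M%:R%:E * mu B <= \int[mu]_x (cst (c * M%:R)%:E) x.
  rewrite -intg; apply: ge0_le_integral => //.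
  - by move=> x _; apply: sume_ge0 => i _; rewrite lee_fin.
  - by apply: emeasurable_sum => i; exact: mg.
  - move=> x _; rewrite sumEFin lee_fin; apply: le_trans (h x).
    apply: ler_sum => i _; rewrite indicE; apply: ler_bool.
    rewrite inE /B /= => nb; apply/asboolP => z zs.
    rewrite leNgt; apply/negP => lt; apply: nb; exists z => //.
    by apply: lt_trans lt _; rewrite ltrBlDr ltrDl.
have -> : \int[mu]_x (cst (c * M%:R)%:E) x = (c * M%:R)%:E.
  rewrite integral_cst; last exact: measurableT.
  exact: (etrans (congr1 (mule (c * M%:R)%:E) (probability_setT mu)) (mule1 _)).
rewrite mulrC EFinM.
by rewrite lee_pmul2l// lte_fin ltr0n.
Qed.

Let half_sum (m N : nat) :
  (\sum_(0 <= n < N) (if (m <= n)%N then 2^-1 ^+ n else 0) <= 2 * 2^-1 ^+ m :> R)%R.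
Proof.
(* Keeping the remainder of the geometric series makes the induction go through. *)
suff h : (\sum_(0 <= n < N) (if (m <= n)%N then 2^-1 ^+ n else 0) <=
    if (m <= N)%N then 2 * 2^-1 ^+ m - 2 * 2^-1 ^+ N else 0 :> R)%R.
  apply: le_trans h _; have : (0 <= 2^-1 ^+ m :> R)%R by rewrite exprn_ge0.
  have : (0 <= 2^-1 ^+ N :> R)%R by rewrite exprn_ge0.
  case: ifP => _; lra.
elim: N => [|N IH].
  by rewrite big_nil leqn0; case: ifP => // /eqP ->; rewrite expr0 subrr.
rewrite big_nat_recr//=; move: IH; case: (leqP m N) => mN.
  rewrite leqW// exprS; lra.
rewrite leq_eqVlt ltnNge; move: mN; rewrite ltnNge => /negbTE ->.
rewrite orbF addr0 => IH; case: eqP => [mE|//].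
by rewrite -mE subrr.
Qed.

Let sum_if_lt (N S : nat) (w : R) :
  (\sum_(0 <= k < N) (if (k < S)%N then w else 0) = (minn N S)%:R * w)%R.
Proof.
elim: N => [|N IH]; first by rewrite big_nil min0n mul0r.
rewrite big_nat_recr//= IH; case: (ltnP N S) => NS.
  by rewrite (minn_idPl NS) -natr1 mulrDl mul1r.
by rewrite (minn_idPr (leqW NS)) addr0.
Qed.

Lemma measure_dim_concentrated : measure_dim mu = 0.
Proof.
have /choice[cs] := conc; move=> /choice[r] /choice[e] /choice[w] /choice[M] h.
pose V n := balls (cs n) (r n).
have VB n : mu (~` V n) <= (2^-1 ^+ n)%:E.
  have [[e0 w0 rw csw M0] hM] := h n.
  exact: balls_measure M0 e0 hM.
pose Z := \bigcap_m \bigcup_(n in [set n | (m <= n)%N]) V n.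
have mV n : measurable (V n) by exact: balls_measurable.
have mZ : measurable Z.
  by apply: bigcap_measurable => // m _; apply: bigcup_measurable.
have muZ : mu Z = 1.
  have ZC : ~` Z = \bigcup_m \bigcap_(n in [set n | (m <= n)%N]) ~` V n.
    by rewrite setC_bigcap; under eq_bigcupr do rewrite setC_bigcup.
  have null : mu.-negligible (~` Z).
    rewrite ZC; apply: negligible_bigcup => m.
    have mI : measurable (\bigcap_(n in [set n | (m <= n)%N]) ~` V n).
      by apply: bigcap_measurable; [exists m => /=|move=> n _; exact: measurableC].
    apply/negligibleP => //; apply/eqP; rewrite eq_le measure_ge0 andbT.
    apply/lee_addgt0Pr => d d0; rewrite add0e.
    have [N NP] := pow2_small d0.
    apply: (@le_trans _ _ (mu (~` V (maxn m N)))).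
      apply: le_measure; rewrite ?inE//; first exact: measurableC.
      by move=> x /(_ (maxn m N)); apply; rewrite /= leq_maxl.
    apply: (le_trans (VB _)); rewrite lee_fin; apply: le_trans NP.
    by apply: ler_wiXn2l; rewrite ?invr_ge0// ?invf_le1 ?ler1n// leq_maxr.
  have mZC : measurable (~` Z) by exact: measurableC.
  move/negligibleP : null => /(_ mZC) mZ0.
  by rewrite -[Z]setCK probability_setC// mZ0 sube0.
have Hs s : (0 < s)%R -> hausdorff_measure s (Z : set circle) = 0.
  move=> s0; apply/eqP; rewrite eq_le; apply/andP; split; last first.
    apply: (@le_trans _ _ (hausdorff_premeasure s 1 (Z : set circle))).
      apply: le_ereal_inf_tmp => _ [A _ <-].
      by apply: nneseries_ge0 => i _ _; exact: diam_pow_ge0.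
    by apply: ereal_sup_ubound; exists 1%R => //=.
  apply: ge_ereal_sup => _ [d /= d0 <-].
  apply/lee_addgt0Pr => eps eps0; rewrite add0e.
  have [N1 N1P] := pow2_small d0.
  have [N2 N2P] := pow2_small (divr_gt0 eps0 (ltr0Sn R 1)).
  pose N3 := Num.bound s^-1.
  (* From stage [m] on, the diameters are at most [d], the tail [2 * 2 ^ (- m)] is at most [eps],
     and [s * (n + 1) >= 1]. *)
  pose m := (N1 + N2 + N3)%N.
  have pw_le (a b : nat) : (a <= b)%N -> (2^-1 ^+ b <= 2^-1 ^+ a :> R)%R.
    by move=> ab; apply: ler_wiXn2l; rewrite ?invr_ge0// ?invf_le1 ?ler1n.
  have sn n : (m <= n)%N -> (1 <= s * n.+1%:R)%R.
    move=> mn; rewrite mulrC -ler_pdivrMr// div1r ltW// (lt_le_trans (ltr_bound _))//.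
    by rewrite ler_nat -/N3; apply: leqW; apply: leq_trans mn; rewrite leq_addl.
  pose A n k : set circle := if (m <= n)%N && (k < size (cs n))%N
    then ball (nth point (cs n) k) (r n) else set0.
  have wle n k : (k < size (cs n))%N -> (w n <= 2^-1 ^+ n)%R.
    move=> kn; have [[_ w0 _ csw _] _] := h n; apply: le_trans csw.
    by rewrite ler_peMl ?(ltW w0)// ler1n (leq_ltn_trans _ kn).
  have h1 n : (2^-1 ^+ n <= 1 :> R)%R by rewrite -[leRHS](expr0 2^-1) pw_le.
  have ZA : Z `<=` \bigcup_n \bigcup_k A n k.
    move=> x /(_ m Logic.I)[n /= mn [z zs xz]].
    exists n => //; exists (index z (cs n)) => //; rewrite /A mn index_mem zs /=.
    by rewrite nth_index// ballEmdist /= metric_sym.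
  have dA n k : diam (A n k) <= d%:E.
    rewrite /A; case: ifP => [/andP[mn kn]|_]; last first.
      by apply: ge_ereal_sup => _ [? /= [[]]].
    have [[_ w0 rw _ _] _] := h n.
    apply: diam_ball_le; apply: (le_trans rw).
    rewrite exprS; apply: (@le_trans _ _ (w n * 1)%R).
      rewrite ler_pM2l//; apply: exprn_ile1; first exact: ltW.
      exact: le_trans (wle n k kn) (h1 n).
    rewrite mulr1 (le_trans (wle n k kn))// (le_trans _ N1P)// pw_le//.
    by apply: leq_trans mn; rewrite /m -addnA leq_addr.
  apply: (le_trans (hausdorff_premeasure_double s ZA dA)).
  have inner n : \sum_(0 <= k <oo) diam_pow s (A n k) <=
      (if (m <= n)%N then 2^-1 ^+ n else 0 : R)%:E.
    have [[_ w0 rw csw _] _] := h n.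
    apply: nneseries_le_bound => [k|N]; first exact: diam_pow_ge0.
    case: ifP => mn; last first.
      rewrite big1// => k _; rewrite /A mn /= /diam_pow.
      by case: pselect.
    apply: (@le_trans _ _ (\sum_(0 <= k < N) (if (k < size (cs n))%N then w n else 0 : R)%:E)).
      apply: lee_sum => k _; rewrite /A mn /=; case: ifP => kn.
        apply: (@diam_pow_ball_le _ _ _ _ _ _ n) => //; last exact: sn.
        by rewrite w0 (le_trans (wle n k kn)).
      by rewrite /diam_pow; case: pselect.
    rewrite sumEFin lee_fin; apply: le_trans csw.
    rewrite sum_if_lt; apply: ler_wpM2r; first exact: ltW.
    by rewrite ler_nat geq_minr.
  apply: nneseries_le_bound => [n|N].
    by apply: nneseries_ge0 => k _ _; exact: diam_pow_ge0.
  apply: (@le_trans _ _ (\sum_(0 <= n < N) (if (m <= n)%N then 2^-1 ^+ n else 0 : R)%:E)).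
    by apply: lee_sum => n _; exact: inner.
  rewrite sumEFin lee_fin (le_trans (half_sum m N))//.
  have : (2^-1 ^+ m <= 2^-1 ^+ N2 :> R)%R.
    by apply: pw_le; rewrite /m addnAC leq_addl.
  lra.
have dim0 (Y : set circle) : 0 <= hausdorff_dim Y.
  by apply: le_ereal_inf_tmp => _ [s [s0 _] <-]; rewrite lee_fin.
have dimZ : hausdorff_dim (Z : set circle) = 0.
  apply/eqP; rewrite eq_le dim0 andbT; apply/lee_addgt0Pr => s s0; rewrite add0e.
  by apply: ereal_inf_lbound; exists s => //; split; [exact: ltW|exact: Hs].
apply/eqP; rewrite eq_le; apply/andP; split.
  by apply: ereal_inf_lbound; exists Z => //; rewrite dimZ.
by apply: le_ereal_inf_tmp => _ [Y _ <-]; exact: dim0.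
Qed.

End Dimension.

Theorem theorem1 (R : realType) (alpha : R) (halpha : liouville alpha) :
  exists U : nat -> set (diffeos_of_rotation alpha),
    [/\ forall n, open (U n : set (C0_space alpha)),
        forall n, dense (U n : set (Coo_space alpha)) &
        \bigcap_n U n `<=` S0 alpha].
Proof.
exists (@concentrated_set R alpha); split.
- by move=> n; exact: open_concentrated_set.
- by move=> n; exact: dense_concentrated_set.
move=> f fU.
have [F [Fl fF Fa]] := rotation_has_lift (set_valP f).
have [mu mu_inv] := invariant_measure_exists Fl Fa fF.
exists mu; last by apply: measure_dim_concentrated mu_inv _ => n; exact: fU.
split=> // nu nu_inv.
exact: (invariant_measure_unique Fl Fa fF (fun u v => @liouville_dense R alpha u v halpha)
  nu_inv mu_inv).
Qed.
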